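(* Let $N\ge 1$ and let $F$ be a closed (dotted) $GL(N)$-foam. Then the deformed evaluation $\langle F\rangle=\sum_c\langle F,c\rangle$, the sum over all colorings $c$ of $F$, a priori an element of the localization of $\mathbf{k}\llbracket x_1,\dots,x_N\rrbracket$ at the elements $x_i-x_j$ ($i<j$), is a symmetric power series in $x_1,\dots,x_N$: it lies in $\mathbf{k}\llbracket x_1,\dots,x_N\rrbracket^{S_N}$. In particular $\langle F\rangle$ is free of denominators.
   Context: **Coefficients.** $\mathbf{k}$ is a commutative graded ring with chosen homogeneous elements $\beta_{k,\ell}\in\mathbf{k}$ of degree $-2(k+\ell)$ for all integers $k,\ell\ge 0$, $(k,\ell)\neq(0,0)$ (universal case: $\mathbf{k}=\mathbb{Z}[\beta_{k,\ell}]$). Put $p(x,y)=1+\sum_{(k,\ell)\ne(0,0)}\beta_{k,\ell}x^ky^\ell\in\mathbf{k}\llbracket x,y\rrbracket$ (an invertible series) and $p_{ij}=p(x_i,x_j)$. The variables $x_i$ have degree $2$, and $S_N$ acts by permuting them. **Foams.** A closed $GL(N)$-foam $F$ is a compact two-dimensional piecewise-linear CW-complex embedded in $\mathbb{R}^3$. Its facets (connected components of the complement of the singular set) are oriented and carry a thickness $\ell(f)\in\{0,\dots,N\}$ (facets of thickness $0$ may be removed). Points are of three types: regular points of facets; points on singular edges, with neighbourhood (tripod)$\times$(interval), where three facets of thickness $a,b,a+b$ meet; singular vertices, where four singular edges meet and the six facet corners have thickness $a,b,c,a+b,b+c,a+b+c$ (the four edges having adjacent thicknesses $(a,b,a+b)$,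 $(a+b,c,a+b+c)$, $(b,c,b+c)$, $(a,b+c,a+b+c)$; such a vertex is the singular point of the cobordism between the two ways of splitting an edge of thickness $a+b+c$ into edges of thickness $a,b,c$). Orientations are compatible at a singular edge: the orientation of each of the two thinner facets agrees with that of the thick facet across the edge. The singular edge is oriented as follows: take an oriented basis $(v,t)$ coming from a thin facet, with $v$ pointing into the thick facet; then $t$ is the orientation of the edge. Each facet $f$ carries a homogeneous symmetric polynomial $P_f$ in $\ell(f)$ variables (the product of its dots). **Colorings.** A coloring $c$ assigns to each facet $f$ a subset $c(f)\subset\{1,\dots,N\}$ of cardinality $\ell(f)$ such that $c(f_3)=c(f_1)\sqcup c(f_2)$ whenever $f_1,f_2,f_3$ meet along a singular edge with $\ell(f_3)=\ell(f_1)+\ell(f_2)$. $F_i(c)$ is the closed surface that is the union of (closures of) facets $f$ with $i\in c(f)$; $F_{ij}(c)$ ($i\ne j$) is the closed orientable surface that is the union of facets $f$ such that $c(f)$ contains exactly one of $i,j$. Put $\chi_i(c)=\chi(F_i(c))$, $\chi_{ij}(c)=\chi(F_{ij}(c))$ (even integers). $P_f(c)$ is $P_f$ evaluated at the variables $x_k$, $k\in c(f)$. **Signs.** For $i<j$, $\theta^+_{ij}(c)$ is the number of positive circular seams on $F_{ij}(c)$, i.e. circles along which facets containing $i$ but not $j$, facets containing $j$ but not $i$, and facets containing both $i$ and $j$ in their color meet. A seam is positive according to the left hand rule: with the thumb of the left hand along the orientation of the seam, the fingers turn from the facet containing $i$ (not $j$) to the facet containing $j$ (not $i$), and then to the facet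 containing both. Put $\theta^+(c)=\sum_{i<j}\theta^+_{ij}(c)$ and $s'(F,c)=\theta^+(c)+\sum_{j=1}^N(j-1)\chi_j(c)/2$. **Evaluation.** $$\langle F,c\rangle=(-1)^{s'(F,c)}\prod_{f}P_f(c)\prod_{1\le i<j\le N}\frac{p_{ij}^{\chi_i(c)/2}\,p_{ji}^{\chi_j(c)/2}}{(x_i-x_j)^{\chi_{ij}(c)/2}}.$$ *)

(* Defs.v *)
From HB Require Import structures.
From mathcomp Require Import all_boot all_order all_fingroup all_algebra.
From mathcomp Require Import boolp reals.
From mathcomp Require Import mpoly.

Set Implicit Arguments.
Unset Strict Implicit.
Unset Printing Implicit Defensive.

Import Order.TTheory GRing.Theory Num.Theory.

Local Open Scope ring_scope.

Section PowerSeries.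
Variables (k : comNzRingType) (n : nat).

Definition mps : Type := 'X_{1..n} -> k.

HB.instance Definition _ := gen_eqMixin mps.
HB.instance Definition _ := gen_choiceMixin mps.

Implicit Types f g h : mps.

Definition mps_zero : mps := fun=> 0.
Definition mps_opp f : mps := fun m => - f m.
Definition mps_add f g : mps := fun m => f m + g m.
Definition mps_const (a : k) : mps := fun m => if m == 0%MM then a else 0.
Definition mps_mul f g : mps :=
  fun m => \sum_(l : 'X_{1..n < (mdeg m).+1} | (l <= m)%MM) f l * g (m - l)%MM.

Fact mps_addA : associative mps_add.
Proof. by move=> f g h; apply/funext=> m; rewrite /mps_add addrA. Qed.
Fact mps_addC : commutative mps_add.
Proof. by move=> f g; apply/funext=> m; rewrite /mps_add addrC. Qed.
Fact mps_add0 : left_id mps_zero mps_add.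
Proof. by move=> f; apply/funext=> m; rewrite /mps_add add0r. Qed.
Fact mps_addN : left_inverse mps_zero mps_opp mps_add.
Proof. by move=> f; apply/funext=> m; rewrite /mps_add addNr. Qed.

HB.instance Definition _ :=
  GRing.isZmodule.Build mps mps_addA mps_addC mps_add0 mps_addN.

(* The ring axioms are transported from {mpoly k[n]} by truncation. *)
Definition mps_trunc (d : nat) f : {mpoly k[n]} :=
  \sum_(m : 'X_{1..n < d}) f m *: 'X_[m].

Lemma mcoeff_trunc d f m : (mdeg m < d)%N -> (mps_trunc d f)@_m = f m.
Proof. exact: mcoeff_mpoly. Qed.

Lemma mcoeffM_agree (p q : {mpoly k[n]}) f g m :
  (forall l, (mdeg l <= mdeg m)%N -> p@_l = f l) ->
  (forall l, (mdeg l <= mdeg m)%N -> q@_l = g l) ->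
  (p * q)@_m = mps_mul f g m.
Proof.
move=> pf qg; rewrite /GRing.mul /= (mcoeff_poly_mul_lin _ _ (ltnSn _)).
apply: eq_bigr => l _; rewrite pf ?qg ?mdegB //.
exact: (bmdeg l).
Qed.

Fact mps_mulA : associative mps_mul.
Proof.
move=> f g h; apply/funext=> m; pose T := mps_trunc (mdeg m).+1.
have E u v l : (mdeg l <= mdeg m)%N -> (T u * T v)@_l = mps_mul u v l.
  by move=> lm; apply: mcoeffM_agree => j jl;
     apply: mcoeff_trunc; rewrite ltnS (leq_trans jl).
have E1 u l : (mdeg l <= mdeg m)%N -> (T u)@_l = u l.
  by move=> lm; apply: mcoeff_trunc.
rewrite -(mcoeffM_agree (E1 f) (E g h)) -(mcoeffM_agree (E f g) (E1 h)).
by rewrite mulrA.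
Qed.

Fact mps_mulC : commutative mps_mul.
Proof.
move=> f g; apply/funext=> m; pose T := mps_trunc (mdeg m).+1.
have E1 u l : (mdeg l <= mdeg m)%N -> (T u)@_l = u l.
  by move=> lm; apply: mcoeff_trunc.
rewrite -(mcoeffM_agree (E1 f) (E1 g)) -(mcoeffM_agree (E1 g) (E1 f)).
by rewrite mulrC.
Qed.

Fact mps_mul1 : left_id (mps_const 1) mps_mul.
Proof.
move=> f; apply/funext=> m; pose T := mps_trunc (mdeg m).+1.
have E1 u l : (mdeg l <= mdeg m)%N -> (T u)@_l = u l.
  by move=> lm; apply: mcoeff_trunc.
have E2 l : (mdeg l <= mdeg m)%N -> (1 : {mpoly k[n]})@_l = mps_const 1 l.
  by move=> _; rewrite mcoeff1 /mps_const; case: eqP.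
by rewrite -(mcoeffM_agree E2 (E1 f)) mul1r E1.
Qed.

Fact mps_mulDl : left_distributive mps_mul mps_add.
Proof.
move=> f g h; apply/funext=> m; rewrite /mps_mul /mps_add -big_split /=.
by apply: eq_bigr => j _; rewrite mulrDl.
Qed.

Fact mps_1_neq0 : mps_const 1 != (0 : mps).
Proof.
apply/eqP=> /(congr1 (fun f : mps => f 0%MM)).
by rewrite /mps_const eqxx; apply/eqP/oner_neq0.
Qed.

HB.instance Definition _ := GRing.Zmodule_isComNzRing.Build mps
  mps_mulA mps_mulC mps_mul1 mps_mulDl mps_1_neq0.

Definition mps_var (i : 'I_n) : mps := fun m => (m == U_(i)%MM)%:R.

Definition mps_perm (s : 'S_n) (f : mps) : mps :=
  fun m => f [multinom m (s i) | i < n].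

Definition mps_symmetric (f : mps) : Prop := forall s : 'S_n, mps_perm s f = f.

(* A polynomial in l variables evaluated at the variables x_i, i \in A, taken
   in increasing order; it is meant for #|A| = l. *)
Definition eval_at (l : nat) (p : {mpoly k[l]}) (A : {set 'I_n}) : mps :=
  mmap mps_const (fun a : 'I_l => nth 0 [seq mps_var i | i <- enum A] a) p.

(* The coefficient of x^a y^b in p(x, y) = 1 + \sum beta_ab x^a y^b; the value
   beta 0 0 is never used. *)
Definition p_coef (beta : nat -> nat -> k) (a b : nat) : k :=
  if (a == 0%N) && (b == 0%N) then 1 else beta a b.

(* p(x_i, x_j), for i != j. *)
Definition p_series (beta : nat -> nat -> k) (i j : 'I_n) : mps :=
  fun m => if [forall l, (l != i) && (l != j) ==> (m l == 0%N)]
           then p_coef beta (m i) (m j) else 0.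

(* The multiplicative set generated by the x_i - x_j, i < j. *)
Definition denominator (s : mps) : Prop :=
  exists e : 'I_n -> 'I_n -> nat,
    s = \prod_(i < n) \prod_(j < n | (i < j)%N) (mps_var i - mps_var j) ^+ e i j.

End PowerSeries.

Definition is_localization (A : comNzRingType) (S : A -> Prop)
    (L : comUnitRingType) (iota : {rmorphism A -> L}) : Prop :=
  [/\ forall s, S s -> iota s \is a GRing.unit,
      forall z : L, exists a s, S s /\ z = iota a / iota s
    & forall a, iota a = 0 -> exists s, S s /\ s * a = 0].

Record grading (k : comNzRingType) := Grading {
  homogeneous : int -> k -> Prop;
  homogeneous0 : forall d, homogeneous d 0;
  homogeneousB : forall d a b, homogeneous d a -> homogeneous d b -> homogeneous d (a - b);
  homogeneous1 : homogeneous 0 1;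
  homogeneousM : forall d e a b, homogeneous d a -> homogeneous e b -> homogeneous (d + e) (a * b);
  homogeneous_span : forall a, exists (s : seq int) (f : int -> k),
    (forall d, homogeneous d (f d)) /\ a = \sum_(d <- s) f d;
  homogeneous_direct : forall (s : seq int) (f : int -> k),
    uniq s -> (forall d, homogeneous d (f d)) -> \sum_(d <- s) f d = 0 ->
    forall d, d \in s -> f d = 0
}.

(* Homogeneity for the total grading in which every variable has degree 2. *)
Definition mpoly_homog (k : comNzRingType) (gr : grading k) (l : nat)
    (p : {mpoly k[l]}) : Prop :=
  exists d : int, forall m, homogeneous gr (d - (2 * mdeg m)%:Z) p@_m.

(* A foam is presented by a triangulation with straight simplices in R^3.
   Triangles are oriented: corner t lists the vertices of t, and only their
   cyclic order matters.  Facets are indexed by a finite type, facet_of t being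
   the facet that contains the interior of t. *)
Record prefoam (R : realType) := Prefoam {
  vert : finType;
  tri : finType;
  facet : finType;
  pos : vert -> 'rV[R]_3;
  corner : tri -> 'I_3 -> vert;
  facet_of : tri -> facet;
  thickness : facet -> nat
}.

Section Prefoam.
Variables (R : realType) (F : prefoam R).
Implicit Types (u v w : vert F) (t : tri F) (C : {set tri F}).

Definition verts_of t : {set vert F} := [set corner t i | i : 'I_3].

(* (u, w) is a directed edge of the oriented boundary of t. *)
Definition dart t u w : bool :=
  [exists i, (corner t i == u) && (corner t (ordS i) == w)].

Definition has_edge t u w : bool := dart t u w || dart t w u.

(* Exactly two triangles meet along uw, with compatible orientations. *)
Definition regular_edge u w : bool :=
  (#|[set t | dart t u w]| == 1%N) && (#|[set t | dart t w u]| == 1%N).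

(* Exactly three triangles meet along uw: t1 and t2 from the thin facets, t3
   from the thick one.  The orientations of t1 and t2 agree with that of t3
   across uw, that is, they induce on uw the direction opposite to the one
   induced by t3.  If v is tangent to t1 and points into the thick facet, then v
   points out of t1, so that (v, w - u) is an oriented basis for t1 exactly when
   u -> w is the boundary direction of t1: the seam is oriented from u to w. *)
Definition seam_at u w t1 t2 t3 : bool :=
  [&& t1 != t2, [set t | dart t u w] == [set t1; t2]
    & [set t | dart t w u] == [set t3]].

Definition seam u w : bool :=
  [exists t1, exists t2, exists t3, seam_at u w t1 t2 t3].

(* Barycentric coordinates of the points of the geometric realization. *)
Definition barycentric (a : vert F -> R) : Prop :=
  [/\ forall v, 0 <= a v, \sum_v a v = 1
    & exists t, forall v, a v != 0 -> v \in verts_of t].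

Definition embedded : Prop :=
  forall a b, barycentric a -> barycentric b ->
    \sum_v a v *: pos v = \sum_v b v *: pos v -> a =1 b.

Definition star v : {set tri F} := [set t | v \in verts_of t].

Definition adjacent_at v : rel (tri F) := fun t t' =>
  [exists w, [&& regular_edge v w, has_edge t v w & has_edge t' v w]].

Definition adjacent : rel (tri F) := fun t t' => [exists v, adjacent_at v t t'].

(* The corners of facets at v: the pieces into which the seams through v cut
   a small neighbourhood of v. *)
Definition sectors v : {set {set tri F}} :=
  equivalence_partition (connect (adjacent_at v)) (star v).

Definition seam_nbrs v : {set vert F} := [set w | seam v w || seam w v].

(* Along the singular edge vw, the thin sectors are C1, C2, the thick one C3. *)
Definition joint v w C1 C2 C3 : bool :=
  [exists t1 in C1, exists t2 in C2, exists t3 in C3,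
    seam_at v w t1 t2 t3 || seam_at w v t1 t2 t3].

(* The link of v is a circle. *)
Definition regular_point v : Prop :=
  seam_nbrs v = set0 /\ exists C, sectors v = [set C].

(* The link of v is a theta graph: v has a neighbourhood tripod * interval. *)
Definition seam_point v : Prop :=
  exists w1 w2 C1 C2 C3,
    [/\ uniq [:: w1; w2], seam_nbrs v =i [:: w1; w2],
        uniq [:: C1; C2; C3], sectors v =i [:: C1; C2; C3]
      & joint v w1 C1 C2 C3 /\ joint v w2 C1 C2 C3].

(* The link of v is the complete graph K_4, with sectors of thickness a, b, c,
   a + b, b + c and a + b + c. *)
Definition singular_vertex v : Prop :=
  exists w1 w2 w3 w4 Ca Cb Cc Cab Cbc Cabc,
    [/\ uniq [:: w1; w2; w3; w4],
        seam_nbrs v =i [:: w1; w2; w3; w4],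
        uniq [:: Ca; Cb; Cc; Cab; Cbc; Cabc],
        sectors v =i [:: Ca; Cb; Cc; Cab; Cbc; Cabc]
      & [/\ joint v w1 Ca Cb Cab, joint v w2 Cab Cc Cabc,
            joint v w3 Cb Cc Cbc & joint v w4 Ca Cbc Cabc]].

Record is_foam (N : nat) : Prop := IsFoam {
  foam_corner_inj : forall t, injective (corner t);
  foam_verts_inj : injective verts_of;
  foam_embedded : embedded;
  foam_edge : forall t u w, dart t u w ->
    [|| regular_edge u w, seam u w | seam w u];
  foam_vertex : forall v,
    [\/ regular_point v, seam_point v | singular_vertex v];
  foam_facet : forall t t', (facet_of t = facet_of t') <-> connect adjacent t t';
  foam_facet_surj : forall f, exists t, facet_of t = f;
  foam_thickness_le : forall f : facet F, (thickness f <= N)%N;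
  foam_thickness : forall u w t1 t2 t3, seam_at u w t1 t2 t3 ->
    thickness (facet_of t3)
      = (thickness (facet_of t1) + thickness (facet_of t2))%N
}.

Definition verts C : {set vert F} := \bigcup_(t in C) verts_of t.
Definition edges C : {set {set vert F}} :=
  [set [set e.1; e.2] | e : vert F * vert F
                      & [exists t in C, dart t e.1 e.2]].
Definition euler C : int := #|verts C|%:Z - #|edges C|%:Z + #|C|%:Z.

Variable N : nat.
Implicit Types (c : {ffun facet F -> {set 'I_N}}) (i j : 'I_N).

Definition is_coloring c : bool :=
  [forall f, #|c f| == thickness f] &&
  [forall u, forall w, forall t1, forall t2, forall t3,
    seam_at u w t1 t2 t3 ==>
      ([disjoint c (facet_of t1) & c (facet_of t2)] &&
       (c (facet_of t3) == c (facet_of t1) :|: c (facet_of t2)))].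

Definition surface1 c i : {set tri F} := [set t | i \in c (facet_of t)].
Definition surface2 c i j : {set tri F} :=
  [set t | (i \in c (facet_of t)) (+) (j \in c (facet_of t))].

(* The Euler characteristics are even, so these divisions are exact. *)
Definition half_chi1 c i : int := (euler (surface1 c i) %/ 2)%Z.
Definition half_chi2 c i j : int := (euler (surface2 c i j) %/ 2)%Z.

Definition bicolored_at c i j u w t1 t2 t3 : bool :=
  [&& seam_at u w t1 t2 t3,
      (i \in c (facet_of t1)) && (j \notin c (facet_of t1)),
      (j \in c (facet_of t2)) && (i \notin c (facet_of t2))
    & (i \in c (facet_of t3)) && (j \in c (facet_of t3))].

Definition bicolored_seam c i j (e : vert F * vert F) : bool :=
  [exists t1, exists t2, exists t3, bicolored_at c i j e.1 e.2 t1 t2 t3].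

Definition seam_linked c i j : rel (vert F * vert F) := fun e e' =>
  [&& bicolored_seam c i j e, bicolored_seam c i j e'
    & ~~ [disjoint [set e.1; e.2] & [set e'.1; e'.2]]].

(* The edges counted by bicolored_seam form disjoint circles; each circle is
   recorded as the set of its oriented edges. *)
Definition circular_seams c i j : {set {set vert F * vert F}} :=
  equivalence_partition (connect (seam_linked c i j))
                        [set e | bicolored_seam c i j e].

Definition det3 (x y z : 'rV[R]_3) : R :=
  \det (\matrix_(a < 3) nth 0 [:: x; y; z] a).

(* The half-planes bounded by the axis directed by d and containing q1, q2, q3
   occur in the cyclic order q1, q2, q3 for the left-handed rotation about d.
   det3 d q q' > 0 means that the right-handed rotation from the half-plane of q
   to that of q' is by an angle less than pi.  For three distinct half-planes,
   the cyclic order is right-handed when at least two of the three determinants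
   are positive, and left-handed when at least two of them are negative. *)
Definition left_handed (d q1 q2 q3 : 'rV[R]_3) : bool :=
  Num.sg (det3 d q1 q2) + Num.sg (det3 d q2 q3) + Num.sg (det3 d q3 q1) < 0.

(* The left hand rule, with q1, q2, q3 the third vertices of the triangles that
   contain i only, j only, and both. *)
Definition positive_edge c i j (e : vert F * vert F) : bool :=
  [exists t1, exists t2, exists t3, exists v1, exists v2, exists v3,
    [&& bicolored_at c i j e.1 e.2 t1 t2 t3,
        verts_of t1 == [set e.1; e.2; v1],
        verts_of t2 == [set e.1; e.2; v2],
        verts_of t3 == [set e.1; e.2; v3]
      & left_handed (pos e.2 - pos e.1) (pos v1 - pos e.1)
                    (pos v2 - pos e.1) (pos v3 - pos e.1)]].

Definition theta_plus2 c i j : nat :=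
  #|[set S in circular_seams c i j | [forall e in S, positive_edge c i j e]]|.

Definition theta_plus c : nat :=
  \sum_(i < N) \sum_(j < N | (i < j)%N) theta_plus2 c i j.

(* Colors are numbered from 0, whence j in place of j - 1. *)
Definition sign_exp c : int :=
  (theta_plus c)%:Z + \sum_(j < N) j%:Z * half_chi1 c j.

End Prefoam.

Record foam (R : realType) (N : nat) := Foam {
  foam_data :> prefoam R;
  foamP : is_foam foam_data N
}.

Record dots (R : realType) (F : prefoam R)
    (k : comNzRingType) (gr : grading k) := Dots {
  dot :> forall f : facet F, {mpoly k[thickness f]};
  dot_sym : forall f, dot f \is symmetric;
  dot_homog : forall f, mpoly_homog gr (dot f)
}.

Section Evaluation.
Variables (R : realType) (N : nat) (F : foam R N).
Variables (k : comNzRingType) (gr : grading k) (beta : nat -> nat -> k).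
Variable P : dots F gr.
Variables (L : comUnitRingType) (iota : {rmorphism mps k N -> L}).

Definition coloring_eval (c : {ffun facet F -> {set 'I_N}}) : L :=
  (-1) ^ sign_exp c *
  (\prod_(f : facet F) iota (eval_at (P f) (c f))) *
  \prod_(i < N) \prod_(j < N | (i < j)%N)
    (iota (p_series beta i j) ^ half_chi1 c i *
     iota (p_series beta j i) ^ half_chi1 c j /
     iota (mps_var k i - mps_var k j) ^ half_chi2 c i j).

Definition foam_eval : L :=
  \sum_(c : {ffun facet F -> {set 'I_N}} | is_coloring c) coloring_eval c.

End Evaluation.

(* Main.v *)
(** For adjacent colors i and j = i + 1, let C be a component of the surface
    F_ij(c).  Exchanging i and j on the facets of C yields a coloring, the Euler
    characteristics chi_k and chi_kl change by restricted Euler characteristics of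
    C, and s' changes by chi(C)/2 modulo 2.  The latter rests on two facts:
    whether a bicolored seam is positive does not change along its circle, which is
    a statement about theta graphs on the link sphere of a vertex, and the parity
    of the number of circles of a given kind is the sign of a permutation of the
    vertices, so that all parities become products of signs.

    Exchanging i and j on the whole of F_ij(c) shows that the evaluation is
    invariant under the transposition of x_i and x_j.  For the denominators, group
    the colorings into orbits of the exchanges on the spherical components of
    F_ij(c).  The sum over an orbit is a common factor times a product, over these
    spheres, of differences of two terms that agree modulo x_i - x_j, hence it is
    divisible by a power of x_i - x_j with exponent the number of spheres, which is
    at least chi_ij(c)/2.  So the sum has no pole along x_i = x_j, and by symmetry
    none along any x_a = x_b; as the x_a - x_b are regular modulo each other, this
    makes it a power series. *)

(* Adjacency of i and j enters twice: every other color lies on the same side of both, so that only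
   the pair (i, j) changes order, and the weights j - 1 in s' differ by exactly 1. An exchange
   recuts the seams that involve a third color k: circles of types ik and jk are cut where they
   cross the region and glued differently, so their separate numbers are not controlled. Only the
   parity of the total is stable, which is why signs of permutations replace counts. The statement
   on theta graphs is proved by linear algebra instead of topology: arcs are viewed along the
   meridians of a generic pole, each endpoint records whether an arc passes above or below it, and
   disjointness of arcs is a statement about cones, read off from the embedding. The classification
   of surfaces is likewise avoided: closed surfaces have even Euler characteristic by a comparison
   of signs of permutations of darts, and connected ones have at most 2 by ranks over F_2. *)
From HB Require Import structures.
From mathcomp Require Import all_boot all_order all_fingroup all_algebra.
From mathcomp Require Import boolp reals.
From mathcomp Require Import mpoly zify ring lra.
Require Import Defs.

Set Implicit Arguments.
Unset Strict Implicit.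
Unset Printing Implicit Defensive.

Import Order.TTheory GRing.Theory Num.Theory.

(** * Signs of permutations *)

Section Permutations.
Local Open Scope group_scope.

Lemma card_imset_kernel (T U V : finType) (f : T -> U) (g : T -> V)
    (D : {set T}) :
  {in D &, forall x y, (f x == f y) = (g x == g y)} -> #|f @: D| = #|g @: D|.
Proof.
move=> fg; have [->|[x0 _]] := set_0Vmem D; first by rewrite !imset0 !cards0.
pose h u := g (odflt x0 [pick x in D | f x == u]).
have hf x : x \in D -> h (f x) = g x.
  move=> Dx; rewrite /h; case: pickP => [y /andP[Dy /eqP fy]|/(_ x)].
    by apply/eqP; rewrite -fg ?fy.
  by rewrite Dx eqxx.
have -> : g @: D = h @: (f @: D).
  by rewrite -imset_comp; apply: eq_in_imset => x Dx /=; rewrite hf.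
rewrite [RHS]card_in_imset // => _ _ /imsetP[x Dx ->] /imsetP[y Dy ->].
by rewrite !hf // => /eqP; rewrite -fg // => /eqP.
Qed.

(** The sign of [s] is the parity of the number of points minus the number of cycles. Points outside
    [D] are cycles of their own and cancel, and the orbits in [D] may be counted by any labels that
    separate exactly them: later these are edges, vertices or circles of seams. *)
Lemma odd_perm_labels (T U : finType) (s : {perm T}) (D : {set T})
    (f : T -> U) :
  (forall x, x \notin D -> s x = x) ->
  {in D &, forall x y, (y \in porbit s x) = (f x == f y)} ->
  odd_perm s = odd #|D| (+) odd #|f @: D|.
Proof.
move=> sD fP; have porbit_out x : x \notin D -> porbit s x = [set x].
  move=> /sD sx; apply/setP=> y; rewrite inE; apply/porbitP/eqP => [[n ->]|->].
    by elim: n => [|n IH]; rewrite ?expg0 ?perm1 // expgSr permM IH.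
  by exists 0%N; rewrite expg0 perm1.
have split_orbits : porbits s = (porbit s @: D) :|: (porbit s @: ~: D).
  by rewrite -imsetU setUCr /porbits; apply/setP => x; apply/imsetP/imsetP;
     case=> y _ ->; exists y.
have disj : [disjoint porbit s @: D & porbit s @: ~: D].
  apply/pred0P => C /=; apply/negP => /andP[/imsetP[x Dx ->]].
  case/imsetP=> y; rewrite inE => Dy /eqP.
  rewrite eq_porbit_mem porbit_out ?inE // => /eqP xy.
  by move: Dy; rewrite -xy Dx.
have cardD : #|porbit s @: D| = #|f @: D|.
  by apply: card_imset_kernel => x y Dx Dy;
     rewrite eq_porbit_mem porbit_sym fP.
have cardC : #|porbit s @: ~: D| = #|~: D|.
  apply: card_in_imset => x y; rewrite !inE => Dx Dy.
  by rewrite !porbit_out // => /set1_inj.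
rewrite /odd_perm -(cardsC D) split_orbits.
have /eqP-> : #|porbit s @: D :|: porbit s @: ~: D|
    == (#|porbit s @: D| + #|porbit s @: ~: D|)%N.
  by rewrite (leq_card_setU _ _).2.
by rewrite cardD cardC !oddD addbACA addbb addbF.
Qed.

(** On [D] the two permutations are conjugate by [h], and elsewhere both are trivial, so their
    nontrivial cycles correspond. *)
Lemma odd_perm_transport (T U : finType) (s : {perm T}) (r : {perm U})
    (D : {set T}) (h : T -> U) :
  {in D &, injective h} ->
  (forall x, x \notin D -> s x = x) ->
  (forall y, y \notin h @: D -> r y = y) ->
  {in D, forall x, s x \in D /\ h (s x) = r (h x)} ->
  odd_perm s = odd_perm r.
Proof.
move=> h_inj sD rD hs.
have hsn n x : x \in D -> (s ^+ n) x \in D /\ h ((s ^+ n) x) = (r ^+ n) (h x).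
  move=> Dx; elim: n => [|n [IHD IH]]; first by rewrite !expg0 !perm1.
  by rewrite !expgSr !permM -IH; apply: hs.
rewrite (@odd_perm_labels _ _ s D (fun x => porbit r (h x)) sD); last first.
  move=> x y Dx Dy; rewrite eq_porbit_mem porbit_sym.
  apply/porbitP/porbitP => [[n ->]|[n hn]]; exists n.
    by case: (hsn n y Dy).
  by case: (hsn n y Dy) => Dn hsnx; apply: h_inj => //; rewrite hsnx.
rewrite (@odd_perm_labels _ _ r (h @: D) (porbit r) rD); last first.
  by move=> x y _ _; rewrite eq_porbit_mem porbit_sym.
by rewrite -imset_comp (card_in_imset h_inj).
Qed.

(* The permutation p1^-1 * p2 preserves W, and q1, q2 are obtained from p1 by
   multiplication by its restrictions to W and to the complement of W. *)
Lemma odd_perm_exchange (T : finType) (W : {set T}) (p1 p2 q1 q2 : {perm T}) :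
  (forall v, q1 v = if v \in W then p2 v else p1 v) ->
  (forall v, q2 v = if v \in W then p1 v else p2 v) ->
  odd_perm q1 (+) odd_perm q2 = odd_perm p1 (+) odd_perm p2.
Proof.
move=> q1P q2P.
have -> : odd_perm q1 (+) odd_perm q2 = odd_perm (p1^-1 * q1 * (p1^-1 * q2)).
  by rewrite !odd_permM odd_permV; case: (odd_perm p1);
     case: (odd_perm q1); case: (odd_perm q2).
suff -> : p1^-1 * q1 * (p1^-1 * q2) = p1^-1 * p2.
  by rewrite odd_permM odd_permV.
pose W1 := [set p1 v | v in W].
have inW1 y : (y \in W1) = (p1^-1 y \in W).
  apply/imsetP/idP => [[v Wv ->]|Wy]; first by rewrite permK.
  by exists (p1^-1 y); rewrite ?permKV.
pose r := p1^-1 * q1.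
have rE y : r y = if y \in W1 then p2 (p1^-1 y) else y.
  by rewrite permM q1P inW1; case: ifP => // _; rewrite permKV.
(* [r] fixes every point outside [W1], so by injectivity it cannot move a point of [W1] out of
   it. *)
have rW y : (r y \in W1) = (y \in W1).
  have sub : [set r z | z in ~: W1] = ~: W1.
    rewrite -[RHS]imset_id; apply: eq_in_imset => z; rewrite inE rE => /negbTE.
    by move->.
  apply/idP/idP => [|yW].
    by apply: contraLR => nW; rewrite rE (negbTE nW).
  apply: contraT => nW.
  have : r y \in ~: W1 by rewrite inE.
  rewrite -sub => /imsetP[z zW /perm_inj yz].
  by move: zW; rewrite -yz inE yW.
apply/permP => y; rewrite permM -/r [LHS]permM q2P -inW1 rW.
case: ifP => yW; first by rewrite permKV rE yW permM.
by rewrite rE yW permM.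
Qed.

End Permutations.

(** * Triangles and edges *)

Section Triangles.
Variables (R : realType) (N : nat) (F : prefoam R) (hF : is_foam F N).
Implicit Types (u v w x : vert F) (t : tri F) (Y : {set tri F}).

Let cornerI := foam_corner_inj hF.

Lemma ordS3 (i : 'I_3) : ordS (ordS (ordS i)) = i.
Proof. by apply/val_inj; case: i => [[|[|[|]]]]. Qed.

Lemma ordS_cases (i l : 'I_3) : [\/ l = i, l = ordS i | l = ordS (ordS i)].
Proof.
case: i l => [[|[|[|i]]] hi] [[|[|[|l]]] hl] //;
  by [constructor 1; apply/val_inj | constructor 2; apply/val_inj
     | constructor 3; apply/val_inj].
Qed.

Lemma ordS_neq (i : 'I_3) : ordS i != i.
Proof. by case: i => [[|[|[|]]]]. Qed.

Lemma dartP t u w :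
  reflect (exists i, u = corner t i /\ w = corner t (ordS i)) (dart t u w).
Proof.
apply: (iffP existsP) => [[i /andP[/eqP <- /eqP <-]]|[i [-> ->]]]; exists i => //.
by rewrite !eqxx.
Qed.

Lemma dart_neq t u w : dart t u w -> u != w.
Proof.
case/dartP=> i [-> ->]; apply/eqP => /cornerI /eqP.
by rewrite eq_sym (negbTE (ordS_neq i)).
Qed.

Lemma dart_next t u w : dart t u w ->
  exists x, [/\ dart t w x, dart t x u & verts_of t = [set u; w; x]].
Proof.
case/dartP=> i [-> ->]; exists (corner t (ordS (ordS i))); split.
- by apply/dartP; exists (ordS i).
- by apply/dartP; exists (ordS (ordS i)); rewrite ordS3.
apply/setP => x; rewrite !inE; apply/imsetP/idP => [[l _ ->]|].
  by case: (ordS_cases i l) => ->; rewrite eqxx ?orbT.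
by rewrite -orbA; case/or3P => /eqP->; [exists i|exists (ordS i)|exists (ordS (ordS i))].
Qed.

Lemma dart_inj_r t u w w' : dart t u w -> dart t u w' -> w = w'.
Proof. by case/dartP=> i [-> ->] /dartP[l [/cornerI <- ->]]. Qed.

Lemma dart_inj_l t u u' w : dart t u w -> dart t u' w -> u = u'.
Proof.
case/dartP=> i [-> ->] /dartP[l [-> /cornerI /(congr1 (fun i => ordS (ordS i)))]].
by rewrite !ordS3 => ->.
Qed.

Lemma dart_asym t u w : dart t u w -> ~~ dart t w u.
Proof.
move=> tuw; apply/negP => twu; have [x [twx txu _]] := dart_next tuw.
by have := dart_neq txu; rewrite (dart_inj_r twx twu) eqxx.
Qed.

Lemma mem_verts_of t v :
  reflect (exists a b, [/\ dart t v a, dart t a b & dart t b v])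
          (v \in verts_of t).
Proof.
apply: (iffP imsetP) => [[i _ ->]|[a [b [/dartP[i [-> _]] _ _]]]]; last by exists i.
have tia : dart t (corner t i) (corner t (ordS i)) by apply/dartP; exists i.
by have [x [? ? _]] := dart_next tia; exists (corner t (ordS i)), x.
Qed.

Lemma dart_verts t u w : dart t u w -> (u \in verts_of t) /\ (w \in verts_of t).
Proof.
case/dartP => i [-> ->].
by split; apply/imsetP; [exists i | exists (ordS i)].
Qed.

Lemma has_edge_sym t u w : has_edge t u w = has_edge t w u.
Proof. by rewrite /has_edge orbC. Qed.

Lemma has_edge_verts t u w : has_edge t u w -> (u \in verts_of t) /\ (w \in verts_of t).
Proof. by case/orP => /dart_verts []. Qed.

Lemma verts_of_has_edge t u w :
  u \in verts_of t -> w \in verts_of t -> u != w -> has_edge t u w.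
Proof.
move/mem_verts_of=> [a [b [tua tab tbu]]].
have [x [tax txu ->]] := dart_next tua.
rewrite !inE -orbA => /or3P[] /eqP-> //; rewrite ?eqxx // /has_edge ?tua //.
by rewrite txu orbT.
Qed.

Definition nxt t u := odflt u [pick w | dart t u w].

Lemma nxtE t u w : dart t u w -> nxt t u = w.
Proof.
rewrite /nxt => tuw; case: pickP => [w' tuw'|/(_ w)]; last by rewrite tuw.
exact: dart_inj_r tuw' tuw.
Qed.

Lemma dart_nxt t u : u \in verts_of t -> dart t u (nxt t u).
Proof. by case/mem_verts_of => a [b [tua _ _]]; rewrite (nxtE tua). Qed.

Lemma dart_prv t u : u \in verts_of t -> dart t (nxt t (nxt t u)) u.
Proof.
case/mem_verts_of => a [b [tua tab tbu]].
by rewrite (nxtE tua) (nxtE tab).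
Qed.

Lemma card_verts_of t : #|verts_of t| = 3.
Proof. by rewrite card_imset ?card_ord. Qed.

(** The alternatives of [foam_edge] seen from [t]: an edge inside a facet, a seam on which [t] is a
    thin sheet and runs along the seam, or a seam on which [t] is the thick sheet and runs against
    it. *)
Lemma dart_cases t u w : dart t u w ->
  [\/ exists t', [/\ [set t | dart t u w] = [set t],
                     [set t | dart t w u] = [set t'],
                     facet_of t' = facet_of t & regular_edge u w],
      exists t2 t3, seam_at u w t t2 t3
    | exists t1 t2, seam_at w u t1 t2 t].
Proof.
move=> tuw; case/or3P: (foam_edge hF tuw).
- move=> reg; case/andP: (reg) => /cards1P[t1 E1] /cards1P[t' E2].
  constructor 1; exists t'.
  have /set1P Et : t \in [set t1] by rewrite -E1 inE.
  rewrite Et in tuw *; split=> //.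
  apply/(foam_facet hF); apply: connect1; apply/existsP; exists u.
  apply/existsP; exists w; rewrite reg /has_edge tuw andbT /=.
  have : t' \in [set t' | dart t' w u] by rewrite E2 set11.
  by rewrite inE => ->; rewrite orbT.
- case/existsP=> t1 /existsP[t2 /existsP[t3 s]]; constructor 2.
  case/and3P: (s) => n12 /eqP E1 E2.
  have : t \in [set t1; t2] by rewrite -E1 inE.
  case/set2P => ->; first by exists t2, t3.
  by exists t1, t3; rewrite /seam_at eq_sym n12 E1 setUC eqxx.
- case/existsP=> t1 /existsP[t2 /existsP[t3 s]]; constructor 3.
  case/and3P: (s) => n12 E1 /eqP E2.
  have /set1P Et : t \in [set t3] by rewrite -E2 inE.
  by exists t1, t2; rewrite Et.
Qed.

Lemma seam_atE u w t1 t2 t3 : seam_at u w t1 t2 t3 ->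
  (forall t, dart t u w = (t == t1) || (t == t2)) /\
  (forall t, dart t w u = (t == t3)).
Proof.
case/and3P=> _ /eqP E1 /eqP E2; split=> t; last by rewrite -in_set1 -E2 inE.
by rewrite -in_set2 -E1 inE.
Qed.

Lemma seam_at_swap u w t1 t2 t3 : seam_at u w t1 t2 t3 -> seam_at u w t2 t1 t3.
Proof.
by case/and3P => n12 E1 E2; rewrite /seam_at eq_sym n12 setUC E1.
Qed.

Lemma seam_at_asym u w t1 t2 t3 t1' t2' t3' :
  seam_at u w t1 t2 t3 -> ~~ seam_at w u t1' t2' t3'.
Proof.
case/and3P=> n12 /eqP E1 _; apply/negP => /and3P[_ _ /eqP E2].
by have := congr1 (fun A : {set _} => #|A|) E2; rewrite E1 cards2 n12 cards1.
Qed.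

End Triangles.

(** * Circles of darts and the parity of the Euler characteristic *)

Section CircleSets.
Variable V : finType.
Implicit Types (Z : {set V * V}) (u v w x : V).

(** A union of disjoint directed cycles, encoded as a partial bijection of the vertices whose domain
    is its image. *)
Definition circle_set Z : Prop :=
  [/\ forall u w w', (u, w) \in Z -> (u, w') \in Z -> w = w',
      forall u u' w, (u, w) \in Z -> (u', w) \in Z -> u = u',
      forall u w, (u, w) \in Z -> exists x, (w, x) \in Z
    & forall u w, (u, w) \in Z -> exists x, (x, u) \in Z].

Definition circ_succ Z u := odflt u [pick w | (u, w) \in Z].

(* The default value 1 is used only when Z is not a circle set. *)
Definition circ Z : {perm V} := insubd (1%g : {perm V}) [ffun u => circ_succ Z u].

(** The parity of the number of circles: [circ Z] permutes the #|Z| sources with one cycle for each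
    circle, so its sign is the parity of #|Z| minus that number. *)
Definition tau Z : bool := odd_perm (circ Z) (+) odd #|Z|.

Lemma circ_succE Z u w : circle_set Z -> (u, w) \in Z -> circ_succ Z u = w.
Proof.
case=> Zf _ _ _ uw; rewrite /circ_succ; case: pickP => [x ux|/(_ w)].
  exact: Zf ux uw.
by rewrite uw.
Qed.

Lemma circ_succ_id Z u : (forall w, (u, w) \notin Z) -> circ_succ Z u = u.
Proof.
by move=> nu; rewrite /circ_succ; case: pickP => // x; rewrite (negbTE (nu x)).
Qed.

Lemma circ_succP Z u :
  (forall w, (u, w) \notin Z) \/ (exists w, (u, w) \in Z).
Proof.
case: (pickP (fun w => (u, w) \in Z)) => [w uw|nu]; first by right; exists w.
by left => w; rewrite nu.
Qed.

Lemma circ_permE Z u : circle_set Z -> circ Z u = circ_succ Z u.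
Proof.
move=> Zc; suff Zi : injectiveb [ffun u => circ_succ Z u].
  by rewrite -pvalE /circ val_insubd Zi ffunE.
apply/injectiveP => a b; rewrite !ffunE; case: (Zc) => _ Zg Zo Zi.
have [na|[a' aa']] := circ_succP Z a; have [nb|[b' bb']] := circ_succP Z b.
- by rewrite !circ_succ_id.
- rewrite (circ_succ_id na) (circ_succE Zc bb') => E; have [x] := Zo _ _ bb'.
  by rewrite -E (negbTE (na x)).
- rewrite (circ_succ_id nb) (circ_succE Zc aa') => E; have [x] := Zo _ _ aa'.
  by rewrite E (negbTE (nb x)).
rewrite (circ_succE Zc aa') (circ_succE Zc bb') => E; rewrite -E in bb'.
exact: Zg aa' bb'.
Qed.

Lemma circE Z u w : circle_set Z -> (u, w) \in Z -> circ Z u = w.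
Proof. by move=> Zc uw; rewrite circ_permE // (circ_succE Zc uw). Qed.

Lemma circ_id Z u : circle_set Z -> (forall w, (u, w) \notin Z) -> circ Z u = u.
Proof. by move=> Zc uw; rewrite circ_permE // (circ_succ_id uw). Qed.

End CircleSets.

Section Parity.
Variables (R : realType) (N : nat) (F : prefoam R) (hF : is_foam F N).
Implicit Types (u v w x : vert F) (t : tri F) (Y : {set tri F}).

Definition darts Y : {set vert F * vert F} :=
  [set e | [exists t in Y, dart t e.1 e.2]].

Definition boundary Y := [set e in darts Y | (e.2, e.1) \notin darts Y].

(** With [fan_connected], this makes [Y] an oriented surface, possibly with boundary: no edge is
    used twice in one direction, and no vertex is a pinch point. *)
Definition dart_uniq Y := forall t t' u w,
  t \in Y -> t' \in Y -> dart t u w -> dart t' u w -> t = t'.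

Definition fan Y v : rel (tri F) := fun t t' =>
  [&& t \in Y, t' \in Y & [exists w, has_edge t v w && has_edge t' v w]].

Definition fan_connected Y := forall v t t',
  t \in Y -> t' \in Y -> v \in verts_of t -> v \in verts_of t' ->
  connect (fan Y v) t t'.

Lemma dartsP Y u w :
  reflect (exists2 t, t \in Y & dart t u w) ((u, w) \in darts Y).
Proof.
rewrite inE /=; apply: (iffP existsP) => [[t /andP[tY d]]|[t tY d]]; exists t => //.
by rewrite tY.
Qed.

Lemma vertsP Y v : reflect (exists2 t, t \in Y & v \in verts_of t) (v \in verts Y).
Proof. exact: bigcupP. Qed.

Lemma darts_out_card Y v : dart_uniq Y ->
  #|[set w | (v, w) \in darts Y]| = #|[set t in Y | v \in verts_of t]|.
Proof.
move=> Yu; rewrite -(card_in_imset (f := fun t => nxt t v)).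
  apply: eq_card => w; rewrite inE; apply/dartsP/imsetP => [[t tY vw]|].
    exists t; last by rewrite (nxtE hF vw).
    by rewrite inE tY; case: (dart_verts vw).
  by case=> t; rewrite inE => /andP[tY vt] ->; exists t => //; apply: (dart_nxt hF).
move=> t t'; rewrite !inE => /andP[tY vt] /andP[t'Y vt'] E.
by apply: (Yu t t' v (nxt t v)) => //; [|rewrite E]; apply: (dart_nxt hF).
Qed.

Lemma darts_in_card Y v : dart_uniq Y ->
  #|[set w | (w, v) \in darts Y]| = #|[set t in Y | v \in verts_of t]|.
Proof.
move=> Yu; rewrite -(card_in_imset (f := fun t => nxt t (nxt t v))).
  apply: eq_card => w; rewrite inE; apply/dartsP/imsetP => [[t tY wv]|].
    have [x [vx xw _]] := dart_next wv.
    exists t; last by rewrite (nxtE hF vx) (nxtE hF xw).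
    by rewrite inE tY; case: (dart_verts vx).
  by case=> t; rewrite inE => /andP[tY vt] ->; exists t => //; apply: (dart_prv hF).
move=> t t'; rewrite !inE => /andP[tY vt] /andP[t'Y vt'] E.
by apply: (Yu t t' (nxt t (nxt t v)) v) => //; [|rewrite E]; apply: (dart_prv hF).
Qed.

(** Each triangle at [v] has one dart that leaves [v] and one that enters it; cancelling the edges
    used in both directions leaves equal numbers. *)
Lemma boundary_balanced Y v : dart_uniq Y ->
  #|[set w | (v, w) \in boundary Y]| = #|[set w | (w, v) \in boundary Y]|.
Proof.
move=> Yu; pose O := [set w | (v, w) \in darts Y].
pose I := [set w | (w, v) \in darts Y].
have -> : [set w | (v, w) \in boundary Y] = O :\: I.
  by apply/setP=> w; rewrite !inE /= andbC.
have -> : [set w | (w, v) \in boundary Y] = I :\: O.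
  by apply/setP=> w; rewrite !inE /= andbC.
have := cardsID I O; have := cardsID O I.
rewrite darts_in_card // darts_out_card // setIC => <- /eqP.
by rewrite eqn_add2l => /eqP.
Qed.

Lemma boundary_circles Y : dart_uniq Y ->
  (forall v, (#|[set w | (v, w) \in boundary Y]| <= 1)%N) ->
  circle_set (boundary Y).
Proof.
move=> Yu out1.
have in1 v : (#|[set w | (w, v) \in boundary Y]| <= 1)%N.
  by rewrite -boundary_balanced.
have ex (A B : {set vert F}) u : #|A| = #|B| -> u \in A -> exists x, x \in B.
  move=> AB uA; apply/set0Pn; rewrite -card_gt0 -AB card_gt0.
  by apply/set0Pn; exists u.
split=> [u w w' uw uw'|u u' w uw uw'|u w uw|u w uw].
- by apply: (card_le1_eqP (out1 u)); rewrite in_set.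
- by apply: (card_le1_eqP (in1 w)); rewrite in_set.
- have [|x] := ex _ _ u (esym (boundary_balanced w Yu)); first by rewrite in_set.
  by rewrite in_set; exists x.
- have [|x] := ex _ _ w (boundary_balanced u Yu); first by rewrite in_set.
  by rewrite in_set; exists x.
Qed.


(* The darts of Y and the reversed boundary darts form a closed surface: the
   permutations [edge_perm], [face_perm * hole_perm] and their product have as
   nontrivial cycles the edges, the triangles with the boundary circles, and the
   vertices.  Comparing signs gives the parity of the Euler characteristic. *)
Section Signs.
Variable Y : {set tri F}.
Hypotheses (Yu : dart_uniq Y) (Yc : fan_connected Y).
Hypothesis bdc : circle_set (boundary Y).
Implicit Type e : vert F * vert F.

Let rev e := (e.2, e.1).
Let full := [set e | (e \in darts Y) || (rev e \in darts Y)].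

Definition edge_swap e := if e \in full then rev e else e.
Definition face_step e :=
  if [pick t in Y | dart t e.1 e.2] is Some t then (e.2, nxt t e.2) else e.
(** The disc glued into a hole is bounded by reversed boundary darts, so it is traversed by the
    inverse of [circ]. *)
Definition hole_step e :=
  if rev e \in boundary Y then (e.2, (circ (boundary Y))^-1%g e.2) else e.

Let revK : involutive rev. Proof. by case. Qed.

Let full_rev e : (rev e \in full) = (e \in full).
Proof. by rewrite !inE /= orbC; case: e. Qed.

Lemma edge_swapK : involutive edge_swap.
Proof.
move=> e; rewrite /edge_swap; case: (boolP (e \in full)) => [fe|/negbTE-> //].
by rewrite full_rev fe revK.
Qed.

Lemma face_stepE t u w : t \in Y -> dart t u w -> face_step (u, w) = (w, nxt t w).
Proof.
move=> tY uw; rewrite /face_step /=; case: pickP => [t' /andP[t'Y uw']|/(_ t)].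
  by rewrite (Yu t'Y tY uw' uw).
by rewrite tY uw.
Qed.

Lemma face_step_id e : e \notin darts Y -> face_step e = e.
Proof.
move=> eY; rewrite /face_step; case: pickP => // t /andP[tY uw]; case/negP: eY.
by rewrite (surjective_pairing e); apply/dartsP; exists t.
Qed.

Lemma face_step3 e : face_step (face_step (face_step e)) = e.
Proof.
case: (boolP (e \in darts Y)) => [|ne]; last by rewrite !face_step_id.
case: e => u w /dartsP[t tY uw]; have [x [wx xu _]] := dart_next uw.
rewrite (face_stepE tY uw) (nxtE hF wx) (face_stepE tY wx) (nxtE hF xu).
by rewrite (face_stepE tY xu) (nxtE hF uw).
Qed.

Lemma boundary_pred u w :
  (u, w) \in boundary Y -> ((circ (boundary Y))^-1%g u, u) \in boundary Y.
Proof.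
by case: (bdc) => _ _ _ /[apply] -[x xu]; rewrite -{1}(circE bdc xu) permK.
Qed.

Lemma hole_step_inj : injective hole_step.
Proof.
move=> [a b] [c d]; rewrite /hole_step /rev /=.
case: ifP => [ba|nba]; case: ifP => [dc|ndc] //.
- case=> bd _; rewrite bd in ba *.
  by rewrite -(circE bdc ba) (circE bdc dc).
- by case=> bc pd; move: ndc; rewrite -bc -pd (boundary_pred ba).
- by case=> ad pb; move: nba; rewrite ad pb (boundary_pred dc).
Qed.

Definition edge_perm := perm (inv_inj edge_swapK).
Lemma face_step_inj : injective face_step.
Proof. exact: (@can_inj _ _ face_step (face_step \o face_step) face_step3). Qed.
Definition face_perm := perm face_step_inj.
Definition hole_perm := perm hole_step_inj.

Lemma odd_face_perm : odd_perm face_perm = false.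
Proof.
have /(congr1 (@odd_perm _)) : (face_perm * face_perm * face_perm = 1)%g.
  by apply/permP => e; rewrite !permM perm1 /face_perm !permE face_step3.
by rewrite !odd_permM odd_perm1; case: (odd_perm _).
Qed.

Let edge_of e : {set vert F} := [set e.1; e.2].

Let edge_ofP e e' : edge_of e = edge_of e' -> e' = e \/ e' = rev e.
Proof.
case: e e' => a b [c d] /= /setP E.
have /set2P[] : c \in [set a; b] by rewrite E set21.
  move=> ca; rewrite {}ca in E *; left; congr (_, _).
  have /set2P[da|-> //] : d \in [set a; b] by rewrite E set22.
  by have := E b; rewrite set22 da !inE orbb => /esym/eqP ->.
move=> cb; rewrite {}cb in E *; right; congr (_, _).
have /set2P[// |db] : d \in [set a; b] by rewrite E set22.
by have := E a; rewrite set21 db !inE orbb => /esym/eqP ->.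
Qed.

Let edges_full : edge_of @: full = edges Y.
Proof.
have dE e : (e \in darts Y) = [exists t in Y, dart t e.1 e.2] by rewrite inE.
apply/setP => A; apply/imsetP/imsetP => [[e fe ->]|[e eY ->]]; last first.
  by exists e => //; rewrite in_set dE; move: eY; rewrite inE => ->.
move: fe; rewrite in_set => /orP[] eY; first by exists e; rewrite // inE -dE.
by exists (rev e); [rewrite inE -dE | rewrite /edge_of setUC].
Qed.

Let full_neq e : e \in full -> rev e != e.
Proof.
case: e => a b; rewrite in_set => /orP[] /dartsP[t _ /(dart_neq hF) n].
  by apply/eqP => -[ba _]; rewrite ba eqxx in n.
by apply/eqP => -[ba _]; rewrite ba eqxx in n.
Qed.

Lemma card_full : #|full| = (#|edges Y| * 2)%N.
Proof.
rewrite -edges_full -sum_nat_const -sum1_card.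
rewrite (partition_big_imset edge_of) /=; apply: eq_bigr => A /imsetP[e fe ->].
rewrite sum1_card (eq_card (B := [set e; rev e])); first by
  rewrite cards2 eq_sym full_neq.
move=> x; rewrite in_set2 unfold_in /=; apply/andP/orP => [[_ /eqP/esym/edge_ofP[]->]|[]/eqP->].
- by left.
- by right.
- by split; rewrite // -in_set.
- split; last by rewrite /edge_of setUC.
  by have := full_rev e; rewrite fe in_set.
Qed.

Lemma odd_edge_perm : odd_perm edge_perm = odd #|edges Y|.
Proof.
rewrite (@odd_perm_labels _ _ edge_perm full edge_of).
- by rewrite card_full oddM andbF edges_full.
- by move=> e fe; rewrite permE /edge_swap (negbTE fe).
move=> x y fx fy; have step e : e \in full -> edge_perm e = rev e.
  by move=> fe; rewrite permE /edge_swap fe.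
apply/porbitP/eqP => [[n ->]|/edge_ofP[]->]; last 2 first.
- by exists 0%N; rewrite perm1.
- by exists 1%N; rewrite expg1 step.
elim: n => [|n IH]; first by rewrite perm1.
rewrite expgSr permM IH permE /edge_swap; case: ifP => // _.
by rewrite /edge_of setUC.
Qed.

Let holes := [set e | rev e \in boundary Y].

Let holesE e : (e \in holes) = (rev e \in boundary Y).
Proof. by rewrite in_set. Qed.

Let fullE e : (e \in full) = (e \in darts Y) || (rev e \in darts Y).
Proof. by rewrite in_set. Qed.

Let boundaryE u w :
  ((u, w) \in boundary Y) = ((u, w) \in darts Y) && ((w, u) \notin darts Y).
Proof. by rewrite in_set. Qed.

Lemma odd_hole_perm : odd_perm hole_perm = odd_perm (circ (boundary Y)).
Proof.
rewrite -[RHS]odd_permV.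
apply: (@odd_perm_transport _ _ hole_perm _ holes fst).
- move=> [a b] [c d]; rewrite !holesE /rev /= => ba dc ac; rewrite -ac in dc *.
  by case: (bdc) => _ g _ _; rewrite (g _ _ _ ba dc).
- by move=> e; rewrite holesE permE /hole_step => /negbTE->.
- move=> y ny; apply: (canLR (permK _)); rewrite circ_id // => w.
  apply: contra ny => yw; case: (bdc) => _ _ _ /(_ _ _ yw)[x xy].
  by apply/imsetP; exists (y, x); rewrite // holesE.
move=> [a b]; rewrite holesE /rev /= => ba.
rewrite permE /hole_step /= ba /= holesE /rev /= (boundary_pred ba); split=> //.
by rewrite -(circE bdc ba) permK.
Qed.

(** Products compose from left to right: a dart that leaves [v] is reversed, then continued along
    its triangle or its hole, and so leaves [v] again. This is the rotation about [v]. *)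
Let rot_perm := (edge_perm * face_perm * hole_perm)%g.

Let rot_permE e : rot_perm e = hole_step (face_step (edge_swap e)).
Proof. by rewrite !permM /edge_perm /face_perm /hole_perm !permE. Qed.

Let rot_out t v w : t \in Y -> dart t w v ->
  rot_perm (v, w) = (v, nxt t v).
Proof.
move=> tY wv; rewrite rot_permE /edge_swap fullE /rev /=.
have wvY : (w, v) \in darts Y by apply/dartsP; exists t.
rewrite wvY orbT (face_stepE tY wv) /hole_step /rev /= boundaryE.
have [x [vx _ _]] := dart_next wv.
have -> : (v, nxt t v) \in darts Y by apply/dartsP; exists t; rewrite ?(nxtE hF vx).
by rewrite andbF.
Qed.

Let rot_hole v w : (w, v) \notin darts Y -> (v, w) \in darts Y ->
  (rot_perm (v, w)).1 = v.
Proof.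
move=> wv vw; rewrite rot_permE /edge_swap fullE /rev /= vw /=.
rewrite face_step_id // /hole_step /rev /=.
by have -> : (v, w) \in boundary Y by rewrite boundaryE vw.
Qed.

Let rot_fst e : (rot_perm e).1 = e.1.
Proof.
case: e => v w; case: (boolP ((w, v) \in darts Y)) => [/dartsP[t tY wv]|wv].
  by rewrite (rot_out tY wv).
case: (boolP ((v, w) \in darts Y)) => [vw|vw]; first by rewrite rot_hole.
rewrite rot_permE /edge_swap fullE /rev /= (negbTE wv) (negbTE vw) /=.
rewrite face_step_id //.
by rewrite /hole_step /rev /= boundaryE (negbTE wv).
Qed.

Lemma odd_rot_perm : odd_perm rot_perm = odd #|verts Y|.
Proof.
rewrite (@odd_perm_labels _ _ rot_perm full fst).
- rewrite card_full oddM andbF /=; congr (odd _); apply: eq_card => v.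
  apply/imsetP/vertsP => [[[a b]]|[t tY /(dart_nxt hF) vw]].
    rewrite fullE => /orP[] /dartsP[t tY /dart_verts[? ?]] ->; by exists t.
  by exists (v, nxt t v); rewrite // fullE; apply/orP; left; apply/dartsP; exists t.
- case=> v w; rewrite fullE /rev /= => /norP[vw wv].
  rewrite rot_permE /edge_swap fullE /rev /= (negbTE wv) (negbTE vw) /=.
  by rewrite face_step_id // /hole_step /rev /= boundaryE (negbTE wv).
move=> x y fx fy; apply/idP/eqP => [/porbitP[n ->]|].
  elim: n => [|n IH]; first by rewrite perm1.
  by rewrite expgSr permM rot_fst.
have porb1 e : rot_perm e \in porbit rot_perm e by rewrite -(expg1 rot_perm) mem_porbit.
(* Every orbit contains the dart by which some triangle of [Y] leaves the vertex, so it suffices to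
   compare triangles along a fan. *)
have start e : e \in full -> exists2 t, t \in Y & e.1 \in verts_of t
    /\ porbit rot_perm (e.1, nxt t e.1) = porbit rot_perm e.
  case: e => v w; rewrite fullE /rev /=.
  case: (boolP ((w, v) \in darts Y)) => [/dartsP[t tY wv] _|wv].
    exists t => //; split; first by case: (dart_verts wv).
    by apply/eqP; rewrite eq_porbit_mem -(rot_out tY wv) porb1.
  rewrite orbF => /dartsP[t tY vw]; exists t => //; split.
    by case: (dart_verts vw).
  by rewrite (nxtE hF vw).
case: (start _ fx) (start _ fy) => [t tY [vt tx]] [t' t'Y [vt' t'y]] xy.
rewrite porbit_sym -eq_porbit_mem -tx -t'y -{}xy in vt' *; apply/eqP.
move: {x fx tx} x.1 vt vt' => v vt vt'.
have /connectP[p] := Yc tY t'Y vt vt'.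
elim: p t tY vt => [|s p IH] t tY vt /=; first by move=> _ ->.
case/andP=> /and3P[_ sY /existsP[w /andP[tw sw]]] sp Et'.
have vs : v \in verts_of s by case: (has_edge_verts sw).
rewrite -(IH s sY vs sp Et'); apply/eqP.
(* Triangles that induce the same direction on the shared edge coincide; for opposite directions,
   one rotation step leads from one to the other. *)
case/orP: tw => [vw|wv]; case/orP: sw => [vw'|wv'].
- by rewrite (Yu tY sY vw vw').
- rewrite (nxtE hF vw) eq_porbit_mem porbit_sym -(rot_out sY wv'); exact: porb1.
- rewrite (nxtE hF vw') eq_porbit_mem -(rot_out tY wv); exact: porb1.
- by rewrite (Yu tY sY wv wv').
Qed.

Lemma card_darts : #|darts Y| = (#|Y| * 3)%N.
Proof.
pose P := [set p : tri F * vert F | (p.1 \in Y) && (p.2 \in verts_of p.1)].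
have -> : darts Y = [set (p.2, nxt p.1 p.2) | p in P].
  apply/setP=> -[u w]; apply/dartsP/imsetP => [[t tY uw]|[[t v]]].
    exists (t, u) => /=; last by rewrite (nxtE hF uw).
    by rewrite inE tY; case: (dart_verts uw).
  rewrite inE => /andP[/= tY vt] [-> ->]; exists t; rewrite //; apply: (dart_nxt hF) vt.
rewrite card_in_imset; last first.
  move=> [t v] [s u]; rewrite !inE => /andP[/= tY vt] /andP[/= sY us] [vu E].
  rewrite -vu in us E *; congr (_, _); apply: (Yu tY sY (dart_nxt hF vt)).
  by rewrite E; apply: (dart_nxt hF).
transitivity (\sum_(t in Y) \sum_(v in verts_of t) 1)%N.
  by rewrite -sum1_card pair_big_dep; apply: eq_bigl => p; rewrite inE.
by under eq_bigr do rewrite sum1_card (card_verts_of hF); rewrite sum_nat_const.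
Qed.

(** [face_perm] is even since its cube is 1, so the signs give #V + #E as the sign of the boundary
    permutation. Counting darts, 2 #E = 3 #T + #boundary, so #T has the parity of the boundary
    length; the sum is [tau]. *)
Lemma euler_parity :
  odd #|verts Y| (+) odd #|edges Y| (+) odd #|Y| = tau (boundary Y).
Proof.
have := odd_rot_perm; rewrite !odd_permM odd_face_perm addbF odd_edge_perm.
rewrite odd_hole_perm => <-; rewrite /tau.
have : #|full| = (#|darts Y| + #|holes|)%N.
  rewrite -cardsUI -[LHS]addn0; congr (_ + _)%N.
    apply: eq_card => e; rewrite fullE in_setU holesE; case: e => u w /=.
    by rewrite boundaryE; case: (_ \in _); rewrite //= andbT.
  apply/esym/eqP; rewrite cards_eq0; apply/eqP/setP => -[u w].
  by rewrite in_setI holesE boundaryE in_set0; case: (_ \in _); rewrite ?andbF.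
rewrite card_full card_darts => /(congr1 odd).
have -> : #|holes| = #|boundary Y|.
  by rewrite -(card_imset _ (inv_inj revK)); apply: eq_card => e;
     rewrite -{1}(revK e) (mem_imset _ _ (inv_inj revK)) holesE revK.
rewrite oddD !oddM andbF andbT.
by case: (odd #|edges Y|); case: (odd #|Y|); case: (odd #|boundary Y|);
   case: (odd_perm _).
Qed.

End Signs.
End Parity.

(** * Bicolored seams at a vertex *)

Lemma connect_equivalence_in (T : finType) (e : rel T) (D : {set T}) :
  ssrbool.symmetric e -> {in D & &, equivalence_rel (connect e)}.
Proof.
move=> es; have eq : equivalence_rel (connect e).
  apply/equivalence_relP; split; first exact: connect0.
  exact/same_connect/sym_connect_sym.
by move=> t1 t2 t3 _ _ _; apply: eq.
Qed.

Section VertexAnalysis.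
Variables (R : realType) (N : nat) (F : prefoam R) (hF : is_foam F N).
Variable c : {ffun facet F -> {set 'I_N}}.
Hypothesis hc : is_coloring c.
Implicit Types (u v w x : vert F) (t : tri F) (C : {set tri F}) (i j l : 'I_N).

Lemma seam_at_unique u w t1 t2 t3 s1 s2 s3 :
  seam_at u w t1 t2 t3 -> seam_at u w s1 s2 s3 ->
  s3 = t3 /\ ((s1 = t1 /\ s2 = t2) \/ (s1 = t2 /\ s2 = t1)).
Proof.
move=> s; case: (s) => /and3P[n12 _ _]; case: (seam_atE s) => E12 E3.
move=> s'; case: (s') => /and3P[n12' _ _]; case: (seam_atE s') => E12' E3'.
split; first by apply/eqP; rewrite -E3 E3' eqxx.
have /orP[/eqP s11|/eqP s11] : (s1 == t1) || (s1 == t2) by rewrite -E12 E12' eqxx.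
  have /orP[/eqP s22|/eqP s22] : (s2 == t1) || (s2 == t2) by rewrite -E12 E12' eqxx orbT.
    by rewrite s11 s22 eqxx in n12'.
  by left.
have /orP[/eqP s22|/eqP s22] : (s2 == t1) || (s2 == t2) by rewrite -E12 E12' eqxx orbT.
  by right.
by rewrite s11 s22 eqxx in n12'.
Qed.

Lemma coloring_seam l u w t1 t2 t3 : seam_at u w t1 t2 t3 ->
  (l \in c (facet_of t3)) = (l \in c (facet_of t1)) || (l \in c (facet_of t2))
  /\ ~~ ((l \in c (facet_of t1)) && (l \in c (facet_of t2))).
Proof.
move=> s; move: hc => /andP[_ /forallP/(_ u)/forallP/(_ w)/forallP/(_ t1)].
move=> /forallP/(_ t2)/forallP/(_ t3); rewrite s => /andP[dis /eqP ->].
rewrite inE; split=> //; apply/negP => /andP[l1 l2].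
by have /disjoint_setI0/setP/(_ l) := dis; rewrite !inE l1 l2.
Qed.

Lemma adjacent_at_facet v t t' : adjacent_at v t t' -> facet_of t = facet_of t'.
Proof.
move=> a; apply/(foam_facet hF); apply: connect1; apply/existsP.
by exists v.
Qed.

Lemma adjacent_at_sym v : ssrbool.symmetric (@adjacent_at R F v).
Proof.
move=> t t'; apply/existsP/existsP => -[w /and3P[? ? ?]]; exists w;
  exact/and3P.
Qed.

Lemma connect_at_facet v t t' :
  connect (adjacent_at v) t t' -> facet_of t = facet_of t'.
Proof.
case/connectP=> p; elim: p t => [|s p IH] t /=; first by move=> _ ->.
by case/andP=> /adjacent_at_facet -> /IH{}IH /IH.
Qed.

Lemma connect_at_equiv v :
  {in star v & &, equivalence_rel (connect (@adjacent_at R F v))}.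
Proof.
exact/connect_equivalence_in/adjacent_at_sym.
Qed.

Lemma mem_sector v t : v \in verts_of t -> exists2 C, C \in sectors v & t \in C.
Proof.
move=> vt; have /and3P[/eqP cov _ _] := equivalence_partitionP (@connect_at_equiv v).
have : t \in cover (sectors v) by rewrite cov inE.
by case/bigcupP => C; exists C.
Qed.

Lemma sector_connect v C t t' : C \in sectors v -> t \in C -> t' \in C ->
  connect (adjacent_at v) t t'.
Proof.
move=> Cv tC t'C; have /and3P[/eqP cov tri0 _] := equivalence_partitionP (@connect_at_equiv v).
have sC : {subset C <= star v}.
  by move=> s sC; rewrite -cov; apply/bigcupP; exists C.
rewrite -(pblock_equivalence_partition (@connect_at_equiv v)) ?sC //.
by rewrite (def_pblock tri0 Cv tC).
Qed.

Lemma sector_facet v C t t' : C \in sectors v -> t \in C -> t' \in C ->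
  facet_of t = facet_of t'.
Proof. by move=> Cv tC t'C; apply: connect_at_facet (sector_connect Cv tC t'C). Qed.

Lemma jointP v w C1 C2 C3 : joint v w C1 C2 C3 ->
  exists t1 t2 t3, [/\ t1 \in C1, t2 \in C2, t3 \in C3 &
    seam_at v w t1 t2 t3 \/ seam_at w v t1 t2 t3].
Proof.
case/existsP=> t1 /andP[t1C /existsP[t2 /andP[t2C /existsP[t3 /andP[t3C /orP s]]]]].
by exists t1, t2, t3.
Qed.

(* The sets of triangles whose colors satisfy a condition on i and j; the
   condition depends on the position of i and j among the thin facets only. *)
Definition pattern (Q : rel bool) i j : {set tri F} :=
  [set t | Q (i \in c (facet_of t)) (j \in c (facet_of t))].

(* At a vertex with link K_4, two sectors that share no edge are opposite; the
   condition provides a third sector of the pattern, which meets both. *)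
Definition linked_pattern (Q : rel bool) := forall ia ib ic ja jb jc : bool,
  ~~ (ia && ib) -> ~~ (ia && ic) -> ~~ (ib && ic) ->
  ~~ (ja && jb) -> ~~ (ja && jc) -> ~~ (jb && jc) ->
  let a := Q ia ja in let b := Q ib jb in let c := Q ic jc in
  let ab := Q (ia || ib) (ja || jb) in let bc := Q (ib || ic) (jb || jc) in
  let abc := Q [|| ia, ib | ic] [|| ja, jb | jc] in
  [&& a && c ==> [|| b, ab, bc | abc], b && abc ==> [|| a, c, ab | bc]
    & ab && bc ==> [|| a, b, c | abc]].

Lemma fan_sym (Y : {set tri F}) v : ssrbool.symmetric (fan Y v).
Proof.
move=> t t'; rewrite /fan; apply/and3P/and3P => -[? ? /existsP[w /andP[? ?]]];
  by split=> //; apply/existsP; exists w; apply/andP.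
Qed.

Lemma pattern_facet Q i j t t' : facet_of t = facet_of t' ->
  (t \in pattern Q i j) = (t' \in pattern Q i j).
Proof. by rewrite !inE => ->. Qed.

Lemma sector_fan Q i j v C t t' : C \in sectors v -> t \in C -> t' \in C ->
  t \in pattern Q i j -> connect (fan (pattern Q i j) v) t t'.
Proof.
move=> Cv tC t'C tQ; case/connectP: (sector_connect Cv tC t'C) => p + ->.
elim: p t tQ {tC t' t'C} => [|s p IH] t tQ /=; first by rewrite connect0.
case/andP=> ts /(IH _); have sQ : s \in pattern Q i j.
  by rewrite -(pattern_facet _ _ _ (adjacent_at_facet ts)).
move/(_ sQ); apply: connect_trans; apply: connect1; rewrite /fan tQ sQ /=.
by case/existsP: ts => w /and3P[_ ? ?]; apply/existsP; exists w; apply/andP.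
Qed.

Lemma fan_csym (Y : {set tri F}) v : connect_sym (fan Y v).
Proof. exact/sym_connect_sym/fan_sym. Qed.

Section Sector.
Variables (Q : rel bool) (i j : 'I_N) (v : vert F).
Let Y := pattern Q i j.
Let lk C C' := forall t t', t \in C -> t' \in C' -> t \in Y -> t' \in Y ->
  connect (fan Y v) t t'.

Let lk_sym C C' : lk C C' -> lk C' C.
Proof. by move=> l t t' tC t'C tY t'Y; rewrite fan_csym; apply: l. Qed.

Let lk_trans C1 C2 C3 t : t \in C2 -> t \in Y -> lk C1 C2 -> lk C2 C3 -> lk C1 C3.
Proof.
move=> tC tY l12 l23 t1 t3 t1C t3C t1Y t3Y.
by apply: connect_trans (l12 _ _ t1C tC t1Y tY) (l23 _ _ tC t3C tY t3Y).
Qed.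

Let joint_lk w C1 C2 C3 : joint v w C1 C2 C3 ->
  C1 \in sectors v -> C2 \in sectors v -> C3 \in sectors v ->
  [/\ lk C1 C2, lk C1 C3 & lk C2 C3].
Proof.
case/jointP=> t1 [t2 [t3 [t1C t2C t3C s]]] C1v C2v C3v.
have e : [/\ has_edge t1 v w, has_edge t2 v w & has_edge t3 v w].
  by case: s => /seam_atE[E12 E3]; rewrite /has_edge !E12 !E3 !eqxx ?orbT.
have key C C' s1 s2 : C \in sectors v -> C' \in sectors v -> s1 \in C -> s2 \in C' ->
    has_edge s1 v w -> has_edge s2 v w -> lk C C'.
  move=> Cv C'v s1C s2C e1 e2 t t' tC t'C tY t'Y.
  have s1Y : s1 \in Y by rewrite -(pattern_facet _ _ _ (sector_facet Cv tC s1C)).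
  have s2Y : s2 \in Y by rewrite -(pattern_facet _ _ _ (sector_facet C'v t'C s2C)).
  apply: connect_trans (sector_fan Cv tC s1C tY) _.
  apply: connect_trans (sector_fan C'v s2C t'C s2Y).
  by apply: connect1; rewrite /fan s1Y s2Y /=; apply/existsP; exists w; rewrite e1.
by case: e => e1 e2 e3; split; [exact: (key _ _ t1 t2)|exact: (key _ _ t1 t3)|
  exact: (key _ _ t2 t3)].
Qed.

Let joint_color w C1 C2 C3 l t1 t2 t3 : joint v w C1 C2 C3 ->
  C1 \in sectors v -> C2 \in sectors v -> C3 \in sectors v ->
  t1 \in C1 -> t2 \in C2 -> t3 \in C3 ->
  (l \in c (facet_of t3)) = (l \in c (facet_of t1)) || (l \in c (facet_of t2))
  /\ ~~ ((l \in c (facet_of t1)) && (l \in c (facet_of t2))).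
Proof.
case/jointP=> s1 [s2 [s3 [s1C s2C s3C s]]] C1v C2v C3v t1C t2C t3C.
rewrite (sector_facet C1v t1C s1C) (sector_facet C2v t2C s2C).
rewrite (sector_facet C3v t3C s3C).
by case: s => /coloring_seam.
Qed.

Hypothesis QP : linked_pattern Q.

Let lk_refl C : C \in sectors v -> lk C C.
Proof. by move=> Cv t t' tC t'C tY _; apply: sector_fan Cv tC t'C tY. Qed.

(** No pinch points: the triangles of the pattern at [v] form one fan. A circle has a single sector,
    and in a theta graph any two sectors meet along a seam. In K_4 only the pairs a and c, b and
    a+b+c, a+b and b+c do not meet, and [QP] supplies a sector of the pattern that joins them. *)
Lemma pattern_fan_connected t t' : t \in Y -> t' \in Y ->
  v \in verts_of t -> v \in verts_of t' -> connect (fan Y v) t t'.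
Proof.
move=> tY t'Y /mem_sector[C Cv tC] /mem_sector[C' C'v t'C].
suff l : lk C C' by apply: l.
case: (foam_vertex hF v) => [[_ [D sD]]|[w1 [w2 [C1 [C2 [C3 [_ _ _ sC [J _]]]]]]]|].
- by move: Cv C'v; rewrite sD => /set1P-> /set1P->; apply: lk_refl; rewrite sD set11.
- have [m1 m2 m3] : [/\ C1 \in sectors v, C2 \in sectors v & C3 \in sectors v].
    by rewrite !sC !inE !eqxx ?orbT.
  have [l12 l13 l23] := joint_lk J m1 m2 m3.
  move: (Cv) (C'v); rewrite !sC !inE => /or3P[] /eqP-> /or3P[] /eqP->;
    by [apply: lk_refl | | apply: lk_sym].
case=> w1 [w2 [w3 [w4 [Ca [Cb [Cc [Cab [Cbc [Cabc]]]]]]]]].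
case=> _ _ _ sC [J1 J2 J3 J4].
have [ma mb mc] : [/\ Ca \in sectors v, Cb \in sectors v & Cc \in sectors v].
  by rewrite !sC !inE !eqxx ?orbT.
have [mab mbc mabc] :
    [/\ Cab \in sectors v, Cbc \in sectors v & Cabc \in sectors v].
  by rewrite !sC !inE !eqxx ?orbT.
have [lab la_ab lb_ab] := joint_lk J1 ma mb mab.
have [lab_c lab_abc lc_abc] := joint_lk J2 mab mc mabc.
have [lbc lb_bc lc_bc] := joint_lk J3 mb mc mbc.
have [la_bc la_abc lbc_abc] := joint_lk J4 ma mbc mabc.
have [ta [tb [tab [taC tbC tabC _]]]] := jointP J1.
have [_ [tc [tabc [_ tcC tabcC _]]]] := jointP J2.
have [_ [_ [tbc [_ _ tbcC _]]]] := jointP J3.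
have K1 l := joint_color l J1 ma mb mab taC tbC tabC.
have K2 l := joint_color l J2 mab mc mabc tabC tcC tabcC.
have K3 l := joint_color l J3 mb mc mbc tbC tcC tbcC.
have YE s : (s \in Y) = Q (i \in c (facet_of s)) (j \in c (facet_of s)) by rewrite inE.
have := QP (ia := i \in c (facet_of ta)) (ib := i \in c (facet_of tb))
  (ic := i \in c (facet_of tc)) (ja := j \in c (facet_of ta))
  (jb := j \in c (facet_of tb)) (jc := j \in c (facet_of tc)).
have K2' l : ~~ ((l \in c (facet_of ta)) && (l \in c (facet_of tc))).
  by have [E _] := K1 l; have [_] := K2 l; rewrite E;
     case: (l \in c (facet_of ta)).
rewrite !(K1 _).2 !(K3 _).2 !K2' => /(_ isT isT isT isT isT isT) /=.
rewrite -!(K1 _).1 -!(K3 _).1.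
rewrite -!(joint_color _ J4 ma mbc mabc taC tbcC tabcC).1.
rewrite -!YE => /and3P[Hac Hb_abc Hab_bc].
have sameC D s s' : D \in sectors v -> s \in D -> s' \in D -> s \in Y -> s' \in Y.
  by move=> Dv sD s'D sY; rewrite -(pattern_facet _ _ _ (sector_facet Dv sD s'D)).
have lac : lk Ca Cc.
  move=> s s' sC' s'C' sY s'Y; move: Hac.
  rewrite (sameC _ _ _ ma sC' taC sY) (sameC _ _ _ mc s'C' tcC s'Y) /=.
  case/or4P => mY; apply: (lk_trans _ mY) sC' s'C' sY s'Y; by
    [exact: tbC|exact: tabC|exact: tbcC|exact: tabcC|idtac|apply: lk_sym].
have lb_abc : lk Cb Cabc.
  move=> s s' sC' s'C' sY s'Y; move: Hb_abc.
  rewrite (sameC _ _ _ mb sC' tbC sY) (sameC _ _ _ mabc s'C' tabcC s'Y) /=.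
  case/or4P => mY; apply: (lk_trans _ mY) sC' s'C' sY s'Y; by
    [exact: taC|exact: tcC|exact: tabC|exact: tbcC|idtac|apply: lk_sym].
have lab_bc : lk Cab Cbc.
  move=> s s' sC' s'C' sY s'Y; move: Hab_bc.
  rewrite (sameC _ _ _ mab sC' tabC sY) (sameC _ _ _ mbc s'C' tbcC s'Y) /=.
  case/or4P => mY; apply: (lk_trans _ mY) sC' s'C' sY s'Y; by
    [exact: taC|exact: tbC|exact: tcC|exact: tabcC|idtac|apply: lk_sym].
have sC6 D : D \in sectors v ->
    [\/ D = Ca, D = Cb, D = Cc | [\/ D = Cab, D = Cbc | D = Cabc]].
  rewrite sC !inE => /or4P[/eqP|/eqP|/eqP|/or3P[]/eqP] ->;
   by [constructor 1|constructor 2|constructor 3|constructor 4; constructor 1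
      |constructor 4; constructor 2|constructor 4; constructor 3].
by case: (sC6 _ Cv) => [->|->|->|[]->]; case: (sC6 _ C'v) => [->|->|->|[]->];
  first [exact: lk_refl | done | exact: lk_sym].
Qed.
End Sector.

Definition bic i j : {set vert F * vert F} := [set e | bicolored_seam c i j e].

Lemma bicP i j u w : reflect (exists t1 t2 t3, [/\ seam_at u w t1 t2 t3,
    (i \in c (facet_of t1)) && (j \notin c (facet_of t1)),
    (j \in c (facet_of t2)) && (i \notin c (facet_of t2))
  & (i \in c (facet_of t3)) && (j \in c (facet_of t3))]) ((u, w) \in bic i j).
Proof.
rewrite inE; apply: (iffP existsP) => [[t1 /existsP[t2 /existsP[t3 /and4P[]]]]|].
  by move=> ? ? ? ?; exists t1, t2, t3; split.
case=> t1 [t2 [t3 [? ? ? ?]]]; exists t1; apply/existsP; exists t2.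
by apply/existsP; exists t3; apply/and4P; split.
Qed.

Lemma bicC i j : bic i j = bic j i.
Proof.
apply/setP => -[u w]; apply/bicP/bicP => -[t1 [t2 [t3 [s a b ab]]]];
  by exists t2, t1, t3; split=> //; [exact: seam_at_swap | rewrite andbC].
Qed.

Lemma joint_bic v w C1 C2 C3 i j :
  joint v w C1 C2 C3 -> (v, w) \in bic i j \/ (w, v) \in bic i j ->
  exists t1 t2 t3, [/\ t1 \in C1, t2 \in C2, t3 \in C3,
    (i \in c (facet_of t1)) (+) (j \in c (facet_of t1)) &
    (i \in c (facet_of t3)) && (j \in c (facet_of t3))].
Proof.
have key t1 t2 t3 u x : seam_at u x t1 t2 t3 -> (u, x) \in bic i j ->
    (i \in c (facet_of t1)) (+) (j \in c (facet_of t1)) /\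
    (i \in c (facet_of t3)) && (j \in c (facet_of t3)).
  move=> s /bicP[s1 [s2 [s3 [s' /andP[a1 b1] /andP[b2 a2] ab]]]].
  have [<- [[<- _]|[_ <-]]] := seam_at_unique s s'; split=> //.
    by rewrite a1 (negbTE b1).
  by rewrite b2 (negbTE a2).
case/jointP=> t1 [t2 [t3 [t1C t2C t3C s]]] b; exists t1, t2, t3.
have nb x y : seam_at x y t1 t2 t3 -> (y, x) \notin bic i j.
  by move=> s'; apply/negP => /bicP[s1 [s2 [s3 [/(seam_at_asym t1 t2 t3)]]]];
     rewrite s'.
by case: s => s; case: b => b; try (by rewrite (negbTE (nb _ _ s)) in b);
   case: (key _ _ _ _ _ s b).
Qed.

Lemma bic_seam_nbrs i j v w :
  (v, w) \in bic i j \/ (w, v) \in bic i j -> w \in seam_nbrs v.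
Proof.
move=> b; rewrite inE; apply/orP; case: b => /bicP[t1 [t2 [t3 [s _ _ _]]]].
  by left; apply/existsP; exists t1; apply/existsP; exists t2; apply/existsP; exists t3.
by right; apply/existsP; exists t1; apply/existsP; exists t2; apply/existsP; exists t3.
Qed.

(** At a vertex with link K_4 the seams to [w1] and [w2] are not both bicolored: the first would
    give the sector [Cab] both colors, the second exactly one. The bound 3 forces degree at most 1
    in each direction, as a boundary has as many edges into [v] as out of it. *)
Lemma bic_degree i j v :
  (#|[set w | (v, w) \in bic i j]| + #|[set w | (w, v) \in bic i j]| <= 3)%N.
Proof.
set A := [set w | (v, w) \in _]; set B := [set w | (w, v) \in _].
have AE w : (w \in A) = ((v, w) \in bic i j) by rewrite in_set.
have BE w : (w \in B) = ((w, v) \in bic i j) by rewrite in_set.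
have AB0 : [disjoint A & B].
  apply/pred0P => w; rewrite /= AE BE; apply/negP => /andP[/bicP[t1 [t2 [t3 [s _ _ _]]]]].
  by case/bicP=> s1 [s2 [s3 [/(seam_at_asym t1 t2 t3)]]]; rewrite s.
have -> : (#|A| + #|B|)%N = #|A :|: B|.
  by apply/esym/eqP; rewrite (leq_card_setU A B).2.
have inAB w : w \in A :|: B -> (v, w) \in bic i j \/ (w, v) \in bic i j.
  by rewrite in_setU AE BE => /orP.
have sub (s : seq (vert F)) : {subset A :|: B <= s} -> (#|A :|: B| <= size s)%N.
  by move=> ABs; apply: leq_trans (card_size s); apply/subset_leq_card/subsetP.
case: (foam_vertex hF v) => [[n0 _]|[w1 [w2 [_ [_ [_ [_ nE _ _ _]]]]]]|].
- apply: leq_trans (sub [::] _) _ => // w /inAB/bic_seam_nbrs.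
  by rewrite n0 inE.
- apply: leq_trans (sub [:: w1; w2] _) _ => // w /inAB/bic_seam_nbrs.
  by rewrite nE.
case=> w1 [w2 [w3 [w4 [Ca [Cb [Cc [Cab [Cbc [Cabc]]]]]]]]].
case=> _ nE _ sC [J1 J2 J3 J4].
have mab : Cab \in sectors v by rewrite sC !inE !eqxx ?orbT.
have [w1AB|w1AB] := boolP (w1 \in A :|: B); last first.
  apply: (sub [:: w2; w3; w4]) => w wAB; have := bic_seam_nbrs (inAB _ wAB).
  by rewrite nE inE => /orP[/eqP ww1|//]; rewrite ww1 (negbTE w1AB) in wAB.
apply: (sub [:: w1; w3; w4]) => w wAB; have := bic_seam_nbrs (inAB _ wAB).
rewrite nE !inE => /or4P[->//|/eqP ww2|->|->]; rewrite ?orbT //.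
have [t1 [t2 [t3 [_ _ t3C _ ij]]]] := joint_bic J1 (inAB _ w1AB).
rewrite ww2 in wAB; have [s1 [s2 [s3 [s1C _ _ + _]]]] := joint_bic J2 (inAB _ wAB).
by rewrite (sector_facet mab s1C t3C); case/andP: ij => -> ->.
Qed.

End VertexAnalysis.

(** * Regions of a bicolored surface *)

Section IntegerParity.
Local Open Scope ring_scope.
Implicit Types a b : int.

Definition oddz a : bool := odd `|a|%N.

Lemma exprz_sign (L : unitRingType) a : (-1 : L) ^ a = (-1) ^+ oddz a.
Proof.
case: a => n; rewrite /oddz /=; first by rewrite signr_odd.
by rewrite -[LHS]/(((-1) ^+ n.+1)^-1) -signr_odd invr_sign.
Qed.

Lemma oddzD a b : oddz (a + b) = oddz a (+) oddz b.
Proof.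
apply: (@signr_inj rat); rewrite -exprz_sign expfzDr ?oppr_eq0 ?oner_eq0 //.
by rewrite !exprz_sign signr_addb.
Qed.

Lemma oddzN a : oddz (- a) = oddz a.
Proof. by rewrite /oddz abszN. Qed.

Lemma oddzB a b : oddz (a - b) = oddz a (+) oddz b.
Proof. by rewrite oddzD oddzN. Qed.

Lemma oddz_nat (n : nat) : oddz n%:Z = odd n.
Proof. by []. Qed.

Lemma divz2K a : ~~ oddz a -> (a %/ 2)%Z * 2 = a.
Proof.
rewrite /oddz -dvdn2 => a2; apply: divzK; exact: a2.
Qed.

Lemma half_sum (x y d : int) : ~~ oddz x -> ~~ oddz y -> y = x + d ->
  (y %/ 2)%Z = (x %/ 2)%Z + (d %/ 2)%Z /\ (d %/ 2)%Z * 2 = d.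
Proof.
move=> x0 y0 E; have d0 : ~~ oddz d.
  have -> : d = y - x by lia.
  by rewrite oddzB (negbTE x0) (negbTE y0).
split; last exact: divz2K.
have := divz2K x0; have := divz2K d0; have := divz2K y0; lia.
Qed.

End IntegerParity.

(** * Euler characteristics of unions and of exchanged pieces *)

Section EulerCharacteristic.
Variables (R : realType) (F : prefoam R).
Implicit Types (u v w x : vert F) (t : tri F) (Y Z : {set tri F}).

Lemma set2_eq (T : finType) (a b x y : T) :
  [set a; b] = [set x; y] -> (x = a /\ y = b) \/ (x = b /\ y = a).
Proof.
move=> /setP E; have /set2P[] : x \in [set a; b] by rewrite E set21.
  move=> xa; rewrite {}xa in E *; left; split=> //.
  have /set2P[ya|//] : y \in [set a; b] by rewrite E set22.
  by have := E b; rewrite set22 ya !inE orbb => /esym/eqP ->.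
move=> xb; rewrite {}xb in E *; right; split=> //.
have /set2P[// |yb] : y \in [set a; b] by rewrite E set22.
by have := E a; rewrite set21 yb !inE orbb => /esym/eqP ->.
Qed.

Lemma edgesP Y (E : {set vert F}) :
  reflect (exists t u w, [/\ t \in Y, has_edge t u w & E = [set u; w]])
          (E \in edges Y).
Proof.
apply: (iffP imsetP) => [[[u w]]|[t [u [w [tY /orP[uw|wu] ->]]]]].
- rewrite inE /= => /existsP[t /andP[tY uw]] ->; exists t, u, w; split=> //.
  by rewrite /has_edge uw.
- by exists (u, w); rewrite // inE; apply/existsP; exists t; rewrite tY.
- exists (w, u); rewrite /= 1?setUC // inE; apply/existsP; exists t.
  by rewrite tY.
Qed.

Lemma has_edge_set t u w x y :
  has_edge t u w -> [set u; w] = [set x; y] -> has_edge t x y.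
Proof. by move=> e /set2_eq[[-> ->]|[-> ->]] //; rewrite has_edge_sym. Qed.

(** Inclusion and exclusion; the second hypothesis says that the common curve has Euler
    characteristic 0, as a union of circles does. *)
Lemma euler_setU Y Z : [disjoint Y & Z] ->
  #|verts Y :&: verts Z| = #|edges Y :&: edges Z| ->
  euler (Y :|: Z) = (euler Y + euler Z)%R.
Proof.
move=> dis E; rewrite /euler.
have -> : verts (Y :|: Z) = verts Y :|: verts Z by rewrite /verts bigcup_setU.
have -> : edges (Y :|: Z) = edges Y :|: edges Z.
  apply/setP => A; rewrite in_setU; apply/edgesP/orP => [[t [u [w [+ e ->]]]]|].
    by rewrite in_setU => /orP[tY|tZ]; [left|right]; apply/edgesP; exists t, u, w.
  by case=> /edgesP[t [u [w [tY e ->]]]]; exists t, u, w; rewrite in_setU tY ?orbT.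
have := cardsUI (verts Y) (verts Z); have := cardsUI (edges Y) (edges Z).
have := cardsUI Y Z; rewrite (disjoint_setI0 dis) cards0; lia.
Qed.

(** The share of the Euler characteristic of [S] in the closure of [T]. It may differ from
    [euler (S :&: T)], namely when a triangle of [S] outside [T] touches [T]. *)
Definition euler_on (T S : {set tri F}) : int :=
  (#|verts S :&: verts T|%:Z - #|edges S :&: edges T|%:Z + #|S :&: T|%:Z)%R.

(** An abstract incidence relation serves vertices, edges and triangles at once. By the last
    hypothesis [S1] and [S2] agree on the triangles outside [T] that share a cell with [T]; so at a
    cell of [T] the set [S'] looks like [S2], and at any other cell like [S1]. *)
Lemma card_swap (X : finType) (inc : tri F -> X -> bool) (T S1 S2 S' : {set tri F})
    (n : {set tri F} -> {set X}) :
  (forall A y, (y \in n A) = [exists t in A, inc t y]) ->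
  (forall t, t \in T -> (t \in S') = (t \in S2)) ->
  (forall t, t \notin T -> (t \in S') = (t \in S1)) ->
  (forall t t' y, t \in T -> t' \notin T -> inc t y -> inc t' y ->
     (t' \in S1) = (t' \in S2)) ->
  (#|n S'| + #|n S1 :&: n T| = #|n S1| + #|n S2 :&: n T|)%N.
Proof.
move=> nE ST SC loc.
have nT : n S' :&: n T = n S2 :&: n T.
  apply/setP=> x; rewrite !in_setI !nE; apply/andb_id2r => /existsP[t /andP[tT tx]].
  apply: eq_existsb => t'; apply: andb_id2r => t'x.
  by have [t'T|t'T] := boolP (t' \in T); [rewrite ST | rewrite SC // (loc t t' x)].
have nC : n S' :\: n T = n S1 :\: n T.
  apply/setP=> x; rewrite !in_setD !nE; apply/andb_id2l => nxT.
  apply: eq_existsb => t'; apply: andb_id2r => t'x; rewrite SC //.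
  by apply: contra nxT => t'T; apply/existsP; exists t'; rewrite t'T.
have := cardsID (n T) (n S'); have := cardsID (n T) (n S1).
rewrite nT nC; lia.
Qed.

Lemma euler_swap (T S1 S2 S' : {set tri F}) :
  (forall t, t \in T -> (t \in S') = (t \in S2)) ->
  (forall t, t \notin T -> (t \in S') = (t \in S1)) ->
  (forall t t' v, t \in T -> t' \notin T -> v \in verts_of t -> v \in verts_of t' ->
     (t' \in S1) = (t' \in S2)) ->
  euler S' = (euler S1 + (euler_on T S2 - euler_on T S1))%R.
Proof.
move=> ST SC loc.
have V := @card_swap _ (fun t v => v \in verts_of t) T S1 S2 S' (@verts R F).
have E := @card_swap _ (fun t (A : {set vert F}) =>
  [exists u, exists w, has_edge t u w && (A == [set u; w])]) T S1 S2 S' (@edges R F).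
have C := @card_swap _ (fun t t' => t == t') T S1 S2 S' id.
have {}V : (#|verts S'| + #|verts S1 :&: verts T| = #|verts S1| + #|verts S2 :&: verts T|)%N.
  apply: V => // A x.
  by apply/vertsP/existsP => [[t tA tx]|[t /andP[tA tx]]]; exists t; rewrite ?tA.
have {}E : (#|edges S'| + #|edges S1 :&: edges T| = #|edges S1| + #|edges S2 :&: edges T|)%N.
  apply: E => // [A x|t t' x tT t'T].
    apply/edgesP/existsP => [[t [u [w [tA e E]]]]|[t /andP[tA]]].
      exists t; rewrite tA; apply/existsP; exists u; apply/existsP; exists w.
      by rewrite e E eqxx.
    by case/existsP=> u /existsP[w /andP[e /eqP E]]; exists t, u, w.
  case/existsP=> u /existsP[w /andP[e /eqP E1]] /existsP[a /existsP[b /andP[e' /eqP E2]]].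
  have e'' : has_edge t' u w by apply: has_edge_set e' _; rewrite -E1 E2.
  apply: loc tT t'T (proj1 (has_edge_verts e)) (proj1 (has_edge_verts e'')).
have {}C : (#|S'| + #|S1 :&: T| = #|S1| + #|S2 :&: T|)%N.
  apply: C => // [A x|t t' x tT t'T /eqP tx /eqP t'x].
    by apply/idP/existsP => [xA|[t /andP[tA /eqP <-//]]]; exists x; rewrite xA /=.
  by rewrite t'x -tx tT in t'T.
rewrite /euler /euler_on; lia.
Qed.

End EulerCharacteristic.

(** * The surfaces of a coloring and their closed pieces *)

Section Surfaces.
Variables (R : realType) (N : nat) (F : prefoam R) (hF : is_foam F N).
Variable c : {ffun facet F -> {set 'I_N}}.
Hypothesis hc : is_coloring c.
Implicit Types (u v w x : vert F) (t : tri F) (i j l : 'I_N).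
Implicit Types (Y Z : {set tri F}) (G : {set facet F}).

Lemma surface1E i t : (t \in surface1 c i) = (i \in c (facet_of t)).
Proof. by rewrite inE. Qed.

Lemma surface2E i j t : (t \in surface2 c i j) =
  (i \in c (facet_of t)) (+) (j \in c (facet_of t)).
Proof. by rewrite inE. Qed.

Lemma surface1_pattern i j : surface1 c i = pattern c (fun a _ => a) i j.
Proof. by apply/setP => t; rewrite !inE. Qed.

Lemma surface2_pattern i j : surface2 c i j = pattern c addb i j.
Proof. by apply/setP => t; rewrite !inE. Qed.

Lemma linked_fst : linked_pattern (fun a _ => a).
Proof. by do 6!case. Qed.

Lemma linked_addb : linked_pattern addb.
Proof. by do 6!case. Qed.

Lemma linked_diff : linked_pattern (fun a b => a && ~~ b).
Proof. by do 6!case. Qed.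

Lemma fan_connected_pattern Q i j : linked_pattern Q -> fan_connected (pattern c Q i j).
Proof. by move=> HQ v t t'; apply: pattern_fan_connected. Qed.

Lemma fan_connected_sub Y Z : fan_connected Y -> Z \subset Y ->
  (forall v t t', t \in Z -> fan Y v t t' -> t' \in Z) -> fan_connected Z.
Proof.
move=> Yc /subsetP ZY cl v t t' tZ t'Z vt vt'.
have /connectP[p] := Yc v t t' (ZY _ tZ) (ZY _ t'Z) vt vt'.
elim: p t tZ {vt} => [|s p IH] t tZ /=; first by move=> _ ->; apply: connect0.
case/andP=> ts sp Et'; have sZ := cl _ _ _ tZ ts.
by apply: connect_trans (IH s sZ sp Et'); apply: connect1;
   case/and3P: ts => _ _ e; apply/and3P.
Qed.

(** Only the two thin triangles of a seam induce the same direction on it, and their colors are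
    disjoint. *)
Lemma dart_uniq_surface1 i : dart_uniq (surface1 c i).
Proof.
move=> t t' u w; rewrite !surface1E => it it' tuw t'uw.
case: (dart_cases hF tuw) => [[s [E _ _ _]]|[t2 [t3 s]]|[t1 [t2 s]]].
- by have /set1P-> : t' \in [set t] by rewrite -E inE.
- have [E12 _] := seam_atE s; move: t'uw; rewrite E12 => /orP[]/eqP // E.
  by have [_] := coloring_seam hc i s; rewrite it -E it'.
- by have [_ E] := seam_atE s; move: t'uw; rewrite E => /eqP.
Qed.

Lemma dart_uniq_sub Y Z : dart_uniq Y -> Z \subset Y -> dart_uniq Z.
Proof. by move=> Yu /subsetP ZY t t' u w /ZY tY /ZY t'Y; apply: Yu. Qed.

Lemma boundary_surface1 i : boundary (surface1 c i) = set0.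
Proof.
apply/setP => -[u w]; rewrite in_set0 in_set; apply/negP => /andP[].
case/dartsP=> t; rewrite surface1E => it tuw /negP; apply; apply/dartsP.
case: (dart_cases hF tuw) => [[s [_ E fE _]]|[t2 [t3 s]]|[t1 [t2 s]]].
- exists s; first by rewrite surface1E fE.
  by have := set11 s; rewrite -E inE.
- have [_ E3] := seam_atE s; exists t3; last by rewrite E3.
  by rewrite surface1E (coloring_seam hc i s).1 it.
- have [E12 _] := seam_atE s; move: it; rewrite (coloring_seam hc i s).1.
  by case/orP=> it; [exists t1|exists t2]; rewrite ?surface1E ?E12 ?eqxx ?orbT.
Qed.

Lemma circ_set0 (V : finType) : circ (set0 : {set V * V}) = 1%g.
Proof.
apply/permP => u; rewrite perm1 circ_permE ?circ_succ_id // => [w|].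
  by rewrite inE.
by split=> u' w' => [w''|w''||]; rewrite inE.
Qed.


Lemma surface1_even i : ~~ oddz (euler (surface1 c i)).
Proof.
have bc : circle_set (boundary (surface1 c i)).
  by rewrite boundary_surface1; split=> u' w' => [w''|w''||]; rewrite inE.
have fc : fan_connected (surface1 c i).
  rewrite (surface1_pattern i i); exact/fan_connected_pattern/linked_fst.
have := euler_parity hF (@dart_uniq_surface1 i) fc bc.
rewrite /euler oddzD oddzB !oddz_nat => ->.
by rewrite boundary_surface1 /tau circ_set0 odd_perm1 cards0.
Qed.

(* A union of components of F_ij(c), given by its facets. *)
Definition closed_facets i j G : Prop :=
  (forall f, f \in G -> (i \in c f) (+) (j \in c f)) /\
  (forall t t' u w, has_edge t u w -> has_edge t' u w -> facet_of t \in G ->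
     t' \in surface2 c i j -> facet_of t' \in G).

Definition region G : {set tri F} := [set t | facet_of t \in G].

Lemma regionE G t : (t \in region G) = (facet_of t \in G).
Proof. by rewrite inE. Qed.

Definition part i G : {set tri F} := [set t in region G | i \in c (facet_of t)].

Lemma partE i G t : (t \in part i G) = (facet_of t \in G) && (i \in c (facet_of t)).
Proof. by rewrite !inE. Qed.

Section Closed.
Variables (i j : 'I_N) (G : {set facet F}).
Hypothesis Gc : closed_facets i j G.

Lemma region_edge t t' u w : has_edge t u w -> has_edge t' u w ->
  t \in region G -> t' \in surface2 c i j -> t' \in region G.
Proof. by rewrite !regionE; apply: (proj2 Gc). Qed.

Lemma region_surface2 t : t \in region G -> t \in surface2 c i j.
Proof. by rewrite regionE surface2E => /Gc.1. Qed.

(** [closed_facets] speaks of shared edges. As F_ij has no pinch points, a chain of its triangles at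
    [v], each sharing an edge with the next, joins [t] to [t']. *)
Lemma region_vertex v t t' : t \in region G -> t' \in surface2 c i j ->
  v \in verts_of t -> v \in verts_of t' -> t' \in region G.
Proof.
move=> tG t'S vt vt'; have tS := region_surface2 tG.
rewrite (surface2_pattern i j) in t'S tS.
have /connectP[p] := fan_connected_pattern linked_addb tS t'S vt vt'.
elim: p t tG {vt tS} => [|s p IH] t tG /=; first by move=> _ ->.
case/andP=> /and3P[_ sS /existsP[w /andP[e e']]] sp E; apply: IH sp E.
by apply: region_edge e e' tG _; rewrite (surface2_pattern i j).
Qed.

Lemma partP t : t \in part i G = (t \in region G) && (i \in c (facet_of t)) && (j \notin c
  (facet_of t)).
Proof.
rewrite partE regionE; case: (boolP (_ \in G)) => //= /Gc.1.
by case: (i \in _); case: (j \in _).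
Qed.

(** Across an edge, color i continues in a sheet without j, except at a seam whose other thin facet
    carries j. There the part with i is thin, so its boundary direction is the orientation of the
    seam. *)
Lemma boundary_part : boundary (part i G) = [set e in bic c i j | e.1 \in verts (region G)].
Proof.
have diffE t : (t \in part i G) = (t \in region G) && (i \in c (facet_of t)) && (j \notin c
  (facet_of t)).
  exact: partP.
apply/setP => -[u w]; rewrite [RHS]in_set [LHS]in_set /=; apply/andP/andP => -[].
  case/dartsP=> t tX tuw nX; have := tX; rewrite diffE -andbA => /and3P[tG it jt].
  have nXt s : dart s w u -> i \in c (facet_of s) -> j \notin c (facet_of s) -> False.
    move=> swu si js; case/negP: nX; apply/dartsP; exists s => //.
    rewrite diffE si js !andbT; apply: (@region_edge t s u w) tG _.
    - by rewrite /has_edge tuw.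
    - by rewrite /has_edge swu orbT.
    - by rewrite surface2E si (negbTE js).
  have uG : u \in verts (region G).
    by apply/vertsP; exists t => //; case: (dart_verts tuw).
  split=> //; case: (dart_cases hF tuw) => [[s [_ E fE _]]|[t2 [t3 s]]|[t1 [t2 s]]].
  - by case: (nXt s); rewrite ?fE //; have := set11 s; rewrite -E inE.
  - have [E12 E3] := seam_atE s; have [Ei ni] := coloring_seam hc i s.
    have [Ej nj] := coloring_seam hc j s; rewrite it /= in Ei ni.
    rewrite (negbTE jt) /= in Ej.
    apply/bicP; exists t, t2, t3; rewrite it jt /= (negbTE ni) Ei Ej /= andbT.
    have [j2|j2] := boolP (j \in c (facet_of t2)); first by [].
    by case: (nXt t3); rewrite ?E3 ?Ei ?Ej.
  - have [E12 E3] := seam_atE s; have [Ei _] := coloring_seam hc i s.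
    have [Ej _] := coloring_seam hc j s; rewrite it in Ei; rewrite (negbTE jt) in Ej.
    have /norP[j1 j2] : ~~ ((j \in c (facet_of t1)) || (j \in c (facet_of t2))) by rewrite -Ej.
    by have /esym/orP[i1|i2] := Ei; [case: (nXt t1)|case: (nXt t2)];
       rewrite ?E12 ?eqxx ?orbT.
case/bicP=> t1 [t2 [t3 [s /andP[i1 j1] /andP[j2 i2] /andP[i3 j3]]]] /vertsP[t tG ut].
have [E12 E3] := seam_atE s.
have d1 : dart t1 u w by rewrite E12 eqxx.
split.
  apply/dartsP; exists t1 => //; rewrite diffE i1 j1 !andbT.
  apply: region_vertex tG _ ut _; last by case: (dart_verts d1).
  by rewrite surface2E i1 (negbTE j1).
apply/negP => /dartsP[t']; rewrite diffE E3 => /andP[_ +] /eqP E.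
by rewrite E j3.
Qed.

Lemma part_fan : fan_connected (part i G).
Proof.
apply: (fan_connected_sub (fan_connected_pattern (i := i) (j := j) linked_diff)).
  by apply/subsetP => t; rewrite partP => /andP[/andP[_ it] jt]; rewrite inE it.
move=> v t t' tX /and3P[_ ]; rewrite inE => /andP[it' jt'] /existsP[w /andP[e e']].
rewrite !partP it' jt' !andbT in tX *; case/andP: tX => /andP[tG _] _.
by apply: region_edge e e' tG _; rewrite surface2E it' (negbTE jt').
Qed.

Lemma part_sub : part i G \subset surface1 c i.
Proof. by apply/subsetP => t; rewrite partP surface1E => /andP[/andP[_ ->]]. Qed.

Lemma part_uniq : dart_uniq (part i G).
Proof. exact: dart_uniq_sub (@dart_uniq_surface1 i) part_sub. Qed.

Lemma part_circles : circle_set (boundary (part i G)).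
Proof.
apply: (boundary_circles hF part_uniq) => v.
have bal := boundary_balanced hF v part_uniq.
have := bic_degree hF c i j v.
have sub e : e \in boundary (part i G) -> e \in bic c i j.
  by rewrite boundary_part in_set => /andP[].
have sub_card (f : vert F -> vert F * vert F) :
  (#|[set w | f w \in boundary (part i G)]| <= #|[set w | f w \in bic c i j]|)%N.
  by apply/subset_leq_card/subsetP => w; rewrite 2!in_set => /sub; rewrite in_set.
have := sub_card (fun w => (v, w)); have := sub_card (fun w => (w, v)).
rewrite -bal; lia.
Qed.
End Closed.

(** Color i is missing on [s] but present on another sheet at the edge, so [s] is a thin sheet of a
    seam. The second thin sheet then carries i, and not j since [s] has it. *)
Lemma shared_edge_bic i j s s' v w : has_edge s v w -> has_edge s' v w ->
  i \notin c (facet_of s) -> j \in c (facet_of s) -> i \in c (facet_of s') ->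
  (v, w) \in bic c i j \/ (w, v) \in bic c i j.
Proof.
have key x y : dart s x y -> has_edge s' x y ->
    i \notin c (facet_of s) -> j \in c (facet_of s) -> i \in c (facet_of s') ->
    (x, y) \in bic c i j.
  move=> sxy s'xy ni js is'.
  case: (dart_cases hF sxy) => [[t [E1 E2 fE _]]|[t2 [t3 st]]|[t1 [t2 st]]].
  - case/orP: s'xy => d.
      have /set1P E : s' \in [set s] by rewrite -E1 inE.
      by rewrite E (negbTE ni) in is'.
    have /set1P E : s' \in [set t] by rewrite -E2 inE.
    by rewrite E fE (negbTE ni) in is'.
  - have [E12 E3] := seam_atE st; have [Ei ni2] := coloring_seam hc i st.
    have [Ej nj] := coloring_seam hc j st; rewrite js /= in Ej nj.
    rewrite (negbTE ni) /= in Ei ni2.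
    suff i2 : i \in c (facet_of t2).
      by rewrite bicC; apply/bicP; exists s, t2, t3; rewrite js ni i2 nj Ei Ej i2.
    move: s'xy; rewrite /has_edge E12 E3 -orbA => /or3P[]/eqP E.
    + by rewrite E (negbTE ni) in is'.
    + by rewrite -E.
    + by rewrite -Ei -E.
  - have [E12 E3] := seam_atE st; have [Ei _] := coloring_seam hc i st.
    rewrite (negbTE ni) in Ei; have /norP[n1 n2] := negbT (esym Ei).
    move: s'xy; rewrite /has_edge E12 E3 => /or3P[]/eqP E;
      by rewrite E ?(negbTE ni) ?(negbTE n1) ?(negbTE n2) in is'.
move=> /orP[d|d] e' ni js is'; first by left; apply: key.
by right; apply: key; rewrite // has_edge_sym.
Qed.

(** Walk from [t] to [t'] through a fan on which j persists as long as i is absent; the edge where i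
    first appears is bicolored. The pattern is membership of j if [t'] has j, and membership of
    exactly one of i, j otherwise. *)
Lemma vertex_bic_any i j t t' v : v \in verts_of t -> v \in verts_of t' ->
  i \notin c (facet_of t) -> j \in c (facet_of t) -> i \in c (facet_of t') ->
  exists w, (v, w) \in bic c i j \/ (w, v) \in bic c i j.
Proof.
move=> vt vt' ni jt it'.
have key Q : linked_pattern Q -> (forall b, Q false b = b) ->
    t \in pattern c Q i j -> t' \in pattern c Q i j ->
    exists w, (v, w) \in bic c i j \/ (w, v) \in bic c i j.
  move=> HQ Q0 tQ t'Q.
  have /connectP[p] := fan_connected_pattern HQ tQ t'Q vt vt'.
  elim: p t ni jt {vt tQ} => [|s p IH] t ni jt /=; first by move=> _ E; rewrite -E it' in ni.
  case/andP=> /and3P[_ sQ /existsP[w /andP[e e']]] sp E.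
  have [i_s|i_s] := boolP (i \in c (facet_of s)).
    by exists w; apply: (shared_edge_bic e e').
  by apply: (IH s) => //; move: sQ; rewrite inE (negbTE i_s) Q0.
have [jt'|jt'] := boolP (j \in c (facet_of t')).
  apply: (key (fun _ b => b)) => //; first by do 6!case.
  by rewrite inE. by rewrite inE.
apply: (key addb) => //; [exact: linked_addb| |].
  by rewrite inE (negbTE ni) jt.
by rewrite inE it' (negbTE jt').
Qed.


Lemma closed_facetsC i j G : closed_facets i j G -> closed_facets j i G.
Proof.
case=> G1 G2; split=> [f /G1|t t' u w e e' tG t'S]; first by rewrite addbC.
by apply: G2 e e' tG _; move: t'S; rewrite !surface2E addbC.
Qed.

Definition mixed_facets i j : {set facet F} := [set f | (i \in c f) (+) (j \in c f)].

Lemma region_mixed i j : region (mixed_facets i j) = surface2 c i j.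
Proof. by apply/setP => t; rewrite !inE. Qed.

Lemma closed_mixed i j : closed_facets i j (mixed_facets i j).
Proof.
split=> [f|t t' u w _ _ _]; first by rewrite inE.
by rewrite !inE.
Qed.

Lemma bic_darts i j u w : (u, w) \in bic c i j -> exists t1 t2,
  [/\ dart t1 u w, dart t2 u w,
   (i \in c (facet_of t1)) && (j \notin c (facet_of t1)) &
   (j \in c (facet_of t2)) && (i \notin c (facet_of t2))].
Proof.
case/bicP=> t1 [t2 [t3 [s a b _]]]; exists t1, t2; have [E _] := seam_atE s.
by rewrite !E !eqxx orbT.
Qed.

Lemma bic_circles i j : circle_set (bic c i j).
Proof.
have := part_circles (closed_mixed i j).
rewrite (boundary_part (closed_mixed i j)).
have -> // : [set e in bic c i j | e.1 \in verts (region (mixed_facets i j))] = bic c i j.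
apply/setP => -[u w]; rewrite in_set andb_idr // => /bic_darts[t1 [_ [d _ /andP[it jt] _]]].
apply/vertsP; exists t1; last by case: (dart_verts d).
by rewrite region_mixed surface2E it (negbTE jt).
Qed.

Lemma vertex_bic i j t t' v : v \in verts_of t -> v \in verts_of t' ->
  i \notin c (facet_of t) -> j \in c (facet_of t) -> i \in c (facet_of t') ->
  exists w, (v, w) \in bic c i j.
Proof.
move=> vt vt' ni jt it'; have [w [vw|wv]] := vertex_bic_any vt vt' ni jt it'.
  by exists w.
by have [_ _ h _] := bic_circles i j; apply: h wv.
Qed.

Section ClosedEuler.
Variables (i j : 'I_N) (G : {set facet F}).
Hypothesis Gc : closed_facets i j G.
Let Gc' := closed_facetsC Gc.
Let B := boundary (part i G).

Lemma boundary_partC : boundary (part j G) = boundary (part i G).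
Proof. by rewrite (boundary_part Gc) (boundary_part Gc') bicC. Qed.

Lemma part_parity : oddz (euler (part i G)) = tau (boundary (part i G)).
Proof.
have := euler_parity hF (part_uniq Gc) (part_fan Gc) (part_circles Gc).
by rewrite /euler oddzD oddzB !oddz_nat => ->.
Qed.

Lemma region_parts : region G = part i G :|: part j G.
Proof.
apply/setP => t; rewrite in_setU !partE regionE; case: (boolP (_ \in G)) => //= /Gc.1.
by case: (i \in _); case: (j \in _).
Qed.

Lemma parts_disjoint : [disjoint part i G & part j G].
Proof.
apply/pred0P => t /=; rewrite !partE; apply/negP => /andP[/andP[tG ti] /andP[_ tj]].
by have := Gc.1 _ tG; rewrite ti tj.
Qed.

Let bdP e : e \in B -> (e.1, e.2) \in bic c i j /\ e.1 \in verts (region G).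
Proof. by case: e => u w; rewrite /B (boundary_part Gc) in_set => /andP. Qed.

Let bdI u w : (u, w) \in bic c i j -> u \in verts (region G) -> (u, w) \in B.
Proof. by move=> b uG; rewrite /B (boundary_part Gc) in_set b. Qed.

Let bd_darts u w : (u, w) \in B -> (u, w) \in darts (part i G) /\ (u, w) \in darts (part j G).
Proof.
move=> uw; split; first by move: uw; rewrite /B in_set => /andP[].
by move: uw; rewrite /B -boundary_partC in_set => /andP[].
Qed.

Let Y_i t : t \in part j G -> (i \notin c (facet_of t)) /\ j \in c (facet_of t).
Proof. by rewrite (partP Gc') => /andP[/andP[_ ->] ->]. Qed.

(** Both sides count boundary darts: the two parts meet exactly in the bicolored circles, where a
    dart is determined by its source and also by its underlying edge. *)
Lemma card_parts_edges :
  #|verts (part i G) :&: verts (part j G)| = #|edges (part i G) :&: edges (part j G)|.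
Proof.
have [Bf Bg Bo _] := part_circles Gc.
have -> : verts (part i G) :&: verts (part j G) = fst @: B.
  apply/setP => v; rewrite in_setI; apply/andP/imsetP => [[]|[[u w] uw ->]] /=.
    case/vertsP=> t' + vt' /vertsP[t tY vt]; rewrite partE => /andP[t'G it'].
    have [ni jt] := Y_i tY; have [w vw] := vertex_bic vt vt' ni jt it'.
    exists (v, w) => //; apply: bdI => //; apply/vertsP; exists t' => //.
    by rewrite regionE.
  have [/dartsP[t tX d] /dartsP[t' t'Y d']] := bd_darts uw.
  by split; apply/vertsP; [exists t|exists t']; rewrite ?(dart_verts d).1 ?(dart_verts d').1.
have -> : edges (part i G) :&: edges (part j G) = (fun e => [set e.1; e.2]) @: B.
  apply/setP => E; rewrite in_setI; apply/andP/imsetP => [[]|[[u w] uw ->]] /=.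
    case/edgesP=> t' [u [w [t'X e' ->]]] /edgesP[t [x [y [tY e /esym E']]]].
    have {E'}e := has_edge_set e E'; have [ni jt] := Y_i tY.
    move: (t'X); rewrite partE => /andP[t'G it'].
    have [d|d] := shared_edge_bic e e' ni jt it'; [exists (u, w)|exists (w, u)];
      rewrite /= 1?setUC //; apply: bdI => //; apply/vertsP; exists t';
      by rewrite ?regionE //; case: (has_edge_verts e').
  have [/dartsP[t tX d] /dartsP[t' t'Y d']] := bd_darts uw.
  by split; apply/edgesP; [exists t, u, w|exists t', u, w];
     rewrite /has_edge ?d ?d'.
rewrite !card_in_imset // => -[u w] [u' w'] uw uw' /=.
  case/set2_eq => -[? ?]; subst => //.
  have [/bicP[t1 [t2 [t3 [s _ _ _]]]] _] := bdP uw.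
  have [/bicP[s1 [s2 [s3 [s' _ _ _]]]] _] := bdP uw'.
  by move: (seam_at_asym s1 s2 s3 s); rewrite s'.
by move=> E; rewrite -E in uw' *; rewrite (Bf _ _ _ uw uw').
Qed.

Lemma euler_region : euler (region G) = (euler (part i G) + euler (part j G))%R.
Proof. by rewrite region_parts euler_setU ?parts_disjoint ?card_parts_edges. Qed.

(** A cell of F_i found on a triangle of the region without i lies on a bicolored seam, hence also
    on a triangle of the part with i. *)
Lemma euler_on_surface1 : euler_on (region G) (surface1 c i) = euler (part i G).
Proof.
have XG t : t \in region G -> i \in c (facet_of t) -> t \in part i G.
  by rewrite partE regionE => -> ->.
have GY t : t \in region G -> i \notin c (facet_of t) -> j \in c (facet_of t).
  by rewrite regionE => /Gc.1; case: (i \in _); case: (j \in _).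
have XS t : t \in part i G -> t \in region G /\ t \in surface1 c i.
  by rewrite partE regionE surface1E => /andP.
have bicX v w t : v \in verts_of t -> t \in region G -> (v, w) \in bic c i j ->
    exists2 t1, t1 \in part i G & dart t1 v w.
  move=> vt tG /bic_darts[t1 [_ [d _ /andP[i1 j1] _]]]; exists t1 => //; apply: XG => //.
  apply: (region_vertex Gc) tG _ vt _; last by case: (dart_verts d).
  by rewrite surface2E i1 (negbTE j1).
rewrite /euler_on /euler; congr (_ - _ + _)%R; congr (Posz _); apply: eq_card.
- move=> v; rewrite in_setI; apply/andP/idP => [[]|].
    case/vertsP=> t'; rewrite surface1E => it' vt' /vertsP[t tG vt].
    have [it|it] := boolP (i \in c (facet_of t)); first by apply/vertsP; exists t; rewrite ?XG.
    have [w vw] := vertex_bic vt vt' it (GY _ tG it) it'.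
    have [t1 t1X d] := bicX _ _ _ vt tG vw.
    by apply/vertsP; exists t1 => //; case: (dart_verts d).
  by case/vertsP=> t /XS[tG tS] vt; split; apply/vertsP; exists t.
- move=> E; rewrite in_setI; apply/andP/idP => [[]|].
    case/edgesP=> t' [u [w [+ e' ->]]]; rewrite surface1E => it'.
    case/edgesP=> t [x [y [tG e /esym E']]]; have {E'}e := has_edge_set e E'.
    have [it|it] := boolP (i \in c (facet_of t)).
      by apply/edgesP; exists t, u, w; rewrite XG.
    have [ut wt] := has_edge_verts e.
    case: (shared_edge_bic e e' it (GY _ tG it) it') => [uw|wu].
      have [t1 t1X d] := bicX _ _ _ ut tG uw.
      by apply/edgesP; exists t1, u, w; rewrite /has_edge d.
    have [t1 t1X d] := bicX _ _ _ wt tG wu.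
    by apply/edgesP; exists t1, u, w; rewrite /has_edge d orbT.
  by case/edgesP=> t [u [w [/XS[tG tS] e ->]]]; split; apply/edgesP; exists t, u, w.
- move=> t; rewrite in_setI; apply/andP/idP => [[]|/XS[tG tS]]; last by [].
  by rewrite surface1E => it tG; apply: XG.
Qed.

End ClosedEuler.

End Surfaces.

(** * Arcs on the sphere *)

Section SphericalArcs.
Local Open Scope ring_scope.
Variable R : realType.
Implicit Types (a b p q x y w z : 'rV[R]_3).

Lemma det3E x y w : det3 x y w =
  x 0 0 * (y 0 1 * w 0 2 - y 0 2 * w 0 1) - x 0 1 * (y 0 0 * w 0 2 - y 0 2 * w 0 0)
  + x 0 2 * (y 0 0 * w 0 1 - y 0 1 * w 0 0).
Proof.
rewrite /det3 (expand_det_row _ 0) !big_ord_recl big_ord0 /cofactor.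
rewrite !(expand_det_row _ 0) !big_ord_recl !big_ord0 /cofactor !det_mx11.
rewrite !mxE /=.
have -> : lift 0 0 = 1 :> 'I_3 by apply/val_inj.
have -> : lift 0 (lift 0 0) = 2 :> 'I_3 by apply/val_inj.
have -> : lift 1 (lift 0 0) = 2 :> 'I_3 by apply/val_inj.
rewrite /=.
have -> : lift ord0 (lift (lift ord0 ord0) 0) = 1 :> 'I_3 by apply/val_inj.
have -> : lift 1 (lift (lift ord0 ord0) 0) = 0 :> 'I_3 by apply/val_inj.
have -> : lift 2 (lift (lift ord0 ord0) 0) = 0 :> 'I_3 by apply/val_inj.
have -> : lift 2 (lift ord0 ord0) = 1 :> 'I_3 by apply/val_inj.
have -> : lift 1 ord0 = 0 :> 'I_3 by apply/val_inj.
have -> : lift 2 ord0 = 0 :> 'I_3 by apply/val_inj.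
rewrite /bump /= !addn0 !add0n !expr0 !expr1 sqrrN expr1n.
have -> : ord0 = 0 :> 'I_3 by [].
ring.
Qed.

Lemma row3P x y : x 0 0 = y 0 0 -> x 0 1 = y 0 1 -> x 0 2 = y 0 2 -> x = y.
Proof.
move=> e0 e1 e2; apply/rowP => -[[|[|[|m]]] hm] //.
- by have -> : Ordinal hm = 0 by apply/val_inj.
- by have -> : Ordinal hm = 1 by apply/val_inj.
- by have -> : Ordinal hm = 2 by apply/val_inj.
Qed.

Section Arcs.
Variable z : 'rV[R]_3.
Local Notation "[[ a , b ]]" := (det3 z a b).

Definition covers (r s t : R) : bool :=
  [&& 0 < r, 0 < s & 0 < t] || [&& r < 0, s < 0 & t < 0].

(* The arc from a to b is seen from p along the meridians with pole z: the sign
   tells whether the arc passes above or below p, and in which direction. *)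
Definition arc_over a b p : R :=
  if covers [[a, p]] [[p, b]] [[a, b]] then - Num.sg (det3 a b p) else 0.

Lemma br_anti a b : [[b, a]] = - [[a, b]].
Proof. by rewrite !det3E; ring. Qed.

Lemma coversN r s t : covers (- r) (- s) (- t) = covers r s t.
Proof. by rewrite /covers !oppr_gt0 !oppr_lt0 orbC. Qed.

Lemma coversC r s t : covers r s t = covers s r t.
Proof. by rewrite /covers; case: (0 < r); case: (0 < s); case: (r < 0); case: (s < 0). Qed.

Lemma det3_anti a b p : det3 b a p = - det3 a b p.
Proof. by rewrite !det3E; ring. Qed.

Lemma arc_over_rev a b p : arc_over b a p = - arc_over a b p.
Proof.
rewrite /arc_over (br_anti p b) (br_anti a p) (br_anti a b) coversN coversC.
by rewrite (det3_anti a b p) sgrN; case: ifP; rewrite ?opprK ?oppr0.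
Qed.

(** Built so as to vanish for disjoint arcs while being a combination of differences between the two
    ends of one arc seen from the other; sums over the pairs of arcs of two paths then telescope. *)
Definition arc_cross a b p q : R :=
  arc_over a b q - arc_over a b p + arc_over p q a - arc_over p q b.

(** Disjointness of two arcs on the sphere, expressed by the cones over them. *)
Definition cones_meet_at_0 a b p q := forall s t u v : R,
  0 <= s -> 0 <= t -> 0 <= u -> 0 <= v ->
  s *: a + t *: b = u *: p + v *: q -> [/\ s = 0, t = 0, u = 0 & v = 0].

Lemma plucker a b p q :
  [[a, b]] * [[p, q]] = [[a, p]] * [[b, q]] - [[a, q]] * [[b, p]].
Proof. by rewrite !det3E; ring. Qed.

(** Cramer's rule, with [z] as third vector next to [a] and [b]. *)
Lemma four_vectors a b p :
  [[a, b]] *: p = [[p, b]] *: a + [[a, p]] *: b + det3 a b p *: z.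
Proof. by apply: row3P; rewrite !mxE !det3E; ring. Qed.

(** Eliminates [z] between the Cramer relations for [p] and [q], which leaves a relation between the
    two cones. *)
Lemma eight_terms a b p q :
  (det3 a b q * [[p, b]] - det3 a b p * [[q, b]]) *: a
    + (det3 a b q * [[a, p]] - det3 a b p * [[a, q]]) *: b
  = (det3 a b q * [[a, b]]) *: p + (- det3 a b p * [[a, b]]) *: q.
Proof.
have Vp := four_vectors a b p; have Vq := four_vectors a b q.
transitivity (det3 a b q *: ([[a, b]] *: p) - det3 a b p *: ([[a, b]] *: q)).
  rewrite Vp Vq !scalerDr !scalerA !scalerBl.
  by apply: row3P; rewrite !mxE; ring.
by rewrite !scalerA mulNr scaleNr.
Qed.

Lemma cross_term a b p q :
  det3 p q b *: a - det3 p q a *: b = det3 a b p *: q - det3 a b q *: p.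
Proof. by apply: row3P; rewrite !mxE !det3E; ring. Qed.

(** Both [p] and [q] have longitudes between [a] and [b]. If one lay above the arc and the other
    below, the coefficients in [eight_terms], up to a common sign, would give a common vector of the
    cones. *)
Lemma same_side a b p q : cones_meet_at_0 a b p q -> 0 < [[a, b]] ->
  0 < [[a, p]] -> [[b, p]] < 0 -> 0 < [[a, q]] -> [[b, q]] < 0 ->
  Num.sg (det3 a b p) = Num.sg (det3 a b q).
Proof.
move=> disj ab ap bp aq bq.
have pb : 0 < [[p, b]] by rewrite br_anti oppr_gt0.
have qb : 0 < [[q, b]] by rewrite br_anti oppr_gt0.
have Vp := four_vectors a b p; have Vq := four_vectors a b q.
have dp0 : det3 a b p != 0.
  apply/eqP => dp.
  have [] := disj _ _ _ _ (ltW pb) (ltW ap) (ltW ab) (lexx 0).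
    by rewrite Vp dp !scale0r !addr0.
  by move=> _ _ E; move: ab; rewrite E ltxx.
have dq0 : det3 a b q != 0.
  apply/eqP => dq.
  have [] := disj _ _ _ _ (ltW qb) (ltW aq) (lexx 0) (ltW ab).
    by rewrite Vq dq !scale0r !addr0 add0r.
  by move=> _ _ _ E; move: ab; rewrite E ltxx.
have V := eight_terms a b p q.
have opp (s : R) : 0 < s * det3 a b q -> 0 < s * - det3 a b p -> False.
  move=> hq hp; have h1 : 0 <= s * (det3 a b q * [[p, b]] - det3 a b p * [[q, b]]).
    rewrite mulrBr !mulrA -mulNr -mulrN; nra.
  have h2 : 0 <= s * (det3 a b q * [[a, p]] - det3 a b p * [[a, q]]).
    rewrite mulrBr !mulrA -mulNr -mulrN; nra.
  have h3 : 0 < s * (det3 a b q * [[a, b]]) by rewrite mulrA mulr_gt0.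
  have h4 : 0 <= s * (- det3 a b p * [[a, b]]) by rewrite mulrA ltW // mulr_gt0.
  have [|_ _ E _] := disj _ _ _ _ h1 h2 (ltW h3) h4; last by rewrite E ltxx in h3.
  by rewrite -!(scalerA s) -!scalerDr V.
case: (ltrgt0P (det3 a b p)) dp0 => // dp _; case: (ltrgt0P (det3 a b q)) dq0 => // dq _.
- by rewrite !gtr0_sg.
- by case: (opp (-1)); rewrite mulN1r ?opprK ?oppr_gt0.
- by case: (opp 1); rewrite mul1r ?oppr_gt0.
- by rewrite !ltr0_sg.
Qed.

(** The longitudes occur in the order a, p, b, q. If [p] lay on the same side of the arc ab as [b]
    of the arc pq, the coefficients in [cross_term] would exhibit a common vector of the cones. *)
Lemma opposite_sides a b p q : cones_meet_at_0 a b p q ->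
  0 < [[a, b]] -> 0 < [[p, q]] ->
  0 < [[a, p]] -> [[b, p]] < 0 -> 0 < [[b, q]] ->
  Num.sg (det3 a b p) + Num.sg (det3 p q b) = 0.
Proof.
move=> disj ab pq ap bp bq.
have V := cross_term a b p q.
have e1 : - det3 a b q * [[b, p]] = - (det3 p q b * [[a, b]] + det3 a b p * [[b, q]]).
  by rewrite !det3E; ring.
have e2 : - det3 p q a * [[b, p]] = - (det3 p q b * [[a, p]] + det3 a b p * [[p, q]]).
  by rewrite !det3E; ring.
have pos (s : R) : 0 <= s * det3 p q b -> 0 <= s * det3 a b p -> s != 0 ->
    det3 p q b = 0 /\ det3 a b p = 0.
  move=> db dp s0.
  have V' : (s * det3 p q b) *: a + (s * - det3 p q a) *: b
      = (s * - det3 a b q) *: p + (s * det3 a b p) *: q.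
    by rewrite -!scalerA -!scalerDr scaleNr V addrC -scaleNr.
  have h1 : 0 <= s * - det3 p q a.
    have : 0 <= s * - det3 p q a * - [[b, p]].
      rewrite mulrN -mulrA e2 mulrN opprK; nra.
    by rewrite pmulr_lge0 // oppr_gt0.
  have h2 : 0 <= s * - det3 a b q.
    have : 0 <= s * - det3 a b q * - [[b, p]].
      rewrite mulrN -mulrA e1 mulrN opprK; nra.
    by rewrite pmulr_lge0 // oppr_gt0.
  have [/eqP + _ _ /eqP] := disj _ _ _ _ db h1 h2 dp V'.
  by rewrite !mulf_eq0 (negbTE s0) /= => /eqP -> /eqP ->.
case: (sgrP (det3 a b p)) => dp; case: (sgrP (det3 p q b)) => db;
  rewrite ?addr0 ?subrr ?addNr //.
all: try by have [] := pos 1; rewrite ?mul1r ?db ?dp ?oner_neq0 ?lexx ?ltW //= => *;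
  exfalso; lra.
all: by have [] := pos (-1); rewrite ?mulN1r ?oppr_ge0 ?db ?dp ?oppr_eq0 ?oner_neq0 ?lexx ?ltW
  //= => *;
  exfalso; lra.
Qed.

(** For a generic pole a vanishing bracket means linear dependence, and distinct points of an
    embedded link can then only have opposite directions. *)
Definition opposite_if_aligned x y :=
  [[x, y]] = 0 -> exists2 s : R, 0 < s & x = - s *: y.

Lemma br_scale (s : R) x y : [[- s *: x, y]] = - s * [[x, y]].
Proof. by rewrite !det3E !mxE; ring. Qed.

Lemma arc_over_pos a b p : 0 < [[a, b]] ->
  arc_over a b p = if (0 < [[a, p]]) && ([[b, p]] < 0) then - Num.sg (det3 a b p) else 0.
Proof.
move=> ab; rewrite /arc_over /covers ab (lt_gtF ab) !andbF orbF andbT.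
by rewrite (br_anti b p) oppr_gt0.
Qed.

(** The signs of the four brackets tell how the longitude intervals overlap. If one contains the
    other, [same_side] cancels the terms; if they overlap partially, [opposite_sides] does; the
    remaining patterns with nonzero terms contradict the Pluecker relation or the alignment
    hypotheses. *)
Lemma arc_cross_pos a b p q : cones_meet_at_0 a b p q ->
  0 < [[a, b]] -> 0 < [[p, q]] ->
  opposite_if_aligned a p -> opposite_if_aligned b q -> arc_cross a b p q = 0.
Proof.
move=> disj ab pq oap obq; rewrite /arc_cross !arc_over_pos //.
have disj' : cones_meet_at_0 p q a b.
  by move=> s t u v s0 t0 u0 v0 /esym E; case: (disj u v s t) => //.
rewrite (br_anti a p) (br_anti a q) (br_anti b p) (br_anti b q) !oppr_lt0 !oppr_gt0.
have P := plucker a b p q.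
have ap0 : [[a, p]] = 0 -> [[a, q]] < 0.
  by move=> /oap[s s0 ->]; rewrite br_scale; nra.
have ap0' : [[a, p]] = 0 -> 0 < [[b, p]] .
  case/oap=> s s0 E; move: ab; rewrite E br_scale (br_anti b p); nra.
have bq0 : [[b, q]] = 0 -> [[a, q]] < 0.
  case/obq=> s s0 E; move: ab; rewrite E br_anti br_scale (br_anti a q); nra.
have bq0' : [[b, q]] = 0 -> 0 < [[b, p]].
  case/obq=> s s0 ->; rewrite br_scale (br_anti p q); nra.
have S1 := same_side disj ab; have S2 := same_side disj' pq.
have O1 := opposite_sides disj ab pq; have O2 := opposite_sides disj' pq ab.
rewrite (br_anti a p) (br_anti a q) (br_anti b p) (br_anti b q) in S2 O2.
rewrite !oppr_lt0 !oppr_gt0 in S2 O2.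
set ap := [[a, p]] in P ap0 ap0' bq0 bq0' S1 S2 O1 O2 *.
set aq := [[a, q]] in P ap0 ap0' bq0 bq0' S1 S2 O1 O2 *.
set bp := [[b, p]] in P ap0 ap0' bq0 bq0' S1 S2 O1 O2 *.
set bq := [[b, q]] in P ap0 ap0' bq0 bq0' S1 S2 O1 O2 *.
have pos : 0 < ap * bq - aq * bp by rewrite -P mulr_gt0.
case: (ltrgt0P ap) => hap; case: (ltrgt0P aq) => haq; case: (ltrgt0P bp) => hbp;
  case: (ltrgt0P bq) => hbq; rewrite /= ?subrr ?addr0 ?sub0r ?add0r ?oppr0 ?subr0 //.
all: try by have := S1 hap hbp haq hbq; lra.
all: try by have := S2 hap haq hbp hbq; lra.
all: try by have := O1 hap hbp hbq; lra.
all: try by have := O2 hap haq hbq; lra.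
all: exfalso.
all: try by have := ap0 hap; lra.
all: try by have := ap0' hap; lra.
all: try by have := bq0 hbq; lra.
all: try by have := bq0' hbq; lra.
all: clear - pos hap haq hbp hbq; nra.
Qed.

Lemma arc_cross_revl a b p q : arc_cross b a p q = - arc_cross a b p q.
Proof. by rewrite /arc_cross !(arc_over_rev a b); ring. Qed.

Lemma arc_cross_revr a b p q : arc_cross a b q p = - arc_cross a b p q.
Proof. by rewrite /arc_cross !(arc_over_rev p q); ring. Qed.

Lemma cones_revl a b p q : cones_meet_at_0 a b p q -> cones_meet_at_0 b a p q.
Proof.
by move=> d s t u v s0 t0 u0 v0; rewrite addrC => E; case: (d t s u v).
Qed.

Lemma cones_revr a b p q : cones_meet_at_0 a b p q -> cones_meet_at_0 a b q p.
Proof.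
by move=> d s t u v s0 t0 u0 v0; rewrite [RHS]addrC => E; case: (d s t v u).
Qed.

Lemma arc_cross_disjoint a b p q : cones_meet_at_0 a b p q ->
  [[a, b]] != 0 -> [[p, q]] != 0 ->
  opposite_if_aligned a p -> opposite_if_aligned a q ->
  opposite_if_aligned b p -> opposite_if_aligned b q -> arc_cross a b p q = 0.
Proof.
move=> disj ab pq oap oaq obp obq.
wlog ab0 : a b disj ab oap oaq obp obq / 0 < [[a, b]].
  move=> H; case: (ltrgt0P [[a, b]]) (ab) => // ab' _; first exact: H.
  apply: oppr_inj; rewrite -arc_cross_revl oppr0.
  have ba : 0 < [[b, a]] by rewrite br_anti oppr_gt0.
  by apply: H => //; [apply: cones_revl | rewrite gt_eqF].
wlog pq0 : p q disj pq oap oaq obp obq / 0 < [[p, q]].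
  move=> H; case: (ltrgt0P [[p, q]]) (pq) => // pq' _; first exact: H.
  apply: oppr_inj; rewrite -arc_cross_revr oppr0.
  have qp : 0 < [[q, p]] by rewrite br_anti oppr_gt0.
  by apply: H => //; [apply: cones_revr | rewrite gt_eqF].
exact: arc_cross_pos.
Qed.

End Arcs.
End SphericalArcs.

(** * Arcs with a common end, and the choice of a pole *)

Section Forks.
Local Open Scope ring_scope.
Variable R : realType.
Implicit Types (a b p q x y w z : 'rV[R]_3).

Section Pole.
Variable z : 'rV[R]_3.
Local Notation "[[ a , b ]]" := (det3 z a b).
Local Notation arc_over := (arc_over z).
Local Notation arc_cross := (arc_cross z).

(* The contribution of two arcs that start at the same point w. *)
Definition fork w x y : R := arc_over w x y - arc_over w y x.

Lemma br_self w : [[w, w]] = 0.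
Proof. by rewrite !det3E; ring. Qed.

Lemma arc_over_start w x : arc_over w x w = 0.
Proof. by rewrite /arc_over /covers br_self ltxx. Qed.

Lemma arc_over_end w x : arc_over x w w = 0.
Proof. by rewrite arc_over_rev arc_over_start oppr0. Qed.

Lemma arc_cross_start w x y : arc_cross w x w y = fork w x y.
Proof. by rewrite /arc_cross !arc_over_start subr0 addr0. Qed.

Lemma arc_cross_end w x y : arc_cross x w y w = fork w x y.
Proof.
rewrite /arc_cross !arc_over_end subr0 sub0r /fork.
by rewrite (arc_over_rev z w x) (arc_over_rev z w y) opprK.
Qed.

Lemma mulr_gt0E (r s : R) : (0 < r * s) = (0 < r) && (0 < s) || (r < 0) && (s < 0).
Proof.
case: (ltrgt0P r) => [r0|r0|->] /=; last by rewrite mul0r ltxx.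
  by rewrite pmulr_rgt0 // orbF.
by rewrite nmulr_rgt0.
Qed.

(** If both arcs leave [w] towards the same side in longitude, the shorter one ends above or below
    the longer one, and the contribution is the same whichever is shorter. Towards opposite sides,
    neither covers the end of the other. *)
Lemma forkE w x y : (0 < [[w, x]] * [[w, y]] -> det3 w x y != 0 -> [[x, y]] != 0) ->
  fork w x y = if 0 < [[w, x]] * [[w, y]] then - Num.sg (det3 w x y) else 0.
Proof.
have d : det3 w y x = - det3 w x y by rewrite !det3E; ring.
have [d0 _|d0 /(_ _ isT)] := eqVneq (det3 w x y) 0.
  by rewrite /fork /arc_over d d0 oppr0 sgr0 oppr0 !if_same subrr.
rewrite /fork /arc_over d sgrN (br_anti z x y) /covers !oppr_gt0 !oppr_lt0 mulr_gt0E.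
case: (ltrgt0P [[x, y]]) => txy H; last first.
  by rewrite !andbF /= subrr; case: ifP => // /H.
all: by case: (ltrgt0P [[w, x]]) => hx; case: (ltrgt0P [[w, y]]) => hy /=;
  rewrite ?subr0 ?sub0r ?opprK ?subrr.
Qed.

(** In the application [r1] is the bracket of [w] with [x1], [s12] is the determinant of [w], [x1],
    [x2], and the linear relation is Pluecker's. With all r positive the three s cannot share a
    sign, so the sum of signs is 1 or -1. *)
Lemma sgr_sum_same (r1 r2 r3 s12 s23 s31 : R) :
  0 < r1 -> 0 < r2 -> 0 < r3 -> s12 != 0 -> s23 != 0 -> s31 != 0 ->
  r1 * s23 + r2 * s31 + r3 * s12 = 0 ->
  Num.sg (Num.sg s12 + Num.sg s23 + Num.sg s31)
    = Num.sg s12 + Num.sg s23 + Num.sg s31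
  /\ Num.sg s12 + Num.sg s23 + Num.sg s31 != 0.
Proof.
move=> r1p r2p r3p n12 n23 n31.
case: (ltrgt0P s12) n12 => // h12 _; case: (ltrgt0P s23) n23 => // h23 _;
  case: (ltrgt0P s31) n31 => // h31 _ E;
  rewrite ?(gtr0_sg h12) ?(gtr0_sg h23) ?(gtr0_sg h31)
          ?(ltr0_sg h12) ?(ltr0_sg h23) ?(ltr0_sg h31).
all: try by exfalso; nra.
all: split; [by first [rewrite gtr0_sg; lra | rewrite ltr0_sg; lra] | by apply/eqP; lra].
Qed.

Lemma sgr_sum_opp (r1 r2 r3 s12 s23 s31 : R) :
  0 < r1 -> 0 < r2 -> r3 < 0 -> s12 != 0 -> r1 * s23 + r2 * s31 + r3 * s12 = 0 ->
  Num.sg (Num.sg s12 + Num.sg s23 + Num.sg s31) = Num.sg s12.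
Proof.
move=> r1p r2p r3p n12.
case: (ltrgt0P s12) n12 => // h12 _; case: (ltrgt0P s23) => h23;
  case: (ltrgt0P s31) => h31 E; rewrite ?h23 ?h31 ?sgr0;
  rewrite ?(gtr0_sg h12) ?(gtr0_sg h23) ?(gtr0_sg h31)
          ?(ltr0_sg h12) ?(ltr0_sg h23) ?(ltr0_sg h31).
all: try by exfalso; nra.
all: by first [rewrite gtr0_sg; lra | rewrite ltr0_sg; lra].
Qed.

(** Either all three arcs leave on one side of the meridian of [w], or one of them is alone on its
    side; up to relabelling and a common sign of the r these are [sgr_sum_same] and
    [sgr_sum_opp]. *)
Lemma sgr_sum_sides (r1 r2 r3 s12 s23 s31 : R) :
  r1 != 0 -> r2 != 0 -> r3 != 0 ->
  (s12 = 0 -> r1 * r2 < 0) -> (s23 = 0 -> r2 * r3 < 0) -> (s31 = 0 -> r3 * r1 < 0) ->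
  r1 * s23 + r2 * s31 + r3 * s12 = 0 ->
  (if 0 < r1 * r2 then - Num.sg s12 else 0) + (if 0 < r2 * r3 then - Num.sg s23 else 0)
    + (if 0 < r3 * r1 then - Num.sg s31 else 0)
  = - Num.sg (Num.sg s12 + Num.sg s23 + Num.sg s31)
  /\ Num.sg s12 + Num.sg s23 + Num.sg s31 != 0.
Proof.
wlog r10 : r1 r2 r3 / 0 < r1.
  move=> H n1 n2 n3 z12 z23 z31 E; case: (ltrgt0P r1) (n1) => // h1 _; first exact: H.
  have := H (- r1) (- r2) (- r3); rewrite !mulrNN oppr_gt0 !oppr_eq0 !mulNr -!opprD E.
  by rewrite oppr0; apply.
move=> _ n2 n3 z12 z23 z31 E; rewrite !mulr_gt0E r10 (lt_gtF r10) /= ?orbF ?andbF ?andbT.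
have nz s (P : R) : (s = 0 -> P < 0) -> 0 < P -> s != 0.
  by move=> h P0; apply/eqP => /h; rewrite ltNge ltW.
have sg_neq0 (t u : R) : Num.sg t = Num.sg u -> u != 0 -> t != 0.
  by move=> tu; rewrite -sgr_eq0 -tu sgr_eq0.
case: (ltrgt0P r2) n2 => // r20 _; case: (ltrgt0P r3) n3 => // r30 _ /=;
  rewrite ?addr0 ?add0r ?orbF.
- have [||| //|S S0] := sgr_sum_same (s12 := s12) (s23 := s23) (s31 := s31) r10 r20 r30.
  + by apply: nz z12 _; rewrite mulr_gt0.
  + by apply: nz z23 _; rewrite mulr_gt0.
  + by apply: nz z31 _; rewrite mulr_gt0.
  by rewrite S !opprD.
- have n12 : s12 != 0 by apply: nz z12 _; rewrite mulr_gt0.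
  have S := sgr_sum_opp r10 r20 r30 n12 E.
  by rewrite S; split=> //; apply: sg_neq0 S n12.
- rewrite (_ : Num.sg s12 + _ + _ = Num.sg s31 + Num.sg s12 + Num.sg s23); last by ring.
  have n31 : s31 != 0 by apply: nz z31 _; rewrite mulr_gt0.
  have S : Num.sg (Num.sg s31 + Num.sg s12 + Num.sg s23) = Num.sg s31.
    by apply: (sgr_sum_opp (r1 := r3) (r2 := r1) (r3 := r2)) => //; rewrite -E; ring.
  by rewrite S; split=> //; apply: sg_neq0 S n31.
- rewrite (_ : Num.sg s12 + _ + _ = Num.sg s23 + Num.sg s31 + Num.sg s12); last by ring.
  have n23 : s23 != 0 by apply: nz z23 _; rewrite nmulr_rgt0.
  have S : Num.sg (Num.sg s23 + Num.sg s31 + Num.sg s12) = Num.sg s23.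
    apply: (sgr_sum_opp (r1 := - r2) (r2 := - r3) (r3 := - r1)); rewrite ?oppr_gt0 ?oppr_lt0 //.
    by rewrite -[RHS]oppr0 -E; ring.
  by rewrite S; split=> //; apply: sg_neq0 S n23.
Qed.

(** Single forks depend on the pole, but their cyclic sum is minus the sign of the cyclic order of
    the three arcs around [w], which does not. *)
Lemma fork_sum w x1 x2 x3 :
  [[w, x1]] != 0 -> [[w, x2]] != 0 -> [[w, x3]] != 0 ->
  opposite_if_aligned z x1 x2 -> opposite_if_aligned z x2 x3 ->
  opposite_if_aligned z x3 x1 ->
  (det3 w x1 x2 = 0 -> [[w, x1]] * [[w, x2]] < 0) ->
  (det3 w x2 x3 = 0 -> [[w, x2]] * [[w, x3]] < 0) ->
  (det3 w x3 x1 = 0 -> [[w, x3]] * [[w, x1]] < 0) ->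
  fork w x1 x2 + fork w x2 x3 + fork w x3 x1
  = - Num.sg (Num.sg (det3 w x1 x2) + Num.sg (det3 w x2 x3) + Num.sg (det3 w x3 x1))
  /\ Num.sg (det3 w x1 x2) + Num.sg (det3 w x2 x3) + Num.sg (det3 w x3 x1) != 0.
Proof.
move=> n1 n2 n3 o12 o23 o31 z12 z23 z31.
have al x y : opposite_if_aligned z x y ->
    0 < [[w, x]] * [[w, y]] -> det3 w x y != 0 -> [[x, y]] != 0.
  move=> o xy _; apply/eqP => /o[s s0 E]; move: xy.
  have -> : [[w, x]] = - s * [[w, y]] by rewrite E !det3E !mxE; ring.
  by rewrite -mulrA mulNr oppr_gt0 pmulr_rlt0 // ltNge -expr2 sqr_ge0.
rewrite !forkE; try exact: al.
by apply: sgr_sum_sides => //; rewrite !det3E; ring.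
Qed.

Section Telescope.
Variables (V : finType) (r : V -> 'rV[R]_3).
Implicit Type X Y : {set V * V}.

(* X is the set of arcs of a path from w to w', possibly with closed paths. *)
Definition path_arcs X (w w' : V) := forall h : V -> R,
  \sum_(e in X) (h e.2 - h e.1) = h w' - h w.

Definition path_over X (w w' : V) : R :=
  \sum_(e in X) (arc_over (r e.1) (r e.2) (r w') - arc_over (r e.1) (r e.2) (r w)).

(** The sum of [arc_cross] over all pairs of arcs, evaluated twice: disjoint pairs vanish, which
    leaves the forks at the two common ends, and by telescoping it is a difference of terms that
    depend on one path each. *)
Lemma cross_total X Y (w w' x y x' y' : V) :
  path_arcs X w w' -> path_arcs Y w w' ->
  (w, x) \in X -> (w, y) \in Y -> (x', w') \in X -> (y', w') \in Y ->
  ((w, x), (w, y)) != ((x', w'), (y', w')) ->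
  (forall e f, e \in X -> f \in Y -> (e, f) != ((w, x), (w, y)) ->
     (e, f) != ((x', w'), (y', w')) ->
     arc_cross (r e.1) (r e.2) (r f.1) (r f.2) = 0) ->
  fork (r w) (r x) (r y) + fork (r w') (r x') (r y')
  = path_over X w w' - path_over Y w w'.
Proof.
move=> Xt Yt wx wy x'w y'w neq zero.
pose T := \sum_(e in X) \sum_(f in Y) arc_cross (r e.1) (r e.2) (r f.1) (r f.2).
transitivity T.
  rewrite /T pair_big /= (bigD1 ((w, x), (w, y))) /=; last by rewrite wx wy.
  rewrite (bigD1 ((x', w'), (y', w'))) /=; last by rewrite x'w y'w eq_sym neq.
  rewrite big1 ?addr0 => [|[e f] /andP[/andP[/andP[eX fY] n1] n2] ]; last exact: zero.
  by rewrite arc_cross_start arc_cross_end.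
pose h1 e v := arc_over (r e.1) (r e.2) (r v).
have -> : T = \sum_(e in X) \sum_(f in Y) (h1 e f.2 - h1 e f.1)
            - \sum_(f in Y) \sum_(e in X) (h1 f e.2 - h1 f e.1).
  rewrite [X in _ - X]exchange_big /= -sumrB /T; apply: eq_bigr => e _.
  rewrite -sumrB; apply: eq_bigr => f _; rewrite /arc_cross /h1; ring.
rewrite /path_over; congr (_ - _); apply: eq_bigr => e _.
  by rewrite (Yt (h1 e)).
by rewrite (Xt (h1 e)).
Qed.

End Telescope.

End Pole.
(** On the moment curve (1, t, t^2) the bracket of a fixed pair is a polynomial in t, which is zero
    only if the cross product of the pair is. Some t is not a root of the product of the nonzero
    ones. *)
Lemma generic_pole (s : seq ('rV[R]_3 * 'rV[R]_3)) :
  exists z, forall x y, (x, y) \in s -> det3 z x y = 0 -> forall z', det3 z' x y = 0.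
Proof.
pose v3 (t : R) : 'rV[R]_3 := \row_m nth 0 [:: 1; t; t ^+ 2] m.
pose m x y : 'rV[R]_3 := \row_l nth 0
  [:: x 0 1 * y 0 2 - x 0 2 * y 0 1; x 0 2 * y 0 0 - x 0 0 * y 0 2;
      x 0 0 * y 0 1 - x 0 1 * y 0 0] l.
have detm z x y : det3 z x y = z 0 0 * m x y 0 0 + z 0 1 * m x y 0 1 + z 0 2 * m x y 0 2.
  by rewrite det3E !mxE /=; ring.
pose P x y : {poly R} := \poly_(l < 3) nth 0 [:: m x y 0 0; m x y 0 1; m x y 0 2] l.
have PE t x y : (P x y).[t] = det3 (v3 t) x y.
  rewrite horner_poly !big_ord_recl big_ord0 /= detm [v3 t 0 0]mxE [v3 t 0 1]mxE.
  by rewrite [v3 t 0 2]mxE /= /bump /= expr0; ring.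
pose Q := \prod_(xy <- s | P xy.1 xy.2 != 0) P xy.1 xy.2.
have Q0 : Q != 0 by rewrite /Q prodf_seq_neq0; apply/allP => xy _; apply/implyP.
have [t Qt] : exists t, Q.[t] != 0.
  pose ts := [seq (l%:R : R) | l <- iota 0 (size Q)].
  have ts_uniq : uniq ts.
    by rewrite map_inj_uniq ?iota_uniq // => a b /eqP; rewrite eqr_nat => /eqP.
  have [/allP ts_roots|/allPn[t _ Qt]] := boolP (all (root Q) ts); last by exists t.
  have := max_poly_roots Q0 (introT allP ts_roots) ts_uniq.
  by rewrite size_map size_iota ltnn.
exists (v3 t) => x y xy; rewrite -PE => Pt z'.
have [P0|P0] := eqVneq (P x y) 0.
  have mP (l : nat) : (P x y)`_l = 0 by rewrite P0 coef0.
  have := mP 0%N; have := mP 1%N; have := mP 2%N; rewrite !coef_poly /= => m2 m1 m0.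
  by rewrite detm m0 m1 m2 !mulr0 !addr0.
case/negP: Qt; rewrite /Q horner_prod prodf_seq_eq0; apply/hasP; exists (x, y) => //.
by rewrite P0 Pt eqxx.
Qed.

Lemma dependent_vectors x y : (forall z', det3 z' x y = 0) -> y != 0 ->
  exists s, x = s *: y.
Proof.
move=> D y0; pose e (l : nat) : 'rV[R]_3 := \row_m (m == l :> nat)%:R.
have := D (e 0%N); have := D (e 1%N); have := D (e 2%N).
rewrite !det3E ![e _ _ _]mxE /= => D2 D1 D0.
have [y00|n0] := eqVneq (y 0 0) 0; last first.
  exists (x 0 0 / y 0 0); apply: row3P; rewrite !mxE; apply: (mulIf n0);
    rewrite mulrAC divfK //; lra.
have [y01|n1] := eqVneq (y 0 1) 0; last first.
  exists (x 0 1 / y 0 1); apply: row3P; rewrite !mxE; apply: (mulIf n1);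
    rewrite mulrAC divfK //; lra.
have [y02|n2] := eqVneq (y 0 2) 0; last first.
  exists (x 0 2 / y 0 2); apply: row3P; rewrite !mxE; apply: (mulIf n2);
    rewrite mulrAC divfK //; lra.
by case/eqP: y0; apply: row3P; rewrite !mxE.
Qed.

End Forks.

(** * Links of vertices *)

Section Links.
Local Open Scope ring_scope.
Variables (R : realType) (N : nat) (F : prefoam R) (hF : is_foam F N).
Variable v : vert F.
Implicit Types (x y a b p q : vert F) (t : tri F).

Definition rpos x : 'rV[R]_3 := pos x - pos v.

(** Scaling the coefficients until their sum is at most 1 and giving the remaining weight to [v]
    turns points of a cone into barycentric coordinates, to which [embedded] applies. *)
Lemma cone_inj t t' (f g : vert F -> R) : v \in verts_of t -> v \in verts_of t' ->
  (forall x, 0 <= f x) -> (forall x, 0 <= g x) ->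
  (forall x, f x != 0 -> x \in verts_of t /\ x != v) ->
  (forall x, g x != 0 -> x \in verts_of t' /\ x != v) ->
  \sum_x f x *: rpos x = \sum_x g x *: rpos x -> f =1 g.
Proof.
move=> vt vt' f0 g0 ft gt E.
have sf0 : 0 <= \sum_x f x by apply: sumr_ge0.
have sg0 : 0 <= \sum_x g x by apply: sumr_ge0.
pose e := (1 + \sum_x f x + \sum_x g x)^-1.
have M0 : 0 < 1 + \sum_x f x + \sum_x g x by lra.
have e0 : 0 < e by rewrite invr_gt0.
have eM : e * (1 + \sum_x f x + \sum_x g x) = 1 by rewrite mulVf ?gt_eqF.
pose bar (h : vert F -> R) x := e * h x + (1 - e * \sum_y h y) * (x == v)%:R.
have sum_at (w : vert F) (A : lmodType R) (k : R) (h : vert F -> A) :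
    \sum_x (k * (x == w)%:R) *: h x = k *: h w.
  rewrite (bigD1 w) //= eqxx mulr1 big1 ?addr0 // => x /negbTE->.
  by rewrite mulr0 scale0r.
have barP h s : v \in verts_of s -> (forall x, 0 <= h x) -> e * \sum_y h y <= 1 ->
    (forall x, h x != 0 -> x \in verts_of s /\ x != v) -> barycentric (bar h).
  move=> vs h0 hs1 hs; split=> [x||].
  - by rewrite /bar addr_ge0 ?mulr_ge0 ?ler0n ?subr_ge0 // ltW.
  - rewrite big_split /= -mulr_sumr.
    have -> : \sum_x (1 - e * \sum_y h y) * (x == v)%:R = 1 - e * \sum_y h y.
      rewrite -mulr_sumr -[RHS]mulr1; congr (_ * _).
      rewrite (bigD1 v) //= eqxx big1 ?addr0 // => x /negbTE->.
      by [].
    by rewrite addrC subrK.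
  exists s => x; have [->//|nxv] := eqVneq x v.
  rewrite /bar (negbTE nxv) mulr0 addr0 mulf_eq0 negb_or => /andP[_ hx].
  by case: (hs x hx).
have barE h : \sum_x bar h x *: pos x = e *: (\sum_x h x *: rpos x) + pos v.
  have -> : \sum_x h x *: rpos x = \sum_x h x *: pos x - (\sum_x h x) *: pos v.
    by rewrite scaler_suml -sumrB; apply: eq_bigr => x _; rewrite -scalerBr.
  under eq_bigr do rewrite scalerDl -scalerA.
  rewrite big_split /= sum_at -scaler_sumr scalerBr scalerA scalerBl scale1r.
  by rewrite addrA addrAC.
have fg : bar f =1 bar g.
  apply: (foam_embedded hF); [apply: (barP _ t)|apply: (barP _ t')|] => //.
  - by nra.
  - by nra.
  - by rewrite !barE E.
move=> x; have [->|nxv] := eqVneq x v.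
  have -> : f v = 0 by apply/eqP; apply: contraT => /ft[_]; rewrite eqxx.
  by apply/esym/eqP; apply: contraT => /gt[_]; rewrite eqxx.
have := fg x; rewrite /bar (negbTE nxv) !mulr0 !addr0; apply: mulfI.
by rewrite gt_eqF.
Qed.

Definition link_vertex t x := (v \in verts_of t) && (x \in verts_of t) && (x != v).

Lemma cone2_inj t t' a b p q (s1 s2 s3 s4 : R) :
  link_vertex t a -> link_vertex t b -> link_vertex t' p -> link_vertex t' q ->
  0 <= s1 -> 0 <= s2 -> 0 <= s3 -> 0 <= s4 ->
  s1 *: rpos a + s2 *: rpos b = s3 *: rpos p + s4 *: rpos q ->
  forall x, s1 * (x == a)%:R + s2 * (x == b)%:R = s3 * (x == p)%:R + s4 * (x == q)%:R.
Proof.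
move=> /andP[/andP[vt ta] av] /andP[/andP[_ tb] bv] /andP[/andP[vt' tp] pv]
  /andP[/andP[_ tq] qv] h1 h2 h3 h4 E.
have sum2 a' b' (k l : R) : \sum_x (k * (x == a')%:R + l * (x == b')%:R) *: rpos x
    = k *: rpos a' + l *: rpos b'.
  under eq_bigr do rewrite scalerDl; rewrite big_split /=; congr (_ + _).
    rewrite (bigD1 a') //= eqxx mulr1 big1 ?addr0 // => x /negbTE->.
    by rewrite mulr0 scale0r.
  rewrite (bigD1 b') //= eqxx mulr1 big1 ?addr0 // => x /negbTE->.
  by rewrite mulr0 scale0r.
apply: (@cone_inj t t') => //; rewrite ?sum2 //.
- by move=> x; rewrite addr_ge0 ?mulr_ge0.
- by move=> x; rewrite addr_ge0 ?mulr_ge0.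
- move=> x; have [->//|_] := eqVneq x a; have [->//|_] := eqVneq x b.
  by rewrite !mulr0 addr0 eqxx.
- move=> x; have [->//|_] := eqVneq x p; have [->//|_] := eqVneq x q.
  by rewrite !mulr0 addr0 eqxx.
Qed.

Lemma link_cones t t' a b p q :
  link_vertex t a -> link_vertex t b -> link_vertex t' p -> link_vertex t' q ->
  a != b -> p != q -> a != p -> a != q -> b != p -> b != q ->
  cones_meet_at_0 (rpos a) (rpos b) (rpos p) (rpos q).
Proof.
move=> ta tb tp tq ab pq ap aq bp bq s1 s2 s3 s4 h1 h2 h3 h4 E.
have H := cone2_inj ta tb tp tq h1 h2 h3 h4 E.
have := H a; have := H b; have := H p; have := H q.
rewrite !eqxx (eq_sym b a) (eq_sym q a) (eq_sym q b) (eq_sym q p) (eq_sym p a) (eq_sym p b).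
rewrite (negbTE ab) (negbTE pq) (negbTE ap) (negbTE aq) (negbTE bp) (negbTE bq) /=.
by rewrite !mulr0 !mulr1 !addr0 !add0r => <- <- <- <-.
Qed.

Lemma rpos_neq0 t x : link_vertex t x -> rpos x != 0.
Proof.
move=> tx; apply/eqP => E.
have := @cone2_inj t t x x x x 1 0 0 0 tx tx tx tx ler01 (lexx 0) (lexx 0) (lexx 0).
rewrite E !scaler0 => /(_ erefl x); rewrite eqxx !mul0r !addr0 mulr1.
by move/eqP; rewrite oner_eq0.
Qed.

Definition good_pole z := forall x y,
  det3 z (rpos x) (rpos y) = 0 -> forall z', det3 z' (rpos x) (rpos y) = 0.

Lemma good_pole_exists : exists z, good_pole z.
Proof.
have [z zP] := generic_pole [seq (rpos e.1, rpos e.2) | e : vert F * vert F].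
exists z => x y; apply: zP; apply/mapP; exists (x, y) => //.
by rewrite mem_enum.
Qed.

Section Pole.
Variables (z : 'rV[R]_3) (zP : good_pole z).

(** Dependence with a nonnegative factor would put two distinct vertices on one ray, against
    [cone2_inj]. *)
Lemma link_opposite t t' x y : link_vertex t x -> link_vertex t' y -> x != y ->
  opposite_if_aligned z (rpos x) (rpos y).
Proof.
move=> tx ty xy /zP D; have [s E] := dependent_vectors D (rpos_neq0 ty).
have [s0|s0] := ltP s 0; first by exists (- s); rewrite ?oppr_gt0 ?opprK.
have := @cone2_inj t t' x x y y 1 0 s 0 tx tx ty ty ler01 (lexx 0) s0 (lexx 0).
rewrite scale1r E !scale0r => /(_ erefl x); rewrite eqxx (negbTE xy) !mulr0 !mul0r !addr0 mulr1.
by move/eqP; rewrite oner_eq0.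
Qed.

Lemma link_det_neq0 t a b : link_vertex t a -> link_vertex t b -> a != b ->
  det3 z (rpos a) (rpos b) != 0.
Proof.
move=> ta tb ab; apply/eqP => /(link_opposite ta tb ab)[s s0 E].
have := @cone2_inj t t a b a a 1 s 0 0 ta tb ta ta ler01 (ltW s0) (lexx 0) (lexx 0).
rewrite scale1r E scaleNr addNr !scale0r addr0 => /(_ erefl a).
rewrite eqxx (negbTE ab) !mulr0 !mul0r !addr0 mulr1.
by move/eqP; rewrite oner_eq0.
Qed.

(** If coplanar arcs left [w] towards the same side, [y] would lie in the cone of [w] and [x], or
    [x] in that of [w] and [y]. *)
Lemma link_half_plane t t' w x y : link_vertex t w -> link_vertex t x ->
  link_vertex t' w -> link_vertex t' y -> w != x -> w != y -> x != y ->
  det3 (rpos w) (rpos x) (rpos y) = 0 ->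
  det3 z (rpos w) (rpos x) * det3 z (rpos w) (rpos y) < 0.
Proof.
move=> tw tx tw' ty wx wy xy D.
have nx := link_det_neq0 tw tx wx; have ny := link_det_neq0 tw' ty wy.
have V := four_vectors z (rpos w) (rpos x) (rpos y); rewrite D scale0r addr0 in V.
rewrite (br_anti z (rpos x) (rpos y)) in V.
set A := det3 z (rpos w) (rpos x) in nx V *.
set B := det3 z (rpos w) (rpos y) in ny V *.
set C := det3 z (rpos x) (rpos y) in V.
rewrite ltNge; apply/negP => AB.
have key (e : R) : 0 < e * A -> 0 <= e * B -> False.
  move=> eA eB.
  have V' : (e * A) *: rpos y = (e * - C) *: rpos w + (e * B) *: rpos x.
    by rewrite -!scalerA V scalerDr.
  have [C0|C0] := leP 0 (e * - C).
    have := cone2_inj ty ty tw tx (ltW eA) (lexx 0) C0 eB.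
    rewrite scale0r addr0 => /(_ V' y).
    rewrite eqxx [y == w]eq_sym [y == x]eq_sym (negbTE wy) (negbTE xy) !mulr0 ?mul0r !addr0 mulr1.
    by move=> E; rewrite E ltxx in eA.
  have C0' : 0 <= - (e * - C) by rewrite oppr_ge0 ltW.
  have := cone2_inj ty tw' tx tx (ltW eA) C0' eB (lexx 0).
  rewrite V' scale0r addr0 scaleNr addrAC subrr add0r => /(_ erefl y).
  rewrite eqxx [y == w]eq_sym [y == x]eq_sym (negbTE wy) (negbTE xy) !mulr0 ?mul0r !addr0 mulr1.
  by move=> E; rewrite E ltxx in eA.
case: (ltrgt0P A) nx => // hA _.
  by apply: (key 1); rewrite mul1r //; rewrite pmulr_rge0 in AB.
by apply: (key (-1)); rewrite mulN1r ?oppr_gt0 // oppr_ge0; rewrite nmulr_rge0 in AB.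
Qed.

End Pole.
End Links.

(** * Cyclic orders at the two ends of a theta graph *)

Section ThetaGraph.
Local Open Scope ring_scope.
Variables (R : realType) (N : nat) (F : prefoam R) (hF : is_foam F N).
Implicit Types (u v w x y a b p q : vert F) (t : tri F) (Y K : {set tri F}).

Section AtVertex.
Variable v : vert F.
Local Notation r := (rpos v).
Implicit Type X : {set vert F * vert F}.

Definition arcs Y : {set vert F * vert F} :=
  [set (nxt t v, nxt t (nxt t v)) | t in [set t in Y | v \in verts_of t]].

Lemma arcsP Y a b : reflect (exists2 t, t \in Y & [/\ dart t v a, dart t a b & dart t b v])
  ((a, b) \in arcs Y).
Proof.
apply: (iffP imsetP) => [[t]|[t tY [va ab bv]]].
  rewrite inE => /andP[tY /mem_verts_of[x [y [vx xy yv]]]] [-> ->].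
  by exists t; rewrite // (nxtE hF vx) (nxtE hF xy).
exists t; last by rewrite (nxtE hF va) (nxtE hF ab).
by rewrite inE tY; case: (dart_verts va).
Qed.

(** Arcs begin where a dart leaves [v] and end where one enters; edges used in both directions
    cancel, and the boundary remains. *)
Lemma arcs_telescope Y (h : vert F -> R) : dart_uniq Y ->
  \sum_(e in arcs Y) (h e.2 - h e.1) =
  \sum_(w | (w, v) \in boundary Y) h w - \sum_(w | (v, w) \in boundary Y) h w.
Proof.
move=> Yu; rewrite sumrB.
have out_sum : \sum_(e in arcs Y) h e.1 = \sum_(w | (v, w) \in darts Y) h w.
  rewrite (eq_bigl (fun w => w \in fst @: arcs Y)); last first.
    move=> w; apply/dartsP/imsetP => [[t tY vw]|[[a b] /arcsP[t tY [va _ _]] ->]].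
      have [x [wx xv _]] := dart_next vw.
      by exists (w, x) => //; apply/arcsP; exists t.
    by exists t.
  rewrite [RHS]big_imset //= => -[a b] [a' b'] /arcsP[t tY [va ab bv]].
  move=> /arcsP[t' t'Y [va' ab' bv']] /= E; rewrite -E in va' ab' *.
  by have Et := Yu _ _ _ _ tY t'Y va va'; rewrite -Et in ab'; rewrite (dart_inj_r hF ab ab').
have in_sum : \sum_(e in arcs Y) h e.2 = \sum_(w | (w, v) \in darts Y) h w.
  rewrite (eq_bigl (fun w => w \in snd @: arcs Y)); last first.
    move=> w; apply/dartsP/imsetP => [[t tY wv]|[[a b] /arcsP[t tY [_ _ bv]] ->]].
      have [x [vx xw _]] := dart_next wv.
      by exists (x, w) => //; apply/arcsP; exists t.
    by exists t.
  rewrite [RHS]big_imset //= => -[a b] [a' b'] /arcsP[t tY [va ab bv]].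
  move=> /arcsP[t' t'Y [va' ab' bv']] /= E; rewrite -E in bv' ab' *.
  by have Et := Yu _ _ _ _ tY t'Y bv bv'; rewrite -Et in ab'; rewrite (dart_inj_l hF ab ab').
rewrite in_sum out_sum.
rewrite (bigID (fun w => (v, w) \in darts Y)) /=.
rewrite [X in _ - X](bigID (fun w => (w, v) \in darts Y)) /=.
rewrite opprD addrACA [X in X + _](_ : _ = 0) ?add0r; last first.
  by apply/eqP; rewrite subr_eq0; apply/eqP; apply: eq_bigl => w; rewrite andbC.
have bdE a b : ((a, b) \in boundary Y) = ((a, b) \in darts Y) && ((b, a) \notin darts Y).
  by rewrite in_set.
by congr (_ - _); apply: eq_bigl => w; rewrite bdE.
Qed.

(** The link of [v] in a surface, as a path from [w] to [w'] with first arc to [x] and last arc from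
    [y]. Closed loops besides the path are tolerated: what is recorded is that sums telescope and
    that only these two arcs touch the ends. *)
Definition arc_family K X w w' x y : Prop :=
  [/\ path_arcs R X w w', (w, x) \in X /\ (y, w') \in X,
      forall e, e \in X -> exists2 t, t \in K &
        [/\ link_vertex v t e.1, link_vertex v t e.2 & e.1 != e.2],
      forall e, e \in X -> w = e.1 \/ w = e.2 -> e = (w, x)
    & forall e, e \in X -> w' = e.1 \/ w' = e.2 -> e = (y, w')].

Lemma arc_family_boundary Y w w' t s : dart_uniq Y ->
  (forall x, (v, x) \in boundary Y -> x = w) ->
  (forall x, (x, v) \in boundary Y -> x = w') ->
  (v, w) \in boundary Y -> (w', v) \in boundary Y ->
  t \in Y -> dart t v w -> s \in Y -> dart s w' v ->
  arc_family Y (arcs Y) w w' (nxt t w) (nxt s v).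
Proof.
move=> Yu out1 in1 vw w'v tY dt sY ds.
have bdE a b : (a, b) \in boundary Y -> (b, a) \notin darts Y by rewrite in_set => /andP[].
have [x [wx xv _]] := dart_next dt; have [y [vy yw' _]] := dart_next ds.
rewrite (nxtE hF wx) (nxtE hF vy); split.
- move=> h; rewrite arcs_telescope //; congr (_ - _).
    by rewrite (big_pred1 w') // => u; apply/idP/eqP => [/in1//|->].
  by rewrite (big_pred1 w) // => u; apply/idP/eqP => [/out1//|->].
- by split; apply/arcsP; [exists t|exists s].
- move=> [a b] /arcsP[t' t'Y [va ab bv]]; exists t' => //=.
  have [? ?] := dart_verts va; have [_ ?] := dart_verts ab.
  split; rewrite /link_vertex; [| |exact: (dart_neq hF ab)].
    by apply/andP; split; [apply/andP | rewrite eq_sym (dart_neq hF va)].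
  by apply/andP; split; [apply/andP | rewrite (dart_neq hF bv)].
- move=> [a b] /arcsP[t' t'Y [va ab bv]] /= [wa|wb].
    rewrite -wa in va ab *; have E := Yu _ _ _ _ t'Y tY va dt.
    by rewrite E in ab; rewrite (dart_inj_r hF ab wx).
  by case/negP: (bdE _ _ vw); apply/dartsP; exists t'; rewrite // wb.
- move=> [a b] /arcsP[t' t'Y [va ab bv]] /= [wa|wb].
    by case/negP: (bdE _ _ w'v); apply/dartsP; exists t'; rewrite // wa.
  rewrite -wb in bv ab *; have E := Yu _ _ _ _ t'Y sY bv ds.
  by rewrite E in ab; rewrite (dart_inj_l hF ab yw').
Qed.

Lemma arc_family_rev K X w w' x y : arc_family K X w w' x y ->
  arc_family K [set (e.2, e.1) | e in X] w' w y x.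
Proof.
case=> tele [wx yw'] tri1 uw uw'; split.
- move=> h; rewrite big_imset /= => [|[a b] [a' b'] _ _ [-> ->] //].
  under eq_bigr do rewrite -opprB.
  by rewrite sumrN tele opprB.
- by split; apply/imsetP; [exists (y, w')|exists (w, x)].
- move=> _ /imsetP[e /tri1[t tK [l1 l2 n]] ->]; exists t => //=.
  by rewrite eq_sym.
- move=> _ /imsetP[e eX ->] /= /or_comm/(uw' e eX) -> //.
- move=> _ /imsetP[e eX ->] /= /or_comm/(uw e eX) -> //.
Qed.

Lemma link_vertex_edge t x : link_vertex v t x -> has_edge t v x.
Proof.
by case/andP=> /andP[vt xt] xv; apply: verts_of_has_edge; rewrite // eq_sym.
Qed.

Lemma link_vertices_inj t t' a b : link_vertex v t a -> link_vertex v t b -> a != b ->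
  link_vertex v t' a -> link_vertex v t' b -> t = t'.
Proof.
move=> /andP[/andP[vt ta] av] /andP[/andP[_ tb] bv] ab
  /andP[/andP[vt' ta'] _] /andP[/andP[_ tb'] _].
have full s : v \in verts_of s -> a \in verts_of s -> b \in verts_of s ->
    verts_of s = v |: [set a; b].
  move=> vs sa sb; apply/esym/eqP; rewrite eqEcard (card_verts_of hF); apply/andP; split.
    by apply/subsetP => x; rewrite !inE => /or3P[]/eqP->.
  by rewrite cardsU1 cards2 ab !inE negb_or [v == a]eq_sym [v == b]eq_sym av bv.
by apply: (foam_verts_inj hF); rewrite (full t) // (full t').
Qed.

Lemma fork_pair z K K' X X' w w' x x' y y' : good_pole v z ->
  arc_family K X w w' x y -> arc_family K' X' w w' x' y' -> [disjoint K & K'] ->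
  (forall t t' p, t \in K -> t' \in K' -> has_edge t v p -> has_edge t' v p ->
     p = w \/ p = w') ->
  [/\ fork z (r w) (r x) (r x') + fork z (r w') (r y) (r y')
      = path_over z r X w w' - path_over z r X' w w',
      x != x' & y != y'].
Proof.
move=> zP [tele [wx yw'] tri1 uw uw'] [tele' [wx' yw''] tri1' vw vw'] dis share.
have nK a b : (a, b) \in X -> (a, b) \in X' -> False.
  move=> /tri1[t tK [l1 l2 n]] /tri1'[t' tK' [l1' l2' _]].
  have E := link_vertices_inj l1 l2 n l1' l2'.
  by have /pred0P/(_ t) := dis; rewrite /= tK E tK'.
split; first apply: cross_total => //.
- by apply/eqP => -[E1 E2 E3 E4]; apply: (nK w x); rewrite // E2 -E4.
- move=> e f eX fX n1 n2; have [t tK [l1 l2 n]] := tri1 _ eX.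
  have [t' tK' [l1' l2' n']] := tri1' _ fX.
  have sh p : p = e.1 \/ p = e.2 -> p = f.1 \/ p = f.2 -> False.
    move=> pe pf; have [pw|pw'] : p = w \/ p = w'.
      apply: (share t t') => //; apply: link_vertex_edge.
        by case: pe => ->.
      by case: pf => ->.
    - by case/eqP: n1; rewrite (uw e) -?pw // (vw f) -?pw.
    - by case/eqP: n2; rewrite (uw' e) -?pw' // (vw' f) -?pw'.
  have s11 : e.1 != f.1 by apply/eqP => E; apply: (sh e.1); left.
  have s12 : e.1 != f.2 by apply/eqP => E; apply: (sh e.1); [left|right].
  have s21 : e.2 != f.1 by apply/eqP => E; apply: (sh e.2); [right|left].
  have s22 : e.2 != f.2 by apply/eqP => E; apply: (sh e.2); right.
  apply: arc_cross_disjoint.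
  + exact: (link_cones hF l1 l2 l1' l2').
  + exact: (link_det_neq0 hF zP l1 l2).
  + exact: (link_det_neq0 hF zP l1' l2').
  + exact: (link_opposite hF zP l1 l1').
  + exact: (link_opposite hF zP l1 l2').
  + exact: (link_opposite hF zP l2 l1').
  + exact: (link_opposite hF zP l2 l2').
- by apply/eqP => E; apply: (nK w x); rewrite // E.
- by apply/eqP => E; apply: (nK y w'); rewrite // E.
Qed.

(** The sum tested by [left_handed] for the axis from [v] to [w]: negative means left-handed. *)
Definition turn w x1 x2 x3 : R := Num.sg (det3 (r w) (r x1) (r x2))
  + Num.sg (det3 (r w) (r x2) (r x3)) + Num.sg (det3 (r w) (r x3) (r x1)).

Lemma turn_fork z w x1 x2 x3 t1 t2 t3 : good_pole v z ->
  link_vertex v t1 w -> link_vertex v t2 w -> link_vertex v t3 w ->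
  link_vertex v t1 x1 -> link_vertex v t2 x2 -> link_vertex v t3 x3 ->
  w != x1 -> w != x2 -> w != x3 -> x1 != x2 -> x2 != x3 -> x3 != x1 ->
  fork z (r w) (r x1) (r x2) + fork z (r w) (r x2) (r x3) + fork z (r w) (r x3) (r x1)
  = - Num.sg (turn w x1 x2 x3) /\ turn w x1 x2 x3 != 0.
Proof.
move=> zP t1w t2w t3w t1x t2x t3x wx1 wx2 wx3 n12 n23 n31.
apply: fork_sum.
- exact: (link_det_neq0 hF zP t1w t1x).
- exact: (link_det_neq0 hF zP t2w t2x).
- exact: (link_det_neq0 hF zP t3w t3x).
- exact: (link_opposite hF zP t1x t2x).
- exact: (link_opposite hF zP t2x t3x).
- exact: (link_opposite hF zP t3x t1x).
- exact: (link_half_plane hF zP t1w t1x t2w t2x).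
- exact: (link_half_plane hF zP t2w t2x t3w t3x).
- exact: (link_half_plane hF zP t3w t3x t1w t1x).
Qed.

Lemma family_turn z K1 K2 K3 X1 X2 X3 w w' x1 x2 x3 y1 y2 y3 : good_pole v z ->
  arc_family K1 X1 w w' x1 y1 -> arc_family K2 X2 w w' x2 y2 ->
  arc_family K3 X3 w w' x3 y3 ->
  x1 != x2 -> x2 != x3 -> x3 != x1 ->
  fork z (r w) (r x1) (r x2) + fork z (r w) (r x2) (r x3) + fork z (r w) (r x3) (r x1)
  = - Num.sg (turn w x1 x2 x3) /\ turn w x1 x2 x3 != 0.
Proof.
move=> zP [_ [m1 _] h1 _ _] [_ [m2 _] h2 _ _] [_ [m3 _] h3 _ _].
have [t1 _ [/= l1 k1 n1]] := h1 _ m1; have [t2 _ [/= l2 k2 n2]] := h2 _ m2.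
have [t3 _ [/= l3 k3 n3]] := h3 _ m3.
exact: (turn_fork zP l1 l2 l3 k1 k2 k3).
Qed.

(** Adding the three identities of [fork_pair] cyclically cancels all [path_over] terms, so the
    forks at [w] and at [w'] add up to zero. By [fork_sum] they give the cyclic orders at the two
    ends, which are therefore opposite. *)
Lemma theta_turn K1 K2 K3 X1 X2 X3 w w' x1 x2 x3 y1 y2 y3 :
  arc_family K1 X1 w w' x1 y1 -> arc_family K2 X2 w w' x2 y2 ->
  arc_family K3 X3 w w' x3 y3 ->
  [disjoint K1 & K2] -> [disjoint K2 & K3] -> [disjoint K3 & K1] ->
  (forall t t' p, t \in K1 -> t' \in K2 -> has_edge t v p -> has_edge t' v p ->
     p = w \/ p = w') ->
  (forall t t' p, t \in K2 -> t' \in K3 -> has_edge t v p -> has_edge t' v p ->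
     p = w \/ p = w') ->
  (forall t t' p, t \in K3 -> t' \in K1 -> has_edge t v p -> has_edge t' v p ->
     p = w \/ p = w') ->
  (turn w x1 x2 x3 < 0) = (0 < turn w' y1 y2 y3) /\ turn w x1 x2 x3 != 0.
Proof.
move=> F1 F2 F3 d12 d23 d31 s12 s23 s31.
have [z zP] := good_pole_exists v.
have [E12 x12 y12] := fork_pair zP F1 F2 d12 s12.
have [E23 x23 y23] := fork_pair zP F2 F3 d23 s23.
have [E31 x31 y31] := fork_pair zP F3 F1 d31 s31.
have [Ew nw] := family_turn zP F1 F2 F3 x12 x23 x31.
have [Ew' nw'] := family_turn zP (arc_family_rev F1) (arc_family_rev F2)
  (arc_family_rev F3) y12 y23 y31.
split=> //; have : Num.sg (turn w x1 x2 x3) + Num.sg (turn w' y1 y2 y3) = 0.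
  lra.
case: (ltrgt0P (turn w x1 x2 x3)) nw => // h _; case: (ltrgt0P (turn w' y1 y2 y3)) nw' => // h' _.
  by rewrite !gtr0_sg //; lra.
by rewrite !ltr0_sg //; lra.
Qed.

End AtVertex.
End ThetaGraph.

(** * Positivity along a bicolored seam *)

Section Positivity.
Local Open Scope ring_scope.
Variables (R : realType) (N : nat) (F : prefoam R) (hF : is_foam F N).
Variable c : {ffun facet F -> {set 'I_N}}.
Hypothesis hc : is_coloring c.
Variables i j : 'I_N.
Implicit Types (u v w x y : vert F) (t : tri F).

Let A := part c i (mixed_facets c i j).
Let B := part c j (mixed_facets c i j).
Let C := surface1 c i :&: surface1 c j.

Lemma boundary_part_mixed : boundary (part c i (mixed_facets c i j)) = bic c i j.
Proof.
rewrite (boundary_part hF hc (closed_mixed c i j)).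
apply/setP => -[u w]; rewrite in_set andb_idr // => /bic_darts[t1 [_ [d _ /andP[it jt] _]]].
apply/vertsP; exists t1; last by case: (dart_verts d).
by rewrite region_mixed surface2E it (negbTE jt).
Qed.

(** At a bicolored seam the facet with both colors is the thick one, whose boundary direction is
    opposite to the seam; at any other edge a sheet with both colors continues in another one. *)
Lemma boundary_both u w : ((u, w) \in boundary C) = ((w, u) \in bic c i j).
Proof.
have CE t : (t \in C) = (i \in c (facet_of t)) && (j \in c (facet_of t)).
  by rewrite in_setI !surface1E.
rewrite in_set; apply/andP/bicP => [[/dartsP[t tC uw] /= nC]|].
  have nCt s : dart s w u -> s \in C -> False.
    by move=> wu sC; case/negP: nC; apply/dartsP; exists s.
  move: (tC); rewrite CE => /andP[it jt].
  case: (dart_cases hF uw) => [[s [_ E fE _]]|[t2 [t3 s]]|[t1 [t2 s]]].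
  - by case: (nCt s); rewrite ?CE ?fE ?it //; have := set11 s; rewrite -E inE.
  - have [_ E3] := seam_atE s; case: (nCt t3); rewrite ?E3 // CE.
    by rewrite (coloring_seam hc i s).1 (coloring_seam hc j s).1 it jt.
  - have [E12 _] := seam_atE s.
    have [Ei ni] := coloring_seam hc i s; have [Ej nj] := coloring_seam hc j s.
    have n1 : t1 \notin C by apply/negP => /(nCt t1); apply; rewrite E12 eqxx.
    have n2 : t2 \notin C by apply/negP => /(nCt t2); apply; rewrite E12 eqxx orbT.
    rewrite !CE in n1 n2; rewrite it in Ei; rewrite jt in Ej.
    case i1: (i \in c (facet_of t1)) in n1 ni Ei; case j1: (j \in c (facet_of t1)) in n1 nj Ej;
    case i2: (i \in c (facet_of t2)) in n2 ni Ei; case j2: (j \in c (facet_of t2)) in n2 nj Ej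
      => //.
      by exists t1, t2, t; rewrite i1 j1 i2 j2 it jt.
    by exists t2, t1, t; rewrite i1 j1 i2 j2 it jt; split=> //; apply: seam_at_swap.
case=> t1 [t2 [t3 [s /andP[i1 j1] /andP[j2 i2] ij3]]]; have [E12 E3] := seam_atE s.
split; first by apply/dartsP; exists t3; rewrite ?CE // E3.
apply/negP => /dartsP[t]; rewrite CE E12 => /andP[it jt] /= /orP[]/eqP E.
  by rewrite E (negbTE j1) in jt.
by rewrite E (negbTE i2) in it.
Qed.

Lemma set3_inj u w x y : x != u -> x != w -> [set u; w; x] = [set u; w; y] -> x = y.
Proof.
move=> xu xw /setP/(_ x); rewrite !inE eqxx (negbTE xu) (negbTE xw) /=.
by move=> /esym/eqP.
Qed.

Lemma positive_edgeE u w t1 t2 t3 x1 x2 x3 : seam_at u w t1 t2 t3 ->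
  (i \in c (facet_of t1)) && (j \notin c (facet_of t1)) ->
  (j \in c (facet_of t2)) && (i \notin c (facet_of t2)) ->
  verts_of t1 = [set u; w; x1] -> verts_of t2 = [set u; w; x2] ->
  verts_of t3 = [set u; w; x3] ->
  positive_edge c i j (u, w) = left_handed (pos w - pos u) (pos x1 - pos u)
    (pos x2 - pos u) (pos x3 - pos u).
Proof.
move=> s a b V1 V2 V3.
have third t x y : verts_of t = [set u; w; x] -> verts_of t = [set u; w; y] -> x = y.
  move=> Vx Vy; have : #|[set u; w; x]| = 3 by rewrite -Vx (card_verts_of hF).
  have [->|xu] := eqVneq x u; first by rewrite setUC setUA setUid cards2; case: (_ != _).
  have [->|xw] := eqVneq x w; first by rewrite -setUA setUid cards2; case: (_ != _).
  by move=> _; apply: (set3_inj xu xw); rewrite -Vx Vy.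
apply/idP/idP.
  case/existsP=> s1 /existsP[s2 /existsP[s3 /existsP[y1 /existsP[y2 /existsP[y3]]]]].
  case/and5P=> /and4P[/= s' a' b' _] /eqP W1 /eqP W2 /eqP W3.
  have [E3 [[E1 E2]|[E1 E2]]] := seam_at_unique s s'; last first.
    by rewrite E1 in a'; case/andP: a' => it; case/andP: b => _; rewrite it.
  rewrite E1 in W1; rewrite E2 in W2; rewrite E3 in W3.
  by rewrite (third _ _ _ V1 W1) (third _ _ _ V2 W2) (third _ _ _ V3 W3).
move=> l; apply/existsP; exists t1; apply/existsP; exists t2; apply/existsP; exists t3.
apply/existsP; exists x1; apply/existsP; exists x2; apply/existsP; exists x3.
rewrite /= V1 V2 V3 !eqxx l !andbT.
apply/and4P; split=> //; case/andP: a => it _; case/andP: b => jt _.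
by rewrite (coloring_seam hc i s).1 (coloring_seam hc j s).1 it jt orbT.
Qed.

Section Turn.
Variables (v w : vert F) (t1 t2 t3 : tri F).
Hypotheses (s : seam_at v w t1 t2 t3)
  (a : (i \in c (facet_of t1)) && (j \notin c (facet_of t1)))
  (b : (j \in c (facet_of t2)) && (i \notin c (facet_of t2))).

Let d12 := (seam_atE s).1.
Let d3 := (seam_atE s).2.

Lemma positive_out : positive_edge c i j (v, w)
  = (turn v w (nxt t1 w) (nxt t2 w) (nxt t3 v) < 0).
Proof.
have dt1 : dart t1 v w by rewrite d12 eqxx.
have dt2 : dart t2 v w by rewrite d12 eqxx orbT.
have dt3 : dart t3 w v by rewrite d3.
have [x1 [wx1 _ V1]] := dart_next dt1; have [x2 [wx2 _ V2]] := dart_next dt2.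
have [x3 [vx3 _ V3]] := dart_next dt3.
rewrite (nxtE hF wx1) (nxtE hF wx2) (nxtE hF vx3).
have {}V3 : verts_of t3 = [set v; w; x3] by rewrite V3 [[set w; v]]setUC.
by rewrite (positive_edgeE s a b V1 V2 V3).
Qed.

(** Seen from the end [w] the axis is reversed, which negates the three determinants; moving the
    base point along the axis does not change them. *)
Lemma positive_in : positive_edge c i j (v, w)
  = (0 < turn w v (nxt t1 w) (nxt t2 w) (nxt t3 v)).
Proof.
rewrite positive_out /turn.
have D x y : det3 (rpos v w) (rpos v x) (rpos v y) = - det3 (rpos w v) (rpos w x) (rpos w y).
  by rewrite !det3E /rpos !mxE; ring.
by rewrite !D !sgrN -!opprD oppr_lt0.
Qed.

End Turn.

(** The facets with i only, with j only and with both have links at [v] that contain paths between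
    the two seam neighbours, a theta graph; the third path is bounded in the opposite direction and
    is reversed. The seam enters [v] at one end of the graph and leaves at the other, so the
    opposite orders of [theta_turn] mean equal positivity. *)
Lemma positive_vertex v w w' t1 t2 t3 : seam_at v w t1 t2 t3 ->
  (i \in c (facet_of t1)) && (j \notin c (facet_of t1)) ->
  (j \in c (facet_of t2)) && (i \notin c (facet_of t2)) ->
  (w', v) \in bic c i j ->
  positive_edge c i j (w', v) = positive_edge c i j (v, w)
  /\ turn v w (nxt t1 w) (nxt t2 w) (nxt t3 v) != 0.
Proof.
move=> s a b w'v; have [Bf Bg _ _] := bic_circles hF hc i j.
have vw : (v, w) \in bic c i j.
  apply/bicP; exists t1, t2, t3; split=> //; case/andP: a => it _; case/andP: b => jt _.
  by rewrite (coloring_seam hc i s).1 (coloring_seam hc j s).1 it jt orbT.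
have [s1 [s2 [s3 [s' a' b' _]]]] := bicP c i j w' v w'v.
rewrite (positive_out s a b) (positive_in s' a' b').
have [E12 E3] := seam_atE s; have [E12' E3'] := seam_atE s'.
have Mc := closed_mixed c i j; have Mc' := closed_facetsC Mc.
have inA t : (t \in A) = (i \in c (facet_of t)) && (j \notin c (facet_of t)).
  rewrite (partP Mc) regionE inE.
  by case: (i \in c (facet_of t)); case: (j \in c (facet_of t)).
have inB t : (t \in B) = (j \in c (facet_of t)) && (i \notin c (facet_of t)).
  rewrite (partP Mc') regionE inE.
  by case: (i \in c (facet_of t)); case: (j \in c (facet_of t)).
have inC t : (t \in C) = (i \in c (facet_of t)) && (j \in c (facet_of t)).
  by rewrite in_setI !surface1E.
have bdA : boundary A = bic c i j by exact: boundary_part_mixed.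
have bdB : boundary B = bic c i j.
  by rewrite /B (boundary_partC hF hc Mc) boundary_part_mixed.
have Cu : dart_uniq C.
  by apply: (dart_uniq_sub (@dart_uniq_surface1 _ _ _ hF _ hc i)); apply: subsetIl.
have both t u x : seam_at u x t1 t2 t -> t \in C.
  move=> sq; rewrite inC (coloring_seam hc i sq).1 (coloring_seam hc j sq).1.
  by case/andP: a => -> _; case/andP: b => -> _; rewrite orbT.
have t3C : t3 \in C := both _ _ _ s.
have s3C : s3 \in C.
  rewrite inC (coloring_seam hc i s').1 (coloring_seam hc j s').1.
  by case/andP: a' => -> _; case/andP: b' => -> _; rewrite orbT.
have FA : arc_family v A (arcs v A) w w' (nxt t1 w) (nxt s1 v).
  apply: (arc_family_boundary hF); rewrite ?bdA ?inA ?E12 ?E12' ?eqxx //.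
  - exact: (part_uniq hF hc Mc).
  - by move=> x /(Bf _ _ _ vw).
  - by move=> x /(Bg _ _ _ w'v).
have FB : arc_family v B (arcs v B) w w' (nxt t2 w) (nxt s2 v).
  apply: (arc_family_boundary hF); rewrite ?bdB ?inB ?E12 ?E12' ?eqxx ?orbT //.
  - exact: (part_uniq hF hc Mc').
  - by move=> x /(Bf _ _ _ vw).
  - by move=> x /(Bg _ _ _ w'v).
have FC : arc_family v C [set (e.2, e.1) | e in arcs v C] w w' (nxt t3 v) (nxt s3 w').
  apply: arc_family_rev; apply: (arc_family_boundary hF) => //.
  - by move=> x; rewrite boundary_both => /(Bg _ _ _ w'v).
  - by move=> x; rewrite boundary_both => /(Bf _ _ _ vw).
  - by rewrite boundary_both.
  - by rewrite boundary_both.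
  - by rewrite E3'.
  - by rewrite E3.
have atv p : (v, p) \in bic c i j \/ (p, v) \in bic c i j -> p = w \/ p = w'.
  by case=> [/(Bf _ _ _ vw)|/(Bg _ _ _ w'v)] ->; [left|right].
have [||||||] := theta_turn hF FA FB FC.
- by apply/pred0P => t /=; rewrite inA inB; case: (i \in c (facet_of t)); rewrite ?andbF.
- by apply/pred0P => t /=; rewrite inC inB; case: (i \in c (facet_of t)); rewrite ?andbF.
- by apply/pred0P => t /=; rewrite inC inA; case: (j \in c (facet_of t)); rewrite ?andbF.
- move=> t t' p; rewrite inA inB => /andP[it jt] /andP[jt' it'] e e'.
  by apply: atv; apply: (shared_edge_bic hF hc e' e).
- move=> t t' p; rewrite inB inC => /andP[jt it] /andP[it' jt'] e e'.
  by apply: atv; apply: (shared_edge_bic hF hc e e').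
- move=> t t' p; rewrite inC inA => /andP[it jt] /andP[it' jt'] e e'.
  by apply: atv; rewrite bicC; apply: (shared_edge_bic hF hc e' e).
by move=> -> ->.
Qed.

End Positivity.

(** Exchanging i and j negates the sum of signs, which is nonzero by [positive_vertex]. *)
Lemma positive_edgeC (R : realType) (N : nat) (F : prefoam R) (hF : is_foam F N)
    (c : {ffun facet F -> {set 'I_N}}) (hc : is_coloring c) (i j : 'I_N) e :
  e \in bic c i j -> positive_edge c j i e = ~~ positive_edge c i j e.
Proof.
case: e => v w vw; have [t1 [t2 [t3 [s a b _]]]] := bicP c i j v w vw.
have [_ _ _ /(_ _ _ vw)[w' w'v]] := bic_circles hF hc i j.
have [_ n0] := positive_vertex hF hc s a b w'v.
rewrite (positive_out hF hc s a b) (positive_out hF hc (seam_at_swap s) b a).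
have -> : (turn v w (nxt t2 w) (nxt t1 w) (nxt t3 v)
         = - turn v w (nxt t1 w) (nxt t2 w) (nxt t3 v))%R.
  have D x y : (det3 (rpos v w) (rpos v x) (rpos v y)
      = - det3 (rpos v w) (rpos v y) (rpos v x))%R by rewrite !det3E; ring.
  rewrite /turn (D (nxt t2 w) (nxt t1 w)) (D (nxt t1 w) (nxt t3 v)) (D (nxt t3 v) (nxt t2 w)).
  by rewrite !sgrN; ring.
by rewrite oppr_lt0; case: (ltrgt0P (turn _ _ _ _ _)) n0.
Qed.

Lemma positive_edge_next (R : realType) (N : nat) (F : prefoam R) (hF : is_foam F N)
    (c : {ffun facet F -> {set 'I_N}}) (hc : is_coloring c) (i j : 'I_N) u v w :
  (u, v) \in bic c i j -> (v, w) \in bic c i j ->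
  positive_edge c i j (u, v) = positive_edge c i j (v, w).
Proof.
move=> uv vw; have [t1 [t2 [t3 [s a b _]]]] := bicP c i j v w vw.
by have [-> _] := positive_vertex hF hc s a b uv.
Qed.

(** * Positive seams *)

Section Tau.
Variable V : finType.
Implicit Types (Z : {set V * V}) (u v w : V).

Lemma circ_succ_local Z Z' v : (forall w, ((v, w) \in Z) = ((v, w) \in Z')) ->
  circ_succ Z v = circ_succ Z' v.
Proof. by move=> E; rewrite /circ_succ (eq_pick E). Qed.

Lemma tau_disjoint Z1 Z2 : circle_set Z1 -> circle_set Z2 -> circle_set (Z1 :|: Z2) ->
  [disjoint Z1 & Z2] -> tau (Z1 :|: Z2) = tau Z1 (+) tau Z2.
Proof.
move=> c1 c2 c12 dis.
have no u w : (u, w) \in Z1 -> forall x, (u, x) \notin Z2.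
  move=> uw x; apply/negP => ux; case: (c12) => Zf _ _ _.
  have E : w = x by apply: (Zf u); rewrite in_setU ?uw ?ux ?orbT.
  by have /pred0P/(_ (u, w)) := dis; rewrite /= uw E ux.
have E : circ (Z1 :|: Z2) = (circ Z1 * circ Z2)%g.
  apply/permP => u; rewrite permM.
  have [n1|[w uw]] := circ_succP Z1 u.
    rewrite (circ_id c1 n1) !circ_permE //; apply: circ_succ_local => w.
    by rewrite in_setU (negbTE (n1 w)).
  rewrite (circE c1 uw) (circE c12 (w := w)) ?in_setU ?uw //.
  case: (c1) => _ _ /(_ _ _ uw)[x wx] _.
  by rewrite (circ_id c2) //; apply: no wx.
rewrite /tau E odd_permM.
have := cardsUI Z1 Z2; rewrite (disjoint_setI0 dis) cards0 addn0 => ->.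
rewrite oddD; by case: (odd_perm _); case: (odd_perm _); case: (odd _); case: (odd _).
Qed.

Lemma circle_subset Z Z' : circle_set Z -> Z' \subset Z ->
  (forall u v w, (u, v) \in Z -> (v, w) \in Z -> ((u, v) \in Z') = ((v, w) \in Z')) ->
  circle_set Z'.
Proof.
case=> f g o i /subsetP sub cl; split.
- by move=> u w w' /sub uw /sub; apply: f.
- by move=> u w w' /sub uw /sub; apply: g.
- by move=> u w uw; have [x wx] := o _ _ (sub _ uw); exists x; rewrite -(cl _ _ _ (sub _ uw) wx).
- by move=> u w uw; have [x xu] := i _ _ (sub _ uw); exists x; rewrite (cl _ _ _ xu (sub _ uw)).
Qed.

End Tau.

HB.lock Definition positive_bic (R : realType) (F : prefoam R) (N : nat)
    (c : {ffun facet F -> {set 'I_N}}) (i j : 'I_N) : {set vert F * vert F} :=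
  [set e in bic c i j | positive_edge c i j e].

Section PositiveCircles.
Variables (R : realType) (N : nat) (F : prefoam R) (hF : is_foam F N).
Implicit Types (u v w x : vert F) (t : tri F) (i j k l : 'I_N).

Lemma positive_bicE (c : {ffun facet F -> {set 'I_N}}) i j e :
  (e \in positive_bic c i j) = (e \in bic c i j) && positive_edge c i j e.
Proof. by rewrite positive_bic.unlock in_set. Qed.

Section Coloring.
Variable c : {ffun facet F -> {set 'I_N}}.
Hypothesis hc : is_coloring c.

Lemma positive_circles i j : circle_set (positive_bic c i j).
Proof.
apply: (circle_subset (bic_circles hF hc i j)).
  by apply/subsetP => e; rewrite positive_bicE => /andP[].
move=> u v w uv vw; rewrite !positive_bicE uv vw /=.
exact: (positive_edge_next hF hc uv vw).
Qed.

Lemma bic_positive i j : bic c i j = positive_bic c i j :|: positive_bic c j i.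
Proof.
apply/setP => e; rewrite in_setU !positive_bicE (bicC c j i).
case: (boolP (e \in _)) => //= eb; rewrite (positive_edgeC hF hc eb).
by case: (positive_edge _ _ _ _).
Qed.

Lemma positive_disjoint i j : [disjoint positive_bic c i j & positive_bic c j i].
Proof.
apply/pred0P => e /=; rewrite !positive_bicE (bicC c j i).
case: (boolP (e \in _)) => //= eb; rewrite (positive_edgeC hF hc eb).
by case: (positive_edge _ _ _ _).
Qed.

Lemma seam_linked_sym i j : ssrbool.symmetric (seam_linked c i j).
Proof. by move=> e e'; rewrite /seam_linked disjoint_sym andbCA. Qed.

(** Positivity is constant along a circle of seams, so the positive circles are the classes of the
    positive edges, and these are the cycles of [circ]. *)
Lemma odd_theta_plus2 i j : odd (theta_plus2 c i j) = tau (positive_bic c i j).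
Proof.
have [Bf Bg Bo Bi] := bic_circles hF hc i j.
set Z := positive_bic c i j; have Zc : circle_set Z := positive_circles i j.
pose cls e := [set e' in [set e | bicolored_seam c i j e] | connect (seam_linked c i j) e e'].
have ZB e : e \in Z -> e \in bic c i j by rewrite positive_bicE => /andP[].
have csym : connect_sym (seam_linked c i j) := sym_connect_sym (seam_linked_sym i j).
have clsE e e' : (e' \in cls e) = (e' \in bic c i j) && connect (seam_linked c i j) e e'.
  by rewrite in_set.
have clsP e e' : e \in bic c i j -> e' \in bic c i j ->
    (cls e == cls e') = connect (seam_linked c i j) e e'.
  move=> eb e'b; apply/eqP/idP => [/setP/(_ e')|ee'].
    by rewrite !clsE e'b connect0.
  by apply/setP => e''; rewrite !clsE (same_connect csym ee').
have link_next e e' : e \in bic c i j -> e' \in bic c i j -> e.2 = e'.1 ->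
    seam_linked c i j e e'.
  rewrite [e \in _]in_set [e' \in _]in_set /seam_linked => -> -> E /=.
  by apply/pred0Pn; exists e.2; rewrite /= !inE eqxx orbT E eqxx.
have link_step e e' : e \in Z -> seam_linked c i j e e' ->
    e' \in Z /\ e'.1 \in porbit (circ Z) e.1.
  case: e e' => [u w] [x y] eZ /and3P[_ e'b /pred0Pn[z /= /andP[]]].
  have {}e'b : (x, y) \in bic c i j by rewrite in_set.
  have eb := ZB _ eZ; move: (eZ); rewrite positive_bicE => /andP[_ pe].
  have nx a b d : (a, b) \in Z -> (b, d) \in bic c i j -> (b, d) \in Z.
    rewrite !positive_bicE => /andP[ab pab] bd; rewrite bd /=.
    by rewrite -(positive_edge_next hF hc ab bd).
  have pv a b d : (b, d) \in Z -> (a, b) \in bic c i j -> (a, b) \in Z.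
    rewrite !positive_bicE => /andP[bd pbd] ab; rewrite ab /=.
    by rewrite (positive_edge_next hF hc ab bd).
  move=> /set2P[]-> /set2P[] E; subst.
  - by rewrite (Bf _ _ _ e'b eb) porbit_id.
  - have Z' := pv _ _ _ eZ e'b; split=> //=.
    by rewrite porbit_sym -{1}(circE Zc Z') -{1}(expg1 (circ Z)) mem_porbit.
  - have Z' := nx _ _ _ eZ e'b; split=> //=.
    by rewrite -{1}(circE Zc eZ) -{1}(expg1 (circ Z)) mem_porbit.
  - by rewrite (Bg _ _ _ e'b eb) porbit_id.
have link_conn e e' : e \in Z -> connect (seam_linked c i j) e e' ->
    e' \in Z /\ e'.1 \in porbit (circ Z) e.1.
  move=> eZ /connectP[p]; elim: p e eZ => [|f p IH] e eZ /=.
    by move=> _ ->; rewrite porbit_id.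
  case/andP=> /(link_step _ _ eZ)[fZ fe] fp E; have [e'Z e'f] := IH f fZ fp E.
  by split=> //; rewrite (eqP (_ : porbit (circ Z) e.1 == porbit (circ Z) f.1)) //
    eq_porbit_mem porbit_sym.
have -> : theta_plus2 c i j = #|cls @: Z|.
  rewrite /theta_plus2; apply: eq_card => S; rewrite in_set.
  apply/andP/imsetP => [[/imsetP[e eb ->] /forallP pos]|[e eZ ->]].
    exists e => //; rewrite positive_bicE [e \in bic _ _ _]eb.
    by have := pos e; rewrite clsE [e \in bic _ _ _]eb connect0.
  split; first by apply/imsetP; exists e => //; apply: (ZB e).
  apply/forallP => e'; apply/implyP; rewrite clsE => /andP[_ /(link_conn _ _ eZ)[]].
  by rewrite positive_bicE => /andP[].
have fst_inj : {in Z &, injective (fun e : vert F * vert F => e.1)}.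
  move=> [u w] [u' w'] uw uw' /= E; rewrite -E in uw' *.
  by rewrite (Bf _ _ _ (ZB _ uw) (ZB _ uw')).
(* A vertex is labelled by the circle of the edge that leaves it. *)
pose D := [set e.1 | e in Z]; pose lab v := cls (v, circ_succ Z v).
have labE e : e \in Z -> lab e.1 = cls e.
  by case: e => u w uw; rewrite /lab /= (circ_succE Zc uw).
rewrite /tau (@odd_perm_labels _ _ (circ Z) D lab).
- rewrite (card_in_imset fst_inj) addbAC addbb addFb; congr (odd #|pred_of_set _|).
  by rewrite -imset_comp; apply: eq_in_imset => e eZ /=; rewrite labE.
- move=> v vD; apply: circ_id => // w; apply: contra vD => vw.
  by apply/imsetP; exists (v, w).
move=> _ _ /imsetP[e eZ ->] /imsetP[e' e'Z ->]; rewrite !labE // clsP ?ZB //.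
apply/idP/idP => [/porbitP[n]|/(link_conn _ _ eZ)[] //].
elim: n e' e'Z => [|n IH] e' e'Z; rewrite ?expg0 ?perm1.
  by move/fst_inj => -> //; apply: connect0.
rewrite expgSr permM => E.
have [f [fZ fE]] : exists f, f \in Z /\ f.1 = (circ Z ^+ n)%g e.1.
  elim: n {IH E} => [|n [f [fZ fE]]]; first by exists e; rewrite expg0 perm1.
  case: f fZ fE => a b ab /= E; have [_ _ Zo _] := Zc; have [d bd] := Zo _ _ ab.
  by exists (b, d); rewrite expgSr permM -E (circE Zc ab).
apply: connect_trans (IH f fZ fE) _; apply: connect1.
apply: link_next; rewrite ?ZB //; rewrite E -fE.
by case: f fZ {fE} => a b ab; rewrite /= (circE Zc ab).
Qed.

End Coloring.
End PositiveCircles.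

(** * Color swaps on regions *)

Section Kempe.
Variables (R : realType) (N : nat) (F : prefoam R) (hF : is_foam F N).
Implicit Types (u v w x : vert F) (t : tri F) (i j k l m a b : 'I_N).

Definition kempe i j (G : {set facet F}) (c : {ffun facet F -> {set 'I_N}}) :
    {ffun facet F -> {set 'I_N}} :=
  [ffun f => if f \in G then tperm i j @: c f else c f].

Lemma mem_imset_tperm i j l (A : {set 'I_N}) :
  (l \in tperm i j @: A) = (tperm i j l \in A).
Proof. by rewrite -{1}(tpermK i j l) mem_imset //; apply: perm_inj. Qed.

Variable c : {ffun facet F -> {set 'I_N}}.
Hypothesis hc : is_coloring c.
Variables (i j : 'I_N) (G : {set facet F}).
Hypothesis Gc : closed_facets c i j G.
Local Notation s := (tperm i j).
Local Notation c' := (kempe i j G c).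
Local Notation T := (region G).

Lemma kempe_out t l : t \notin T -> (l \in c' (facet_of t)) = (l \in c (facet_of t)).
Proof. by rewrite regionE ffunE => /negbTE->. Qed.

(* Near the region every facet may be regarded as swapped, because the facets
   outside of it contain both or none of i and j. *)
Lemma kempe_in t t' v l : t \in T -> v \in verts_of t -> v \in verts_of t' ->
  (l \in c' (facet_of t')) = (s l \in c (facet_of t')).
Proof.
move=> tG vt vt'; rewrite ffunE; case: ifP => [_|t'G]; first by rewrite mem_imset_tperm.
have : t' \notin surface2 c i j.
  apply/negP => t'S; move/negP: t'G; apply.
  by rewrite -regionE; apply: (region_vertex hF hc Gc tG t'S vt vt').
by rewrite surface2E; case: tpermP => [->|->|//]; case: (_ \in _); case: (_ \in _).
Qed.

Lemma seam_at_verts u w t1 t2 t3 : seam_at u w t1 t2 t3 ->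
  [/\ u \in verts_of t1, u \in verts_of t2 & u \in verts_of t3].
Proof.
move=> /seam_atE[E12 E3].
have d1 : dart t1 u w by rewrite E12 eqxx.
have d2 : dart t2 u w by rewrite E12 eqxx orbT.
have d3 : dart t3 w u by rewrite E3.
by rewrite (dart_verts d1).1 (dart_verts d2).1 (dart_verts d3).2.
Qed.

(** At any vertex the new coloring is the old one up to a single permutation of the colors, [s] or
    the identity. Whatever is tested on the triangles at one vertex is thus transported or
    unchanged. *)
Lemma kempe_local u :
  (u \in verts T -> forall t l, u \in verts_of t ->
     (l \in c' (facet_of t)) = (s l \in c (facet_of t))) /\
  (u \notin verts T -> forall t l, u \in verts_of t ->
     (l \in c' (facet_of t)) = (l \in c (facet_of t))).
Proof.
split=> [/vertsP[t0 t0T ut0]|nu] t l ut; first exact: kempe_in t0T ut0 ut.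
by apply: kempe_out; apply: contra nu => tT; apply/vertsP; exists t.
Qed.

Lemma kempe_coloring : is_coloring c'.
Proof.
apply/andP; split.
  apply/forallP => f; rewrite ffunE; case/andP: hc => /forallP/(_ f) + _.
  by case: ifP => // _; rewrite card_imset //; apply: perm_inj.
apply/forallP => u; apply/forallP => w; apply/forallP => t1; apply/forallP => t2.
apply/forallP => t3; apply/implyP => sm; have [u1 u2 u3] := seam_at_verts sm.
have [l1 l2] : (exists p : 'I_N -> 'I_N, forall t l, u \in verts_of t ->
    (l \in c' (facet_of t)) = (p l \in c (facet_of t))) /\ True.
  split=> //; have [inT outT] := kempe_local u.
  by have [/inT h|/outT h] := boolP (u \in verts T); [exists s|exists id].
case: l1 => p pP; apply/andP; split.
  apply/pred0P => l /=; rewrite !pP //; apply/negbTE.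
  exact: (coloring_seam hc (p l) sm).2.
by apply/eqP/setP => l; rewrite in_setU !pP // (coloring_seam hc (p l) sm).1.
Qed.

Lemma kempe_surface1 l :
  (forall t, t \in T -> (t \in surface1 c' l) = (t \in surface1 c (s l))) /\
  (forall t, t \notin T -> (t \in surface1 c' l) = (t \in surface1 c l)) /\
  (forall t t' v, t \in T -> t' \notin T -> v \in verts_of t -> v \in verts_of t' ->
     (t' \in surface1 c l) = (t' \in surface1 c (s l))).
Proof.
split=> [t tT|]; first rewrite !surface1E.
  have vt0 : (0 < #|verts_of t|)%N by rewrite (card_verts_of hF).
  by have [z tz] := card_gt0P vt0; apply: (kempe_in l tT tz tz).
split=> [t tT|t t' v tT t'T vt vt']; rewrite !surface1E; first exact: kempe_out.
by rewrite -(kempe_in l tT vt vt') kempe_out.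
Qed.

Lemma kempe_surface2 l m :
  (forall t, t \in T -> (t \in surface2 c' l m) = (t \in surface2 c (s l) (s m))) /\
  (forall t, t \notin T -> (t \in surface2 c' l m) = (t \in surface2 c l m)) /\
  (forall t t' v, t \in T -> t' \notin T -> v \in verts_of t -> v \in verts_of t' ->
     (t' \in surface2 c l m) = (t' \in surface2 c (s l) (s m))).
Proof.
have [in1 [out1 loc1]] := kempe_surface1 l; have [in2 [out2 loc2]] := kempe_surface1 m.
have E d a b t : (t \in surface2 d a b) = (t \in surface1 d a) (+) (t \in surface1 d b).
  by rewrite surface2E !surface1E.
split=> [t tT|]; first by rewrite !E in1 ?in2.
split=> [t tT|t t' v tT t'T vt vt']; first by rewrite !E out1 ?out2.
by rewrite !E (loc1 t t' v) ?(loc2 t t' v).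
Qed.

(** The change of [half_chi1]; the division is exact by [shift1K]. *)
Definition shift1 l : int :=
  ((euler_on T (surface1 c (s l)) - euler_on T (surface1 c l)) %/ 2)%Z.
Definition shift2 l m : int :=
  ((euler_on T (surface2 c (s l) (s m)) - euler_on T (surface2 c l m)) %/ 2)%Z.

Lemma euler_kempe1 l : euler (surface1 c' l) =
  (euler (surface1 c l) + (euler_on T (surface1 c (s l)) - euler_on T (surface1 c l)))%R.
Proof. have [h1 [h2 h3]] := kempe_surface1 l; exact: (euler_swap h1 h2 h3). Qed.

Lemma euler_kempe2 l m : euler (surface2 c' l m) =
  (euler (surface2 c l m)
   + (euler_on T (surface2 c (s l) (s m)) - euler_on T (surface2 c l m)))%R.
Proof. have [h1 [h2 h3]] := kempe_surface2 l m; exact: (euler_swap h1 h2 h3). Qed.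

End Kempe.

(** * Parities of seams and Euler characteristics under a color swap *)

Section KempeParity.
Variables (R : realType) (N : nat) (F : prefoam R) (hF : is_foam F N).
Implicit Types (u v w x : vert F) (t : tri F) (i j k l m a b : 'I_N).

Lemma surface2_even c i j : is_coloring c -> ~~ oddz (euler (@surface2 R F N c i j)).
Proof.
move=> hc; have Mc := @closed_mixed R N F c i j.
rewrite -region_mixed (euler_region hF hc Mc) oddzD (part_parity hF hc Mc).
by rewrite (part_parity hF hc (closed_facetsC Mc)) (boundary_partC hF hc Mc) addbb.
Qed.

Variable c : {ffun facet F -> {set 'I_N}}.
Hypothesis hc : is_coloring c.
Variables (i j : 'I_N) (G : {set facet F}).
Hypothesis Gc : closed_facets c i j G.
Local Notation s := (tperm i j).
Local Notation c' := (kempe i j G c).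
Local Notation T := (region G).
Let hc' := kempe_coloring hF hc Gc.

Lemma half_chi1_kempe l : half_chi1 c' l = (half_chi1 c l + shift1 c i j G l)%R.
Proof.
exact: (half_sum (surface1_even hF hc l) (surface1_even hF hc' l) (euler_kempe1 hF hc Gc l)).1.
Qed.

Lemma half_chi2_kempe l m : half_chi2 c' l m = (half_chi2 c l m + shift2 c i j G l m)%R.
Proof.
exact: (half_sum (surface2_even l m hc) (surface2_even l m hc')
  (euler_kempe2 hF hc Gc l m)).1.
Qed.

Lemma shift1K l : (shift1 c i j G l * 2 =
  euler_on T (surface1 c (s l)) - euler_on T (surface1 c l))%R.
Proof.
exact: (half_sum (surface1_even hF hc l) (surface1_even hF hc' l) (euler_kempe1 hF hc Gc l)).2.
Qed.

Lemma shift2K l m : (shift2 c i j G l m * 2 =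
  euler_on T (surface2 c (s l) (s m)) - euler_on T (surface2 c l m))%R.
Proof.
exact: (half_sum (surface2_even l m hc) (surface2_even l m hc')
  (euler_kempe2 hF hc Gc l m)).2.
Qed.

Lemma region_even : ~~ oddz (euler T).
Proof.
rewrite (euler_region hF hc Gc) oddzD (part_parity hF hc Gc).
by rewrite (part_parity hF hc (closed_facetsC Gc)) (boundary_partC hF hc Gc) addbb.
Qed.

(* With X, Y the parts of the region colored i, j: chi_j changes by
   chi(X) - chi(Y), and chi(X) = chi(Y) mod 2 is the parity of the number of
   seams in the region. *)
Lemma shift1_parity :
  oddz (shift1 c i j G j) (+) oddz (euler (part c i G)) = oddz (euler T %/ 2)%Z.
Proof.
have S := shift1K j; rewrite tpermR (euler_on_surface1 hF hc Gc) in S.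
rewrite (euler_on_surface1 hF hc (closed_facetsC Gc)) in S.
have E := euler_region hF hc Gc.
(* Twice the shift is chi(X) - chi(Y), while chi(T) = chi(X) + chi(Y). *)
have -> : (euler T %/ 2)%Z = (shift1 c i j G j + euler (part c j G))%R.
  by rewrite E -(mulzK (shift1 c i j G j + euler (part c j G))%R (d := 2)) // mulrDl S;
     congr (_ %/ _)%Z; lia.
rewrite oddzD (part_parity hF hc Gc) (part_parity hF hc (closed_facetsC Gc)).
by rewrite (boundary_partC hF hc Gc).
Qed.

Lemma kempe_positive a b u w :
  ((u, w) \in positive_bic c' a b) =
  if u \in verts T then (u, w) \in positive_bic c (s a) (s b)
  else (u, w) \in positive_bic c a b.
Proof.
have key (p : 'I_N -> 'I_N) : (forall t l, u \in verts_of t ->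
    (l \in c' (facet_of t)) = (p l \in c (facet_of t))) ->
  ((u, w) \in positive_bic c' a b) = ((u, w) \in positive_bic c (p a) (p b)).
  move=> pP.
  have B t1 t2 t3 : bicolored_at c' a b u w t1 t2 t3 = bicolored_at c (p a) (p b) u w t1 t2 t3.
    rewrite /bicolored_at; case sm: (seam_at u w t1 t2 t3) => //=.
    by have [u1 u2 u3] := seam_at_verts sm; rewrite !pP.
  have Eb : ((u, w) \in bic c' a b) = ((u, w) \in bic c (p a) (p b)).
    rewrite [LHS]in_set [RHS]in_set; apply: eq_existsb => t1; apply: eq_existsb => t2.
    by apply: eq_existsb => t3; exact: B.
  have Ep : positive_edge c' a b (u, w) = positive_edge c (p a) (p b) (u, w).
    apply: eq_existsb => t1; apply: eq_existsb => t2; apply: eq_existsb => t3.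
    apply: eq_existsb => v1; apply: eq_existsb => v2; apply: eq_existsb => v3.
    by rewrite [bicolored_at c' _ _ _ _ _ _ _]B.
  by rewrite 2!positive_bicE Eb Ep.
have [inT outT] := kempe_local hF hc Gc u.
by case: ifP => [/inT/key ->|/negbT/outT/(key id) ->].
Qed.

Lemma kempe_theta_other a b : a != i -> a != j -> b != i -> b != j ->
  tau (positive_bic c' a b) = tau (positive_bic c a b).
Proof.
move=> ai aj bi bj.
congr tau; apply/setP => -[u w]; rewrite kempe_positive !tpermD 1?eq_sym //.
by case: ifP.
Qed.

Lemma region_source (i' j' : 'I_N) u w : (i' == i) && (j' == j) || (i' == j) && (j' == i) ->
  (u, w) \in bic c i' j' -> (u \in verts T) = (w \in verts T).
Proof.
move=> ij uw; have {}uw : (u, w) \in bic c i j.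
  by case/orP: ij => /andP[/eqP<- /eqP<-]; rewrite // bicC.
have [t1 [t2 [d _ /andP[it jt] _]]] := bic_darts uw.
have [ut wt] := dart_verts d.
have tS : t1 \in surface2 c i j by rewrite surface2E it (negbTE jt).
by apply/vertsP/vertsP => -[t tT vt]; exists t1 => //;
  [apply: (region_vertex hF hc Gc tT tS vt ut)|apply: (region_vertex hF hc Gc tT tS vt wt)].
Qed.

Let inside (Z : {set vert F * vert F}) := [set e in Z | e.1 \in verts T].
Let outside (Z : {set vert F * vert F}) := [set e in Z | e.1 \notin verts T].

Let insideE Z e : (e \in inside Z) = (e \in Z) && (e.1 \in verts T).
Proof. by rewrite in_set. Qed.
Let outsideE Z e : (e \in outside Z) = (e \in Z) && (e.1 \notin verts T).
Proof. by rewrite in_set. Qed.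

Let circ_inside Z : circle_set Z -> (forall u w, (u, w) \in Z -> (u \in verts T) = (w \in
  verts T)) ->
  [/\ circle_set (inside Z), circle_set (outside Z) & tau Z = tau (inside Z) (+) tau (outside Z)].
Proof.
move=> Zc ZT.
have ci : circle_set (inside Z).
  apply: (circle_subset Zc); first by apply/subsetP => e; rewrite insideE => /andP[].
  by move=> u v w uv vw; rewrite !insideE uv vw /= (ZT _ _ uv).
have co : circle_set (outside Z).
  apply: (circle_subset Zc); first by apply/subsetP => e; rewrite outsideE => /andP[].
  by move=> u v w uv vw; rewrite !outsideE uv vw /= (ZT _ _ uv).
have E : Z = inside Z :|: outside Z.
  by apply/setP => e; rewrite in_setU insideE outsideE -andb_orr orbN andbT.
split=> //; rewrite {1}E; apply: tau_disjoint => //; first by rewrite -E.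
by apply/pred0P => e /=; rewrite insideE outsideE; case: (e.1 \in _); rewrite ?andbF.
Qed.

(** Seams of type ij do not leave the region, and inside it positive and negative circles trade
    places. The change is the parity of all circles in the region; they form the boundary of the
    part with i, so it is the parity of its Euler characteristic. *)
Lemma kempe_theta_ij : tau (positive_bic c' i j) =
  tau (positive_bic c i j) (+) oddz (euler (part c i G)).
Proof.
rewrite (part_parity hF hc Gc).
have sub a b e : e \in positive_bic c a b -> e \in bic c a b.
  by rewrite positive_bicE => /andP[].
have [|ci1 co1 ->] := circ_inside (positive_circles hF hc i j).
  by move=> u w /sub; apply: region_source; rewrite !eqxx.
have [|ci2 co2 _] := circ_inside (positive_circles hF hc j i).
  by move=> u w /sub; apply: region_source; rewrite !eqxx orbT.
have E : positive_bic c' i j = inside (positive_bic c j i) :|: outside (positive_bic c i j).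
  apply/setP => -[u w]; rewrite in_setU insideE outsideE kempe_positive tpermL tpermR /=.
  by case: ifP => _; rewrite ?andbT ?andbF ?orbF.
have Ebd : boundary (part c i G) = inside (positive_bic c i j) :|: inside (positive_bic c j i).
  rewrite (boundary_part hF hc Gc); apply/setP => e.
  rewrite in_set (bic_positive hF hc) in_setU [in RHS]in_setU !insideE.
  by rewrite andb_orl.
have dis : [disjoint positive_bic c i j & positive_bic c j i] := positive_disjoint hF hc i j.
have nd e : e \in positive_bic c i j -> e \in positive_bic c j i -> False.
  by move=> e1 e2; have /pred0P/(_ e) := dis; rewrite /= e1 e2.
rewrite Ebd (tau_disjoint ci1 ci2).
- rewrite E (tau_disjoint ci2 co1).
  + by case: (tau (inside (positive_bic c i j)));
       case: (tau (inside (positive_bic c j i))); case: (tau (outside _)).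
  + by rewrite -E; apply: (positive_circles hF hc').
  + apply/pred0P => e /=; rewrite insideE outsideE.
    by case: (e.1 \in _); rewrite ?andbF.
- by rewrite -Ebd; apply: (part_circles hF hc Gc).
- apply/pred0P => e /=; rewrite !insideE; apply/negP => /andP[/andP[e1 _] /andP[e2 _]].
  exact: nd e1 e2.
Qed.

(** For seams of types ik and jk, whose circles may enter and leave the region. The swap recombines
    the arcs, but the product of the two signs is preserved by [odd_perm_exchange], and so is the
    total number of edges. *)
Let tau_exchange (Z1 Z2 Z1' Z2' : {set vert F * vert F}) :
  circle_set Z1 -> circle_set Z2 -> circle_set Z1' -> circle_set Z2' ->
  (forall u w, ((u, w) \in Z1') = if u \in verts T then (u, w) \in Z2 else (u, w) \in Z1) ->
  (forall u w, ((u, w) \in Z2') = if u \in verts T then (u, w) \in Z1 else (u, w) \in Z2) ->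
  tau Z1' (+) tau Z2' = tau Z1 (+) tau Z2.
Proof.
move=> c1 c2 c1' c2' E1 E2.
have P := @odd_perm_exchange _ (verts T) (circ Z1) (circ Z2) (circ Z1') (circ Z2').
have {}P : odd_perm (circ Z1') (+) odd_perm (circ Z2') = odd_perm (circ Z1) (+) odd_perm (circ
  Z2).
  by apply: P => u; case: ifP => uT; rewrite !circ_permE //; apply: circ_succ_local => w;
     rewrite ?E1 ?E2 uT.
have card (Z : {set vert F * vert F}) : #|Z| = (#|inside Z| + #|outside Z|)%N.
  rewrite -(cardsID [set e : vert F * vert F | e.1 \in verts T] Z).
  congr (_ + _)%N; apply: eq_card => e; first by rewrite in_setI insideE [in LHS]in_set.
  by rewrite in_setD outsideE [in LHS]in_set andbC.
have I1 : inside Z1' = inside Z2.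
  by apply/setP => -[u w]; rewrite !insideE E1 /=; case: ifP; rewrite ?andbF.
have O1 : outside Z1' = outside Z1.
  by apply/setP => -[u w]; rewrite !outsideE E1 /=; case: ifP; rewrite ?andbF.
have I2 : inside Z2' = inside Z1.
  by apply/setP => -[u w]; rewrite !insideE E2 /=; case: ifP; rewrite ?andbF.
have O2 : outside Z2' = outside Z2.
  by apply/setP => -[u w]; rewrite !outsideE E2 /=; case: ifP; rewrite ?andbF.
have Q : odd #|Z1'| (+) odd #|Z2'| = odd #|Z1| (+) odd #|Z2|.
  by rewrite -!oddD (card Z1') (card Z2') (card Z1) (card Z2) I1 I2 O1 O2; congr odd; lia.
by rewrite /tau addbACA P Q addbACA.
Qed.

Lemma kempe_theta_right k : k != i -> k != j ->
  tau (positive_bic c' i k) (+) tau (positive_bic c' j k) =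
  tau (positive_bic c i k) (+) tau (positive_bic c j k).
Proof.
move=> ki kj.
apply: tau_exchange; try exact: (positive_circles hF hc);
  try exact: (positive_circles hF hc').
  by move=> u w; rewrite kempe_positive tpermL tpermD 1?eq_sym.
by move=> u w; rewrite kempe_positive tpermR tpermD 1?eq_sym.
Qed.

Lemma kempe_theta_left k : k != i -> k != j ->
  tau (positive_bic c' k i) (+) tau (positive_bic c' k j) =
  tau (positive_bic c k i) (+) tau (positive_bic c k j).
Proof.
move=> ki kj.
apply: tau_exchange; try exact: (positive_circles hF hc);
  try exact: (positive_circles hF hc').
  by move=> u w; rewrite kempe_positive tpermL tpermD 1?eq_sym.
by move=> u w; rewrite kempe_positive tpermR tpermD 1?eq_sym.
Qed.

End KempeParity.

(** Any other color is smaller or larger than both i and j, which groups the pairs a < b into (i,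
    j), those with one entry among i and j, and the rest. The monoid is arbitrary because parities
    use exclusive or and the evaluation uses products. *)
Lemma big_pairs_adjacent (T : Type) (idx : T) (op : Monoid.com_law idx) (N : nat)
    (i j : 'I_N) (S : 'I_N -> 'I_N -> T) : j = i.+1 :> nat ->
  \big[op/idx]_(a < N) \big[op/idx]_(b < N | (a < b)%N) S a b =
  op (S i j) (op
    (\big[op/idx]_(k < N | (k != i) && (k != j))
       (if (k < i)%N then op (S k i) (S k j) else op (S i k) (S j k)))
    (\big[op/idx]_(a < N | (a != i) && (a != j))
       \big[op/idx]_(b < N | [&& b != i, b != j & (a < b)%N]) S a b)).
Proof.
move=> ij; have ji : j != i by apply/eqP => E; move: ij; rewrite E; lia.
have split2 (f : 'I_N -> T) : \big[op/idx]_(b < N) f b =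
    op (f i) (op (f j) (\big[op/idx]_(b < N | (b != i) && (b != j)) f b)).
  by rewrite (bigD1 i) // (bigD1 j).
have inner (a : 'I_N) : \big[op/idx]_(b < N | (a < b)%N) S a b =
    op (if (a < i)%N then S a i else idx) (op (if (a < j)%N then S a j else idx)
      (\big[op/idx]_(b < N | [&& b != i, b != j & (a < b)%N]) S a b)).
  rewrite big_mkcond split2; congr (op _ (op _ _)).
  rewrite [RHS]big_mkcond [LHS]big_mkcond; apply: eq_bigr => b _.
  by case: (b != i); case: (b != j).
have lt_ij : (i < j)%N by rewrite ij.
have near (b : 'I_N) : (b != i) && (b != j) ->
    [/\ (b < j)%N = (b < i)%N, (i < b)%N = ~~ (b < i)%N & (j < b)%N = ~~ (b < i)%N].
  case/andP => /eqP bi /eqP bj.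
  have {}bi : b <> i :> nat by move/val_inj.
  have {}bj : b <> j :> nat by move/val_inj.
  by split; lia.
have mkrest (P : pred 'I_N) (f : 'I_N -> T) :
    \big[op/idx]_(b < N | [&& b != i, b != j & P b]) f b =
    \big[op/idx]_(b < N | (b != i) && (b != j)) (if P b then f b else idx).
  by rewrite -big_mkcondr; apply: eq_bigl => b; rewrite andbA.
have S1 : \big[op/idx]_(a < N) (if (a < i)%N then S a i else idx) =
    \big[op/idx]_(a < N | (a != i) && (a != j)) (if (a < i)%N then S a i else idx).
  by rewrite split2 ltnn ltnNge (ltnW lt_ij) /= !Monoid.mul1m.
have S2 : \big[op/idx]_(a < N) (if (a < j)%N then S a j else idx) = op (S i j)
    (\big[op/idx]_(a < N | (a != i) && (a != j)) (if (a < i)%N then S a j else idx)).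
  rewrite split2 lt_ij ltnn Monoid.mul1m; congr (op _ _); apply: eq_bigr => b /near[-> _ _].
  by [].
have S3 : \big[op/idx]_(a < N) \big[op/idx]_(b < N | [&& b != i, b != j & (a < b)%N]) S a b
  = op (\big[op/idx]_(b < N | (b != i) && (b != j)) (if (b < i)%N then idx else op (S i b) (S
    j b)))
   (\big[op/idx]_(a < N | (a != i) && (a != j))
      \big[op/idx]_(b < N | [&& b != i, b != j & (a < b)%N]) S a b).
  rewrite split2 Monoid.mulmA; congr (op _ _); rewrite !mkrest.
  rewrite [RHS](eq_bigr (fun b : 'I_N => op (if (i < b)%N then S i b else idx)
                                (if (j < b)%N then S j b else idx))) ?big_split //.
  by move=> b /near[_ -> ->]; case: (b < i)%N; rewrite ?Monoid.mulm1.
under eq_bigr do rewrite inner.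
rewrite !big_split /= S1 S2 S3 {S1 S2 S3 inner}.
rewrite Monoid.mulmCA -Monoid.mulmA; congr (op _ _).
rewrite !Monoid.mulmA; congr (op _ _).
rewrite [RHS](eq_bigr (fun b : 'I_N => op (op (if (b < i)%N then S b i else idx)
    (if (b < i)%N then S b j else idx)) (if (b < i)%N then idx else op (S i b) (S j b)))).
  rewrite !big_split /=; congr (op _ _); exact: Monoid.mulmC.
by move=> b _; case: (b < i)%N; rewrite ?Monoid.mulm1 ?Monoid.mul1m.
Qed.

(** * The change of the sign exponent *)

Section Sign.
Variables (R : realType) (N : nat) (F : prefoam R) (hF : is_foam F N).
Variable c : {ffun facet F -> {set 'I_N}}.
Hypothesis hc : is_coloring c.
Variables (i j : 'I_N) (G : {set facet F}).
Hypothesis ij : j = i.+1 :> nat.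
Hypothesis Gc : closed_facets c i j G.
Local Notation s := (tperm i j).
Local Notation c' := (kempe i j G c).
Local Notation T := (region G).
Let hc' := kempe_coloring hF hc Gc.

Lemma shift1_0 l : l != i -> l != j -> shift1 c i j G l = 0%R.
Proof.
move=> li lj; have := shift1K hF hc Gc l; rewrite tpermD 1?eq_sym //; lia.
Qed.

Lemma shift1_opp : shift1 c i j G i = (- shift1 c i j G j)%R.
Proof.
have := shift1K hF hc Gc i; have := shift1K hF hc Gc j; rewrite tpermL tpermR; lia.
Qed.

Lemma odd_theta_plus d : is_coloring d -> odd (@theta_plus R F N d) =
  \big[addb/false]_(a < N) \big[addb/false]_(b < N | (a < b)%N) tau (positive_bic d a b).
Proof.
move=> hd; rewrite /theta_plus (big_morph odd oddD erefl); apply: eq_bigr => a _.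
rewrite (big_morph odd oddD erefl); apply: eq_bigr => b _.
exact: (odd_theta_plus2 hF hd a b).
Qed.

Lemma kempe_theta : odd (theta_plus c') = odd (theta_plus c) (+) oddz (euler (part c i G)).
Proof.
apply: (etrans (odd_theta_plus hc')).
apply: (etrans _ (esym (congr1 (addb^~ _) (odd_theta_plus hc)))).
rewrite !(big_pairs_adjacent _ _ ij) /=.
rewrite (kempe_theta_ij hF hc Gc).
have -> : \big[addb/false]_(k < N | (k != i) && (k != j))
    (if (k < i)%N then tau (positive_bic c' k i) (+) tau (positive_bic c' k j)
     else tau (positive_bic c' i k) (+) tau (positive_bic c' j k))
  = \big[addb/false]_(k < N | (k != i) && (k != j))
    (if (k < i)%N then tau (positive_bic c k i) (+) tau (positive_bic c k j)
     else tau (positive_bic c i k) (+) tau (positive_bic c j k)).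
  apply: eq_bigr => k /andP[ki kj]; case: ifP => _.
    exact: (kempe_theta_left hF hc Gc).
  exact: (kempe_theta_right hF hc Gc).
have -> : \big[addb/false]_(a < N | (a != i) && (a != j))
    \big[addb/false]_(b < N | [&& b != i, b != j & (a < b)%N]) tau (positive_bic c' a b)
  = \big[addb/false]_(a < N | (a != i) && (a != j))
    \big[addb/false]_(b < N | [&& b != i, b != j & (a < b)%N]) tau (positive_bic c a b).
  apply: eq_bigr => a /andP[ai aj]; apply: eq_bigr => b /and3P[bi bj _].
  exact: (kempe_theta_other hF hc Gc).
by rewrite addbAC.
Qed.

(** The number of positive seams changes by the Euler characteristic of the part with i, and the
    weighted sum by the shift of j times j - i = 1; [shift1_parity] adds the two. *)
Lemma kempe_sign : oddz (sign_exp c') = oddz (sign_exp c) (+) oddz (euler T %/ 2)%Z.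
Proof.
have E : (\sum_(l < N) l%:Z * half_chi1 c' l =
    \sum_(l < N) l%:Z * half_chi1 c l + shift1 c i j G j)%R.
  under eq_bigr do rewrite (half_chi1_kempe hF hc Gc) mulrDr.
  rewrite big_split /=; congr (_ + _)%R.
  have ji : j != i by apply/eqP => E; move: ij; rewrite E; lia.
  rewrite (bigD1 i) // (bigD1 j) //= big1 ?addr0 => [|l /andP[li lj]].
    by rewrite shift1_opp ij -[i.+1]addn1 PoszD; lia.
  by rewrite shift1_0 ?mulr0.
have key (m' m : nat) (x' x d : int) (e : bool) : odd m' = odd m (+) e ->
    x' = (x + d)%R -> oddz (m'%:Z + x')%R = oddz (m%:Z + x)%R (+) (oddz d (+) e).
  move=> me ->; rewrite !oddzD !oddz_nat {}me.
  by case: (odd m); case: (oddz x); case: (oddz d); case: e.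
apply: (etrans (key _ _ _ _ _ _ kempe_theta E)).
by rewrite (shift1_parity hF hc Gc).
Qed.

End Sign.

(** * Components of a bicolored surface *)

Lemma card_disjoint_cover (I X : finType) (H : {set I}) (B : I -> {set X}) (U : {set X}) :
  (forall x, (x \in U) = [exists C in H, x \in B C]) ->
  (forall C C' x, C \in H -> C' \in H -> x \in B C -> x \in B C' -> C = C') ->
  #|U| = \sum_(C in H) #|B C|.
Proof.
move=> UE dis; under eq_bigr do rewrite -sum1_card big_mkcond.
rewrite exchange_big /= -sum1_card big_mkcond; apply: eq_bigr => x _.
rewrite UE; case: ifP => [/existsP[C /andP[CH xC]]|/negbT nx].
  rewrite (bigD1 C) //= xC big1 ?addn0 // => C' /andP[C'H /eqP nC].
  by case: ifP => // xC'; case: nC; apply: dis xC' xC.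
rewrite big1 // => C CH; case: ifP => // xC; case/negP: nx.
by apply/existsP; exists C; rewrite CH.
Qed.

Section Components.
Variables (R : realType) (N : nat) (F : prefoam R) (hF : is_foam F N).
Implicit Types (u v w x : vert F) (t : tri F) (i j k l m : 'I_N).
Implicit Types (M G C : {set facet F}) (H : {set {set facet F}}).

Definition facet_link M : rel (facet F) := fun f g =>
  [&& f \in M, g \in M & [exists t, exists t',
    [&& facet_of t == f, facet_of t' == g
      & [exists u, exists w, has_edge t u w && has_edge t' u w]]]].

Definition components M : {set {set facet F}} :=
  equivalence_partition (connect (facet_link M)) M.

Lemma facet_link_sym M : ssrbool.symmetric (facet_link M).
Proof.
move=> f g; apply/and3P/and3P => -[fM gM /existsP[t /existsP[t' /and3P[ft gt']]]];
  move=> /existsP[u /existsP[w /andP[e e']]]; split=> //; apply/existsP; exists t';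
  apply/existsP; exists t; rewrite ft gt' /=; apply/existsP; exists u;
  by apply/existsP; exists w; rewrite e e'.
Qed.

Lemma facet_linkI M t t' u w : facet_of t \in M -> facet_of t' \in M ->
  has_edge t u w -> has_edge t' u w -> facet_link M (facet_of t) (facet_of t').
Proof.
move=> tM t'M e e'; apply/and3P; split=> //; apply/existsP; exists t.
apply/existsP; exists t'; rewrite !eqxx /=; apply/existsP; exists u.
by apply/existsP; exists w; rewrite e e'.
Qed.

Lemma components_partition M : partition (components M) M.
Proof. exact/equivalence_partitionP/connect_equivalence_in/facet_link_sym. Qed.

Lemma component_sub M C : C \in components M -> C \subset M.
Proof.
move=> CM; have /and3P[/eqP cov _ _] := components_partition M.
by rewrite -cov; apply: bigcup_sup.
Qed.

Lemma component_connect M C f g : C \in components M -> f \in C -> g \in C ->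
  connect (facet_link M) f g.
Proof.
move=> CM fC gC; have /subsetP sC := component_sub CM.
have /and3P[_ tr _] := components_partition M.
rewrite -(pblock_equivalence_partition (connect_equivalence_in (D := M) (@facet_link_sym M)));
  try exact: sC.
by rewrite (def_pblock tr CM fC).
Qed.

Lemma component_closed M C f g : C \in components M -> f \in C ->
  facet_link M f g -> g \in C.
Proof.
move=> CM fC fg; have /subsetP sC := component_sub CM.
have /and3P[_ tr _] := components_partition M.
have gM : g \in M by case/and3P: fg.
rewrite -(def_pblock tr CM fC).
by rewrite (pblock_equivalence_partition (connect_equivalence_in (D := M) (@facet_link_sym M)));
  [apply: connect1| apply: sC |].
Qed.

Lemma component_unique M C C' f : C \in components M -> C' \in components M ->
  f \in C -> f \in C' -> C = C'.
Proof.
move=> CM C'M fC fC'; have /and3P[_ tr _] := components_partition M.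
by rewrite -(def_pblock tr CM fC) (def_pblock tr C'M fC').
Qed.

Section Coloring.
Variable c : {ffun facet F -> {set 'I_N}}.
Hypothesis hc : is_coloring c.
Variables i j : 'I_N.
Local Notation M := (mixed_facets c i j).

Lemma mixedE f : (f \in M) = (i \in c f) (+) (j \in c f).
Proof. by rewrite inE. Qed.

Lemma cover_closed H : H \subset components M -> closed_facets c i j (cover H).
Proof.
move=> /subsetP HM; split=> [f /bigcupP[C /HM CM fC]|t t' u w e e' /bigcupP[C CH tC] t'S].
  by rewrite -mixedE; apply: (subsetP (component_sub CM)).
apply/bigcupP; exists C => //; apply: (component_closed (HM _ CH) tC).
apply: facet_linkI e e'; first exact: (subsetP (component_sub (HM _ CH))).
by rewrite mixedE -surface2E.
Qed.

Lemma component_closed_facets C : C \in components M -> closed_facets c i j C.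
Proof.
move=> CM; have -> : C = cover [set C] by rewrite /cover big_set1.
by apply: cover_closed; rewrite sub1set.
Qed.

(** Triangles of F_ij at one vertex are joined through shared edges, so components are disjoint as
    closed sets, which makes Euler characteristics additive over them. *)
Lemma component_vertex C C' v : C \in components M -> C' \in components M ->
  v \in verts (region C) -> v \in verts (region C') -> C = C'.
Proof.
move=> CM C'M /vertsP[t tC vt] /vertsP[t' t'C' vt'].
have t'S := region_surface2 (component_closed_facets C'M) t'C'.
have := region_vertex hF hc (component_closed_facets CM) tC t'S vt vt'.
by rewrite !regionE in t'C' * => t'C; apply: (component_unique CM C'M t'C t'C').
Qed.

Lemma region_cover H t : (t \in region (cover H)) = [exists C in H, t \in region C].
Proof.
rewrite regionE; apply/bigcupP/existsP => [[C CH tC]|[C /andP[CH]]].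
  by exists C; rewrite CH regionE.
by rewrite regionE => tC; exists C.
Qed.

Lemma euler_on_cover H S : H \subset components M ->
  euler_on (region (cover H)) S = (\sum_(C in H) euler_on (region C) S)%R.
Proof.
move=> /subsetP HM; rewrite /euler_on big_split sumrB /= -!(big_morph Posz PoszD (erefl _)).
have unique C C' v : C \in H -> C' \in H -> v \in verts (region C) ->
    v \in verts (region C') -> C = C' by move=> /HM CM /HM C'M; apply: component_vertex.
congr (_ - _ + _)%R; congr Posz; apply: card_disjoint_cover.
- move=> v; rewrite in_setI; apply/andP/existsP => [[vS /vertsP[t]]|[C /andP[CH]]].
    rewrite region_cover => /existsP[C /andP[CH tC]] vt; exists C.
    by rewrite CH in_setI vS; apply/vertsP; exists t.
  rewrite in_setI => /andP[vS /vertsP[t tC vt]]; split=> //; apply/vertsP; exists t => //.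
  by rewrite region_cover; apply/existsP; exists C; rewrite CH.
- move=> C C' v CH C'H; rewrite !in_setI => /andP[_ vC] /andP[_ vC'].
  exact: unique vC vC'.
- move=> E; rewrite in_setI; apply/andP/existsP => [[ES /edgesP[t [u [w [+ e EE]]]]]|].
    rewrite region_cover => /existsP[C /andP[CH tC]]; exists C.
    by rewrite CH in_setI ES; apply/edgesP; exists t, u, w.
  case=> C /andP[CH]; rewrite in_setI => /andP[ES /edgesP[t [u [w [tC e EE]]]]].
  split=> //; apply/edgesP; exists t, u, w; split=> //.
  by rewrite region_cover; apply/existsP; exists C; rewrite CH.
- move=> C C' E CH C'H; rewrite !in_setI => /andP[_ /edgesP[t [u [w [tC e EE]]]]].
  case/andP=> _ /edgesP[t' [u' [w' [tC' e' EE']]]]; rewrite EE in EE'.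
  have {}e' := has_edge_set e' (esym EE').
  by apply: (unique _ _ u) => //; apply/vertsP; [exists t|exists t'];
     rewrite ?(has_edge_verts e).1 ?(has_edge_verts e').1.
- move=> t; rewrite in_setI region_cover; apply/andP/existsP => [[tS /existsP[C /andP[CH tC]]]|].
    by exists C; rewrite CH in_setI tS.
  case=> C /andP[CH]; rewrite in_setI => /andP[tS tC]; split=> //.
  by apply/existsP; exists C; rewrite CH.
- move=> C C' t CH C'H; rewrite !in_setI !regionE => /andP[_ tC] /andP[_ tC'].
  exact: component_unique (HM _ CH) (HM _ C'H) tC tC'.
Qed.

Lemma euler_on_setT (T : {set tri F}) : euler_on T setT = euler T.
Proof.
rewrite /euler_on /euler !setTI; congr (_ - _ + _)%R; congr (Posz _); apply: eq_card => X.
  rewrite in_setI andb_idl // => /vertsP[t _ vt].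
  by apply/vertsP; exists t; rewrite ?inE.
rewrite in_setI andb_idl // => /edgesP[t [u [w [_ e E]]]]; apply/edgesP; exists t, u, w.
by split; rewrite ?inE.
Qed.

Lemma euler_cover H : H \subset components M ->
  euler (region (cover H)) = (\sum_(C in H) euler (region C))%R.
Proof.
move=> HM; rewrite -euler_on_setT euler_on_cover //; apply: eq_bigr => C _.
exact: euler_on_setT.
Qed.

Lemma shift1_cover H l : H \subset components M ->
  shift1 c i j (cover H) l = (\sum_(C in H) shift1 c i j C l)%R.
Proof.
move=> HM; apply: (@mulIf _ 2%:Z) => //; rewrite (shift1K hF hc (cover_closed HM)).
rewrite !euler_on_cover // -sumrB mulr_suml; apply: eq_bigr => C CH.
by rewrite (shift1K hF hc) //; apply: component_closed_facets; apply: (subsetP HM).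
Qed.

Lemma shift2_cover H l m : H \subset components M ->
  shift2 c i j (cover H) l m = (\sum_(C in H) shift2 c i j C l m)%R.
Proof.
move=> HM; apply: (@mulIf _ 2%:Z) => //; rewrite (shift2K hF hc (cover_closed HM)).
rewrite !euler_on_cover // -sumrB mulr_suml; apply: eq_bigr => C CH.
by rewrite (shift2K hF hc) //; apply: component_closed_facets; apply: (subsetP HM).
Qed.

Section Component.
Variable C : {set facet F}.
Hypothesis CM : C \in components M.
Let T := region C.
Let Cc := component_closed_facets CM.

(** Constancy spreads inside a facet through regular edges, and from facet to facet through
    [facet_link]. *)
Lemma component_constant (A : Type) (f : tri F -> A) :
  (forall t t' u w, t \in T -> t' \in T -> has_edge t u w -> has_edge t' u w -> f t = f t') ->
  forall t t', t \in T -> t' \in T -> f t = f t'.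
Proof.
move=> fE; have facet_const t t' : t \in T -> facet_of t = facet_of t' -> f t = f t'.
  move=> tT /(foam_facet hF)/connectP[p]; elim: p t tT => [|s p IH] t tT /=.
    by move=> _ ->.
  case/andP=> /existsP[v ts] sp E; have sT : s \in T.
    by rewrite regionE -(adjacent_at_facet hF ts) -regionE.
  case/existsP: ts => w /and3P[_ e e'].
  by rewrite (fE t s v w) // (IH s).
have link_const g g' : facet_link M g g' -> g \in C ->
    exists t t', [/\ t \in T, t' \in T, facet_of t = g, facet_of t' = g' & f t = f t'].
  move=> gg' gC; have g'C := component_closed CM gC gg'.
  case/and3P: gg' => _ _ /existsP[t /existsP[t' /and3P[/eqP tg /eqP tg' /existsP[u
    /existsP[w]]]]].
  case/andP=> e e'; have tT : t \in T by rewrite regionE tg.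
  have t'T : t' \in T by rewrite regionE tg'.
  by exists t, t'; split=> //; apply: fE e e'.
move=> t t' tT t'T; have := tT; have := t'T; rewrite !regionE => t'C tC.
have /connectP[p] := component_connect CM tC t'C.
move Eg: (facet_of t) => g; elim: p g t tT tC Eg => [|g' p IH] g t tT tC Eg /=.
  by move=> _ E; apply: facet_const; rewrite // E.
case/andP=> gg' gp E; rewrite Eg in tC.
have [t1 [t2 [t1T t2T t1g t2g' ->]]] : exists t1 t2, [/\ t1 \in T, t2 \in T,
    facet_of t1 = g, facet_of t2 = g' & f t = f t2].
  have [t1 [t2 [t1T t2T t1g t2g E12]]] := link_const _ _ gg' tC.
  by exists t1, t2; split=> //; rewrite -E12; apply: facet_const; rewrite // t1g.
by apply: (IH g' t2) => //; rewrite -regionE.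
Qed.

(** A component is closed: of the three sheets at a seam, F_ij contains none or exactly two. *)
Lemma component_edge t u w : t \in T -> has_edge t u w ->
  exists2 t', t' != t & forall s, (s \in T) && has_edge s u w = (s == t) || (s == t').
Proof.
have key x y : t \in T -> dart t x y ->
    exists2 t', t' != t & forall s, (s \in T) && has_edge s x y = (s == t) || (s == t').
  move=> tT txy; have txyE : has_edge t x y by rewrite /has_edge txy.
  have inT s : has_edge s x y -> s \in surface2 c i j -> s \in T.
    by move=> e sS; apply: (region_edge Cc txyE e tT sS).
  have notT s : s \notin surface2 c i j -> (s \in T) = false.
    by move=> nS; apply/negP => sT; rewrite (region_surface2 Cc sT) in nS.
  have := region_surface2 Cc tT; rewrite surface2E => tS.
  case: (dart_cases hF txy) => [[t' [E1 E2 fE _]]|[t2 [t3 st]]|[t1 [t2 st]]].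
  - have D1 s : dart s x y = (s == t) by rewrite -in_set1 -E1 inE.
    have D2 s : dart s y x = (s == t') by rewrite -in_set1 -E2 inE.
    exists t'; first by rewrite -D1; apply/negP => d; have := dart_asym hF d; rewrite D2 eqxx.
    move=> s; rewrite /has_edge D1 D2; apply: andb_idl => /orP[]/eqP-> //.
    by rewrite regionE fE -regionE.
  - have [E12 E3] := seam_atE st; have [Ei ni] := coloring_seam hc i st.
    have [Ej nj] := coloring_seam hc j st; case/and3P: (st) => n12 _ _.
    have n3 : t3 != t by apply/eqP => E; have := dart_asym hF txy; rewrite E3 -E eqxx.
    have n23 : t2 != t3.
      apply/eqP => E; have d : dart t2 x y by rewrite E12 eqxx orbT.
      by have := dart_asym hF d; rewrite E3 E eqxx.
    have S2 : t2 \in surface2 c i j = (t3 \notin surface2 c i j).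
      by rewrite !surface2E Ei Ej; move: tS ni nj; do 4!case: (_ \in _).
    have e2 : has_edge t2 x y by rewrite /has_edge E12 eqxx orbT.
    have e3 : has_edge t3 x y by rewrite /has_edge E3 eqxx !orbT.
    case S3: (t3 \in surface2 c i j) in S2.
      exists t3 => // s; rewrite /has_edge E12 E3.
      have [->|ns] := eqVneq s t; first by rewrite tT.
      have [->|ns2] := eqVneq s t2; first by rewrite (notT t2) ?S2 // (negbTE n23).
      by rewrite /=; apply: andb_idl => /eqP ->; apply: inT.
    exists t2; first by rewrite eq_sym.
    move=> s; rewrite /has_edge E12 E3.
    have [->|ns] := eqVneq s t; first by rewrite tT.
    have [->|ns2] := eqVneq s t2; first by rewrite inT ?S2.
    by rewrite /=; case: eqP => [->|]; rewrite ?andbF // notT ?S3.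
  - have [E12 E3] := seam_atE st; have [Ei ni] := coloring_seam hc i st.
    have [Ej nj] := coloring_seam hc j st; case/and3P: (st) => n12 _ _.
    have d1 : dart t1 y x by rewrite E12 eqxx.
    have d2 : dart t2 y x by rewrite E12 eqxx orbT.
    have n1 : t1 != t by apply/eqP => E; have := dart_asym hF txy; rewrite -E d1.
    have n2 : t2 != t by apply/eqP => E; have := dart_asym hF txy; rewrite -E d2.
    have S12 : t1 \in surface2 c i j = (t2 \notin surface2 c i j).
      by rewrite !surface2E; move: tS ni nj; rewrite Ei Ej; do 4!case: (_ \in _).
    have e1 : has_edge t1 x y by rewrite /has_edge d1 orbT.
    have e2 : has_edge t2 x y by rewrite /has_edge d2 orbT.
    case S2: (t2 \in surface2 c i j) in S12.
      exists t2 => // s; rewrite /has_edge E12 E3.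
      have [->|ns] := eqVneq s t; first by rewrite tT.
      have [->|ns2] := eqVneq s t1; first by rewrite (notT t1) ?S12 // (negbTE n12).
      by rewrite /=; apply: andb_idl => /eqP ->; apply: inT.
    exists t1 => // s; rewrite /has_edge E12 E3.
    have [->|ns] := eqVneq s t; first by rewrite tT.
    have [->|ns2] := eqVneq s t1; first by rewrite inT ?S12.
    by rewrite /=; case: eqP => [->|]; rewrite ?andbF // notT ?S2.
move=> tT /orP[d|d]; first exact: key.
have [t' n E] := key _ _ tT d; exists t' => // s.
by rewrite has_edge_sym E.
Qed.

(* The boundary maps over F_2 satisfy D2 * D1 = 0; connectedness says that the
   left kernels of D2 and of the transpose of D1 are the constants, so that
   (|T| - 1) + (|V| - 1) <= |E|. *)
Lemma euler_component : (euler T <= 2)%R.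
Proof.
pose V := verts T; pose E := edges T.
pose D2 : 'M['F_2]_(#|T|, #|E|) :=
  (\matrix_(a < #|T|, e < #|E|) (enum_val e \subset verts_of (enum_val a))%:R)%R.
pose D1 : 'M['F_2]_(#|E|, #|V|) := (\matrix_(e < #|E|, b < #|V|) (enum_val b \in enum_val
  e)%:R)%R.
have const_rank (m n : nat) (A : 'M['F_2]_(m, n)) :
    (forall x : 'rV_m, (x *m A)%R = 0%R -> forall a b, x 0%R a = x 0%R b) ->
    (m <= (\rank A).+1)%N.
  move=> K; suff : (\rank (kermx A) <= 1)%N by rewrite mxrank_ker; lia.
  apply: leq_trans (rank_leq_row (const_mx 1%R : 'rV['F_2]_m)); apply: mxrankS.
  apply/row_subP => l; have := K (row l (kermx A)).
  rewrite -row_mul mulmx_ker row0 => /(_ erefl) cst.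
  have [a _|m0] := pickP (fun a : 'I_m => true); last first.
    have -> : row l (kermx A) = 0%R by apply/rowP => b; have := m0 b.
    exact: sub0mx.
  have -> : row l (kermx A) = (row l (kermx A) 0 a *: const_mx 1)%R.
    by apply/rowP => b; rewrite (cst b a) !mxE mulr1.
  exact: scalemx_sub.
have F2 (a : 'F_2) : (a + a = 0)%R by rewrite -mulr2n (mulrn_pchar (pchar_Fp (isT : prime 2))).
have F2eq (a b : 'F_2) : (a + b = 0)%R -> a = b.
  by move=> ab; apply: (addIr b); rewrite ab F2.
have sum2 (I : finType) (A : {set I}) (P : pred I) (f : I -> 'F_2) a b : a != b ->
    (forall s, (s \in A) && P s = (s == a) || (s == b)) ->
    (\sum_(s in A) f s * (P s)%:R = f a + f b)%R.
  move=> ab AP; rewrite (eq_bigr (fun s => if P s then f s else 0)%R); last first.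
    by move=> s _; case: (P s); rewrite ?mulr1 ?mulr0.
  rewrite -big_mkcondr (eq_bigl _ _ AP) (bigD1 a) ?eqxx //= (bigD1 b) /=; last first.
    by rewrite eqxx orbT eq_sym.
  rewrite big1 ?addr0 // => s; by case: (s == a); case: (s == b).
have edge_sub t e : e \in E -> e \subset verts_of t ->
    exists u w, [/\ u != w, has_edge t u w & e = [set u; w]].
  move=> /edgesP[t' [u [w [_ e' ->]]]] sub; exists u, w.
  have uw : u != w by case/orP: e' => d; rewrite ?(dart_neq hF d) // eq_sym (dart_neq hF d).
  split=> //; apply: verts_of_has_edge uw; apply: (subsetP sub); rewrite !inE eqxx ?orbT //.
have sub_edge s u w : u != w -> has_edge s u w = ([set u; w] \subset verts_of s).
  move=> uw; apply/idP/idP => [e|/subsetP sub].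
    have [us ws] := has_edge_verts e; by apply/subsetP => x /set2P[]->.
  by apply: verts_of_has_edge uw; apply: sub; rewrite !inE eqxx ?orbT.
have edgeE t u w : t \in T -> has_edge t u w -> [set u; w] \in E.
  by move=> tT e; apply/edgesP; exists t, u, w.
have r2 : (#|T| <= (\rank D2).+1)%N.
  apply: (const_rank _ _ D2) => x xD a b; have aT := enum_valP a; have bT := enum_valP b.
  pose f t := x 0%R (enum_rank_in aT t).
  have xf d : x 0%R d = f (enum_val d) by rewrite /f enum_valK_in.
  rewrite !xf; apply: (component_constant _ aT bT) => t t' u w tT t'T e e'.
  have uw : u != w by case/orP: e => d; rewrite ?(dart_neq hF d) // eq_sym (dart_neq hF d).
  have eE := edgeE _ _ _ tT e; have [s nst sE] := component_edge tT e.
  have : f t = f s.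
    apply: F2eq; have /rowP/(_ (enum_rank_in eE [set u; w])) := xD.
    rewrite !mxE => <-; rewrite -(sum2 _ T (fun s => has_edge s u w)) 1?eq_sym //.
    rewrite big_enum_val; apply: eq_bigr => d _; rewrite !mxE enum_rankK_in // xf.
    by rewrite sub_edge.
  have /orP[/eqP-> //|/eqP->//] : (t' == t) || (t' == s) by rewrite -sE t'T.
have r1 : (#|V| <= (\rank D1^T%R).+1)%N.
  apply: (const_rank _ _ D1^T%R) => x xD a b; have aV := enum_valP a; have bV := enum_valP b.
  pose f v := x 0%R (enum_rank_in aV v).
  have xf d : x 0%R d = f (enum_val d) by rewrite /f enum_valK_in.
  have VP t v : t \in T -> v \in verts_of t -> v \in V by move=> tT vt; apply/bigcupP; exists t.
  have fE t u w : t \in T -> u \in verts_of t -> w \in verts_of t -> f u = f w.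
    move=> tT ut wt; have [->//|uw] := eqVneq u w; have e := verts_of_has_edge ut wt uw.
    have eE := edgeE _ _ _ tT e.
    apply: F2eq; have /rowP/(_ (enum_rank_in eE [set u; w])) := xD.
    rewrite !mxE => <-; rewrite -(sum2 _ V (fun s => s \in [set u; w])) //; last first.
      move=> s; rewrite !inE; apply: andb_idl => /orP[]/eqP->; exact: (VP t).
    rewrite big_enum_val; apply: eq_bigr => d _; rewrite !mxE enum_rankK_in // xf //.
  have [t tT ta] := bigcupP aV; have [t' t'T tb] := bigcupP bV; rewrite !xf.
  have corner_in (s : tri F) : corner s 0%R \in verts_of s by apply: imset_f.
  rewrite (fE _ _ _ tT ta (corner_in t)) (fE _ _ _ t'T tb (corner_in t')).
  apply: (component_constant (f := fun s => f (corner s 0%R))) tT t'T => s s' u w sT s'T e e'.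
  by rewrite (fE _ _ u sT) ?(has_edge_verts e).1 // (fE _ _ u s'T) ?(has_edge_verts e').1.
(* A vertex of a triangle lies on exactly two of its edges, and 1 + 1 = 0. *)
have DD : (D2 *m D1 = 0)%R.
  apply/matrixP => a b; rewrite !mxE; set t := enum_val a; set v := enum_val b.
  have tT : t \in T := enum_valP a.
  transitivity (\sum_(e in E) 1 * ((e \subset verts_of t) && (v \in e))%:R : 'F_2)%R.
    by rewrite [RHS]big_enum_val; apply: eq_bigr => e _; rewrite !mxE mul1r -natrM mulnb.
  have [/mem_verts_of[p [q [pv vq qp]]]|nv] := boolP (v \in verts_of t); last first.
    rewrite big1 // => e _; case: andP => [[/subsetP sub /sub vt]|_]; last by rewrite mulr0.
    by rewrite vt in nv.
  have d1 := dart_neq hF pv; have d2 := dart_neq hF vq; have d3 := dart_neq hF qp.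
  have pq : [set v; p] != [set v; q].
    apply/eqP => /set2_eq[[_ E']|[_ E']]; [move: d2 | move: d3]; by rewrite E' eqxx.
  have tE x : x \in verts_of t -> [|| x == v, x == p | x == q].
    have : [set v; p; q] = verts_of t.
      apply/eqP; rewrite eqEcard (card_verts_of hF) -setUA !cardsU1 cards1 !inE.
      rewrite negb_or d1 d2 (eq_sym v) d3 /= andbT; have [vt pt] := dart_verts pv;
        have [qt _] := dart_verts qp.
      by apply/subsetP => x'; rewrite !inE => /or3P[]/eqP->.
    by move=> <-; rewrite !inE orbA.
  have vpE := edgeE t v p tT _; have vqE := edgeE t v q tT _.
  have vp : has_edge t v p by rewrite /has_edge pv.
  have vq' : has_edge t v q by rewrite /has_edge qp orbT.
  rewrite (sum2 _ _ _ (fun=> 1%R) _ _ pq) ?F2 // => e.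
  apply/and3P/orP => [[eE sub ve]|[]/eqP->]; last 2 first.
  - by rewrite vpE // -sub_edge // vp set21.
  - by rewrite vqE // -sub_edge 1?eq_sym // vq' set21.
  have [x [y [xy e' E']]] := edge_sub _ _ eE sub.
  have [z vz Ez] : exists2 z, v != z & e = [set v; z].
    move: ve xy; rewrite E' => /set2P[->|->] xy; first by exists y.
    by exists x; rewrite 1?eq_sym // setUC.
  have : z \in verts_of t by apply: (subsetP sub); rewrite Ez set22.
  rewrite Ez => /tE/or3P[]/eqP E3; rewrite E3 ?eqxx in vz *; [by [] | by left | by right].
have := mulmx0_rank_max DD; rewrite mxrank_tr in r1.
by rewrite /euler -/V -/E; lia.
Qed.
End Component.
End Coloring.
End Components.

(** * Power series *)

Section PowerSeriesPerm.
Variables (k : comNzRingType) (n : nat).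
Local Open Scope ring_scope.
Implicit Types (f g : mps k n) (s t : 'S_n) (a b c : 'I_n).

Local Notation "m # s" := [multinom m (s i) | i < n] (at level 40, left associativity).

Fact mps_perm_zmod s : zmod_morphism (@mps_perm k n s).
Proof. by []. Qed.
HB.instance Definition _ s :=
  GRing.isZmodMorphism.Build (mps k n) (mps k n) (mps_perm s) (mps_perm_zmod s).

Lemma mps_perm_const s (a : k) : mps_perm s (@mps_const k n a) = mps_const a.
Proof.
apply/funext => m; rewrite /mps_perm /mps_const.
by rewrite -!mdeg_eq0 mdeg_mperm.
Qed.

Fact mps_perm_monoid s : monoid_morphism (@mps_perm k n s).
Proof.
split=> [|f g]; first exact: mps_perm_const.
apply/funext => m; pose T (h : mps k n) := mps_trunc (mdeg m).+1 h.
have E (h : mps k n) (l : 'X_{1..n}) : (mdeg l <= mdeg m)%N -> (T h)@_l = h l by move=> lm;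
  apply: mcoeff_trunc.
have Es (h : mps k n) (l : 'X_{1..n}) : (mdeg l <= mdeg m)%N -> (msym s (T h))@_l = mps_perm s
  h l.
  by move=> lm; rewrite mcoeff_sym E // mdeg_mperm.
transitivity (T f * T g)@_(m # s).
  by apply/esym/mcoeffM_agree => l; rewrite mdeg_mperm; apply: E.
by rewrite -mcoeff_sym msymM; apply: mcoeffM_agree => l; apply: Es.
Qed.
HB.instance Definition _ s :=
  GRing.isMonoidMorphism.Build (mps k n) (mps k n) (mps_perm s) (mps_perm_monoid s).

Lemma mps_permM s t f : mps_perm (t * s)%g f = mps_perm s (mps_perm t f).
Proof.
by apply/funext => m; congr f; apply/mnmP => i; rewrite !mnmE permM.
Qed.

Lemma mps_perm1 f : mps_perm 1%g f = f.
Proof. by apply/funext => m; congr f; apply/mnmP => i; rewrite !mnmE perm1. Qed.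

Lemma mps_perm_var s i : mps_perm s (mps_var k i) = mps_var k (s i).
Proof.
apply/funext => m; rewrite /mps_perm /mps_var; congr (nat_of_bool _)%:R.
apply/eqP/eqP => [/mnmP E|->]; apply/mnmP => l; last by rewrite !mnmE (inj_eq perm_inj).
by have := E ((s^-1)%g l); rewrite !mnmE permKV => ->; rewrite -(inj_eq (@perm_inj _ s)) permKV.
Qed.

Lemma mps_perm_p_series beta s i j :
  mps_perm s (p_series beta i j) = p_series beta (s i) (s j) :> mps k n.
Proof.
apply/funext => m; rewrite /mps_perm /p_series !mnmE; congr (if _ then _ else _).
apply/forallP/forallP => E l.
  have e x : (s^-1%g l == x) = (l == s x) by rewrite -(inj_eq (@perm_inj _ s)) permKV.
  by have := E ((s^-1)%g l); rewrite !mnmE permKV !e.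
by have := E (s l); rewrite !mnmE !(inj_eq perm_inj).
Qed.

Lemma mmap_symmetric l (f : k -> mps k n) (h : 'I_l -> mps k n) (s : 'S_l) (p : {mpoly k[l]}) :
  p \is symmetric -> mmap f (h \o s) p = mmap f h p.
Proof.
move=> ps; rewrite /mmap.
have E : perm_eq [seq [multinom m (s^-1%g i) | i < l] | m : 'X_{1..l} <- msupp p] (msupp p).
  apply: uniq_perm (msupp_uniq p) _.
    by rewrite map_inj_uniq ?msupp_uniq //; apply: mperm_inj.
  move=> m0; apply/mapP/idP => [[m' m'p ->]|mp]; first by rewrite issym_msupp.
  exists [multinom m0 (s i) | i < l]; first by rewrite issym_msupp.
  by apply/mnmP => i; rewrite !mnmE permKV.
rewrite -[RHS](perm_big _ E) [RHS]big_map /=. apply: eq_bigr => m0 _; congr (_ * _).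
  by rewrite msym_coeff.
rewrite /mmap1 [RHS](reindex_inj (@perm_inj _ s)); apply: eq_bigr => i _.
by rewrite mnmE permK.
Qed.

(** The images of the variables of [A], listed in the order of [A], are those of [s @: A] up to a
    permutation, which a symmetric polynomial absorbs. *)
Lemma mps_perm_eval_at s l (p : {mpoly k[l]}) (A : {set 'I_n}) : #|A| = l ->
  p \is symmetric -> mps_perm s (eval_at p A) = eval_at p (s @: A).
Proof.
move=> cA ps; have csA : #|s @: A| = l by rewrite card_imset //; apply: perm_inj.
have E : perm_eq [seq mps_var k (s i) | i <- enum A] [seq mps_var k i | i <- enum (s @: A)].
  rewrite (map_comp (@mps_var k n) s); apply: perm_map; apply: uniq_perm; rewrite ?enum_uniq //.
    by rewrite map_inj_uniq ?enum_uniq //; apply: perm_inj.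
  by move=> x; rewrite mem_enum; apply/mapP/imsetP => -[y]; rewrite ?mem_enum => yA ->;
    exists y; rewrite ?mem_enum.
have sz : size [seq mps_var k (s i) | i <- enum A] = l by rewrite size_map -cardE.
have sz' : size [seq mps_var k i | i <- enum (s @: A)] = l by rewrite size_map -cardE.
have /tuple_permP[q qE] : perm_eq (Tuple (introT eqP sz)) (Tuple (introT eqP sz')) by [].
rewrite /eval_at -[RHS](mmap_symmetric _ _ q ps) /mmap rmorph_sum; apply: eq_bigr => m _.
rewrite rmorphM /= mps_perm_const; congr (_ * _); rewrite /mmap1 rmorph_prod.
apply: eq_bigr => i _; rewrite rmorphXn; congr (_ ^+ _) => /=.
have /(congr1 (fun e => nth 0 e i)) := qE; rewrite nth_mktuple (tnth_nth 0) /= => <-.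
rewrite -(nth_map 0 0) ?size_map -?cardE ?cA // -map_comp; congr nth.
by apply: eq_map => x /=; rewrite mps_perm_var.
Qed.

Lemma mps_var_mul c f m :
  (mps_var k c * f) m = if (0 < m c)%N then f (m - U_(c))%MM else 0.
Proof.
rewrite /GRing.mul /= /mps_mul /mps_var.
have [mc|mc] := boolP (0 < m c)%N; last first.
  apply: big1 => l lm; case: eqP => [E|_]; last by rewrite mul0r.
  by move: lm; rewrite E => /mnm_lepP/(_ c); rewrite mnm1E eqxx (negbTE mc).
have cm : (U_(c) <= m)%MM.
  by apply/mnm_lepP => i; rewrite mnm1E; case: eqP => // <-.
have dU : (mdeg U_(c) < (mdeg m).+1)%N.
  by rewrite ltnS mdeg1; move: mc; rewrite mdegE (bigD1 c) //=; lia.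
rewrite (bigD1 (BMultinom dU)) //= eqxx mul1r big1 ?addr0 // => l /andP[_ nl].
by rewrite -(inj_eq val_inj) /= in nl; rewrite (negbTE nl) mul0r.
Qed.


Lemma mps_sumE (I : Type) (r : seq I) (P : pred I) (G : I -> mps k n) m :
  (\sum_(i <- r | P i) G i) m = \sum_(i <- r | P i) G i m.
Proof. by apply: (big_morph (fun h : mps k n => h m)). Qed.

Lemma mps_exp_low f d m : f 0%MM = 0 -> (mdeg m < d)%N -> (f ^+ d) m = 0.
Proof.
move=> f0; elim: d m => // d IH m md; rewrite exprS; apply: big1 => l lm.
have [->|l0] := eqVneq (l : 'X_{1..n}) 0%MM; first by rewrite f0 mul0r.
rewrite IH ?mulr0 //; move: l0; rewrite -mdeg_eq0; have := congr1 mdeg (submK lm).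
by rewrite mdegD; lia.
Qed.

Lemma mps_inverse f : f 0%MM = 1 -> exists g, f * g = 1.
Proof.
move=> f1; have [u [u0 fE]] : exists u : mps k n, u 0%MM = 0 /\ f = 1 - u.
  exists (1 - f); rewrite subKr; split=> //.
  by rewrite [LHS](_ : _ = @mps_const k n 1 0%MM - f 0%MM) // /mps_const eqxx f1 subrr.
(* Geometric series: the coefficient at [m] is read off from a partial sum long enough for the
   degree of [m]. *)
pose S d : mps k n := \sum_(i < d.+1) u ^+ i.
exists (fun m => S (mdeg m) m); apply/funext => m.
transitivity ((f * S (mdeg m)) m).
  apply: eq_bigr => l lm; congr (_ * _).
  have lm' : (mdeg (m - l)%MM <= mdeg m)%N by rewrite mdegB.
  rewrite /S !mps_sumE (big_ord_widen _ (fun i => (u ^+ i) (m - l)%MM) (lm' : _ < _.+1)%N).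
  rewrite big_mkcond; apply: eq_bigr => i _; case: ifP => // /negbT; rewrite -leqNgt => mi.
  by rewrite mps_exp_low.
have -> : f * S (mdeg m) = 1 - u ^+ (mdeg m).+1.
  by rewrite fE -[RHS]opprB subrX1 -mulNr opprB.
by rewrite [LHS](_ : _ = (1 : mps k n) m - (u ^+ (mdeg m).+1) m) // mps_exp_low // subr0.
Qed.

Section Diagonal.
Variables a b : 'I_n.
Hypothesis ab : a != b.
Local Notation d := (mps_var k a - mps_var k b).

Definition diag (m : 'X_{1..n}) (r t : nat) : 'X_{1..n} :=
  [multinom if l == a then r else if l == b then t else m l | l < n].

(* The substitution x_b := x_a. *)
Definition identify f : mps k n := fun m =>
  if m b == 0%N then \sum_(t < (m a).+1) f (diag m (m a - t) t) else 0.

Lemma identifyB f g : identify (f - g) = identify f - identify g.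
Proof.
apply/funext => m; rewrite [RHS](_ : _ = identify f m - identify g m) // /identify.
by case: ifP => _; rewrite ?subr0 // -sumrB.
Qed.

Let ba : (b == a) = false. Proof. by rewrite eq_sym (negbTE ab). Qed.

Lemma identify_var c f :
  identify (mps_var k c * f) = mps_var k (if c == b then a else c) * identify f.
Proof.
apply/funext => m; rewrite mps_var_mul /identify.
under eq_bigr do rewrite mps_var_mul.
have [->|cb] := eqVneq c b.
  rewrite !mnmE eqxx (negbTE ab) subn0; case: (m b == 0%N); last by rewrite if_same.
  rewrite big_ord_recl mnmE ba eqxx ltnn add0r; case: ifP => ma; last first.
    by rewrite (_ : m a = 0%N) ?big_ord0 //; lia.
  rewrite subn1 prednK //; apply: eq_bigr => t _; rewrite /bump /=.
  rewrite mnmE ba eqxx /=; congr f; apply/mnmP => l; rewrite !mnmE.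
  have [->|la] := eqVneq l a; first by rewrite ba /bump; lia.
  by have [_|lb] := eqVneq l b; rewrite ?subn0 ?eqxx /bump; lia.
rewrite !mnmE (negbTE cb) subn0; case: (m b == 0%N); last by rewrite if_same.
have [->|ca] := eqVneq c a.
  rewrite big_ord_recr /= mnmE eqxx subnn ltnn addr0; case: ifP => ma; last first.
    by rewrite (_ : m a = 0%N) ?big_ord0 //; lia.
  rewrite subn1 prednK //; apply: eq_bigr => t _.
  rewrite mnmE eqxx subn_gt0 ltn_ord; congr f; apply/mnmP => l; rewrite !mnmE.
  have [_|la] := eqVneq l a; first by lia.
  by case: (l == b); rewrite subn0.
rewrite subn0; case: ifP => mc.
  apply: eq_bigr => t _; rewrite mnmE ?(negbTE ca) ?(negbTE cb) mc; congr f.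
  apply/mnmP => l; rewrite !mnmE.
  have [->|la] := eqVneq l a; first by rewrite (negbTE ca); lia.
  by have [->|lb] := eqVneq l b; rewrite ?(negbTE cb); lia.
by apply: big1 => t _; rewrite mnmE (negbTE ca) (negbTE cb) mc.
Qed.

Lemma identify_diff f : identify (d * f) = 0.
Proof. by rewrite mulrBl identifyB !identify_var eqxx (negbTE ab) subrr. Qed.

Lemma diff_mul f m : (d * f) m =
  (if (0 < m a)%N then f (m - U_(a))%MM else 0) - (if (0 < m b)%N then f (m - U_(b))%MM else 0).
Proof. by rewrite mulrBl -!mps_var_mul. Qed.

Lemma identify_eq0 f : identify f = 0 -> exists g, f = d * g.
Proof.
(* Division by x_a - x_b is solved along the monomials with a fixed sum of exponents at [a] and [b]:
   [g] collects partial sums of [f], and [identify f = 0] says that the full sum vanishes. The 1 is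
   the degree lost by division. *)
move=> f0; pose g (q : 'X_{1..n}) := \sum_(s < (q b).+1) f (diag q (q a + q b + 1 - s) s).
exists g; apply/funext => m; rewrite diff_mul.
have -> : (if (0 < m b)%N then g (m - U_(b))%MM else 0) =
    \sum_(s < m b) f (diag m (m a + m b - s) s).
  case: ifP => mb; last by rewrite (_ : m b = 0%N) ?big_ord0 //; lia.
  rewrite /g !mnmE eqxx ba subn1 prednK //; apply: eq_bigr => s _; congr f.
  apply/mnmP => l; rewrite !mnmE; have [_|la] := eqVneq l a; first by lia.
  by have [_|lb] := eqVneq l b; rewrite ?subn0.
have fm : f m = f (diag m (m a) (m b)).
  by congr f; apply/mnmP => l; rewrite !mnmE; case: eqP => [->|] //; case: eqP => [->|].
case: ifP => ma.
  rewrite /g !mnmE eqxx (negbTE ab) subn0 big_ord_recr /= addrAC.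
  rewrite (_ : _ - _ = 0) ?add0r.
    rewrite fm; congr f; apply/mnmP => l; rewrite !mnmE; have [_|la] := eqVneq l a; first by lia.
    by case: (l == b); rewrite ?subn0.
  apply/eqP; rewrite subr_eq0; apply/eqP; apply: eq_bigr => s _; congr f.
  apply/mnmP => l; rewrite !mnmE; have [_|la] := eqVneq l a; first by lia.
  by case: (l == b); rewrite ?subn0.
have a0 : m a = 0%N by lia.
have := congr1 (fun h : mps k n => h (diag m (m b) 0)) f0.
rewrite /identify !mnmE ba !eqxx big_ord_recr /= subnn => E.
rewrite sub0r fm a0; apply/eqP; rewrite -subr_eq0 opprK addrC; apply/eqP; rewrite -[RHS]E.
congr (_ + _); last by congr f; apply/mnmP => l; rewrite !mnmE; case: eqP => // _; case: eqP.
apply: eq_bigr => s _; congr f; apply/mnmP => l; rewrite !mnmE.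
by case: eqP => // _; case: eqP.
Qed.

(** The coefficient at m + U_a gives f m = f (m + U_a - U_b), or f m = 0 if x_b does not occur in m;
    hence induction on the exponent of x_b, over any ring. *)
Lemma diff_regular f : d * f = 0 -> f = 0.
Proof.
move=> E; apply/funext => m; move Er: (m b) => r; elim: r m Er => [|r IH] m mb.
  have := congr1 (fun h : mps k n => h (m + U_(a))%MM) E.
  by rewrite diff_mul !mnmE eqxx (negbTE ab) addn1 /= addn0 mb /= addmK subr0.
have := congr1 (fun h : mps k n => h (m + U_(a))%MM) E.
rewrite diff_mul !mnmE eqxx (negbTE ab) addn1 /= addn0 mb /= addmK => /eqP.
rewrite subr_eq0 => /eqP ->; apply: IH; rewrite !mnmE eqxx (negbTE ab) mb; lia.
Qed.

(** The substitution x_b := x_a makes [f] and its transpose equal; on coefficients this reverses the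
    order of summation. *)
Lemma tperm_diff f : exists g, f - mps_perm (tperm a b) f = d * g.
Proof.
apply: identify_eq0; rewrite identifyB; apply/eqP; rewrite subr_eq0; apply/eqP.
apply/funext => m; rewrite /identify; case: ifP => // /eqP mb.
rewrite (reindex_inj rev_ord_inj); apply: eq_bigr => t _.
congr f; apply/mnmP => l; rewrite !mnmE permE /= subSS.
have := ltn_ord t; have [_|la] := eqVneq l a; first by rewrite ba eqxx; lia.
by have [_|lb] := eqVneq l b; rewrite ?eqxx ?(negbTE la) ?(negbTE lb) //; lia.
Qed.

End Diagonal.

(** The substitution x_b := x_a kills the right-hand side and turns x_p - x_q into a difference of
    distinct variables, which is regular; so it kills [f] as well. *)
Lemma diff_regular_mod a b p q f g : a != b -> p != q -> (p, q) != (a, b) -> (p, q) != (b, a) ->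
  (mps_var k p - mps_var k q) * f = (mps_var k a - mps_var k b) * g ->
  exists h, f = (mps_var k a - mps_var k b) * h.
Proof.
move=> ab pq n1 n2 E; apply: (identify_eq0 ab).
have := congr1 (identify a b) E; rewrite identify_diff // mulrBl identifyB !identify_var //.
rewrite -mulrBl; apply: diff_regular; move: n1 n2; rewrite !xpair_eqE.
have [pb|pb] := eqVneq p b; have [qb|qb] := eqVneq q b; rewrite ?andbT ?andbF //=.
  by rewrite pb qb eqxx in pq.
by rewrite eq_sym.
Qed.

End PowerSeriesPerm.

(** * Localization *)

Section Localization.
Local Open Scope ring_scope.

Lemma divrE (L : comUnitRingType) (z u v : L) : v \is a GRing.unit -> z * v = u -> z = u / v.
Proof. by move=> vu <-; rewrite mulrK. Qed.

(** Universal property. Two fractions for one element have the same image, since the kernel of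
    [iota] is killed by denominators, which become units. *)
Lemma localization_lift (A : comNzRingType) (S : A -> Prop) (L B : comUnitRingType)
    (iota : {rmorphism A -> L}) (g : {rmorphism A -> B}) : is_localization S iota ->
  (forall s, S s -> g s \is a GRing.unit) ->
  exists phi : {rmorphism L -> B}, forall a, phi (iota a) = g a.
Proof.
case=> Su Ss Sk gu.
have ker a b : iota a = iota b -> g a = g b.
  move=> ab; have /Sk[s [sS E]] : iota (a - b) = 0 by rewrite rmorphB ab subrr.
  apply/eqP; rewrite -subr_eq0 -rmorphB; apply/eqP/(mulrI (gu _ sS)).
  by rewrite -rmorphM E rmorph0 mulr0.
have frac z : exists w : B, exists a s, [/\ iota s \is a GRing.unit, g s \is a GRing.unit,
    z * iota s = iota a & w * g s = g a].
  have [a [s [sS ->]]] := Ss z; exists (g a / g s), a, s.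
  by rewrite !divrK ?Su ?gu.
have [phi phiP] := choice frac.
have phiE z a s : iota s \is a GRing.unit -> g s \is a GRing.unit -> z * iota s = iota a ->
    phi z = g a / g s.
  move=> su gs E; apply: divrE gs _.
  have [a' [s' [su' gs' E' F']]] := phiP z; apply: (mulIr gs').
  rewrite mulrAC F' -!rmorphM; apply: ker; rewrite !rmorphM -E -E'; ring.
have phi_zmod : zmod_morphism phi.
  move=> z w; have [a [s [su gs E F]]] := phiP z; have [b [t [tu gt E' F']]] := phiP w.
  have Ez : (z - w) * iota (s * t) = iota (a * t - b * s).
    by rewrite rmorphB !rmorphM -E -E' /=; ring.
  rewrite (phiE _ _ _ _ _ Ez) ?rmorphM ?unitrM ?su ?gs ?tu ?gt //.
  apply/esym/divrE; first by rewrite unitrM gs.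
  by rewrite rmorphB !rmorphM -F -F' /=; ring.
have phi_monoid : monoid_morphism phi.
  split=> [|z w]; first by rewrite (phiE _ 1 1) ?rmorph1 ?unitr1 ?mulr1 ?divr1.
  have [a [s [su gs E F]]] := phiP z; have [b [t [tu gt E' F']]] := phiP w.
  have Ez : (z * w) * iota (s * t) = iota (a * b) by rewrite !rmorphM -E -E' /=; ring.
  rewrite (phiE _ _ _ _ _ Ez) ?rmorphM ?unitrM ?su ?gs ?tu ?gt //.
  apply/esym/divrE; first by rewrite unitrM gs.
  by rewrite -F -F'; ring.
pose phiM : {rmorphism L -> B} := HB.pack phi (GRing.isZmodMorphism.Build L B phi phi_zmod)
  (GRing.isMonoidMorphism.Build L B phi phi_monoid).
exists phiM => a /=; by rewrite (phiE _ a 1) ?rmorph1 ?unitr1 ?mulr1 ?divr1.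
Qed.

Lemma localization_ext (A : comNzRingType) (S : A -> Prop) (L B : comUnitRingType)
    (iota : {rmorphism A -> L}) (f g : {rmorphism L -> B}) : is_localization S iota ->
  (forall a, f (iota a) = g (iota a)) -> f =1 g.
Proof.
by case=> Su Ss _ fg z; have [a [s [sS ->]]] := Ss z; rewrite !rmorph_div ?Su // !fg.
Qed.

Variables (k : comNzRingType) (N : nat) (L : comUnitRingType).
Variable iota : {rmorphism mps k N -> L}.
Hypothesis hL : is_localization (@denominator k N) iota.
Implicit Types (a b p q : 'I_N) (s t : 'S_N) (f g : mps k N) (z w : L).

Local Notation dif a b := (@mps_var k N a - @mps_var k N b).

Lemma denominator_pairs f : denominator f -> exists r : seq ('I_N * 'I_N),
  all (fun x : 'I_N * 'I_N => (x.1 < x.2)%N) r /\ f = \prod_(x <- r) dif x.1 x.2.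
Proof.
pose Q f := exists r : seq ('I_N * 'I_N),
  all (fun x : 'I_N * 'I_N => (x.1 < x.2)%N) r /\ f = \prod_(x <- r) dif x.1 x.2.
have Q1 : Q 1 by exists [::]; rewrite big_nil.
have QM f1 f2 : Q f1 -> Q f2 -> Q (f1 * f2).
  by move=> [r [rP ->]] [r' [rP' ->]]; exists (r ++ r'); rewrite all_cat rP big_cat.
case=> e ->; rewrite -/(Q _).
apply: (big_ind Q) => // i _; apply: (big_ind Q) => // j ij.
elim: (e i j) => // d IH; rewrite exprS; apply: QM => //.
by exists [:: (i, j)]; rewrite /= ij big_seq1.
Qed.

Lemma denominator_diff a b : (a < b)%N -> denominator (dif a b).
Proof.
move=> ab; exists (fun i j => (i == a) && (j == b) : nat).
rewrite (bigD1 a) //= (bigD1 b) //= !eqxx expr1 big1 ?mulr1; last first.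
  by move=> j /andP[_ /negbTE->]; rewrite expr0.
rewrite big1 ?mulr1 // => i /negbTE ia; apply: big1 => j _; by rewrite ia expr0.
Qed.

Lemma iota_unit a b : a != b -> iota (dif a b) \is a GRing.unit.
Proof.
have key p q : (p < q)%N -> iota (dif p q) \is a GRing.unit.
  by move=> pq; case: hL => Su _ _; apply: Su; apply: denominator_diff.
rewrite neq_ltn => /orP[]; first exact: key.
by move=> /key; rewrite -unitrN -rmorphN opprB.
Qed.

Lemma iota_inj : injective iota.
Proof.
move=> f g fg; case: hL => _ _ /(_ (f - g)) []; first by rewrite rmorphB fg subrr.
move=> d [/denominator_pairs[r [rP ->]] E]; apply/eqP; rewrite -subr_eq0; apply/eqP.
elim: r rP E => [|x r IH] /=; first by rewrite big_nil mul1r.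
case/andP=> xP rP; rewrite big_cons -mulrA => /diff_regular E; apply: IH => //; apply: E.
by rewrite neq_ltn xP.
Qed.

(** [D] is not a zero divisor modulo [d]. *)
Definition regular_mod (d D : mps k N) : Prop :=
  forall f g, D * f = d * g -> exists h, f = d * h.

Lemma regular_mod1 d : regular_mod d 1.
Proof. by move=> f g; rewrite mul1r => ->; exists g. Qed.

Lemma regular_modM d D E : regular_mod d D -> regular_mod d E -> regular_mod d (D * E).
Proof. by move=> rD rE f g; rewrite -mulrA => /rD[h] /rE. Qed.

(* The series x_a - x_b need not be prime when k is not a domain: the
   denominators allowed in the local ring at it are those regular modulo it. *)
Definition integral_at a b z : Prop :=
  exists D f, regular_mod (dif a b) D /\ z * iota D = iota f.

Definition divisible_at a b z : Prop := integral_at a b (z / iota (dif a b)).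

Section At.
Variables a b : 'I_N.
Hypothesis ab : a != b.

Lemma integral_iota f : integral_at a b (iota f).
Proof. by exists 1, f; rewrite rmorph1 mulr1; split=> //; apply: regular_mod1. Qed.

Lemma integralB z w : integral_at a b z -> integral_at a b w -> integral_at a b (z - w).
Proof.
move=> [D [f [rD Ef]]] [E [g [rE Eg]]]; exists (D * E), (f * E - g * D).
by split; [exact: regular_modM | rewrite rmorphB !rmorphM -Ef -Eg /=; ring].
Qed.

Lemma integralM z w : integral_at a b z -> integral_at a b w -> integral_at a b (z * w).
Proof.
move=> [D [f [rD Ef]]] [E [g [rE Eg]]]; exists (D * E), (f * g).
by split; [exact: regular_modM | rewrite !rmorphM -Ef -Eg /=; ring].
Qed.

Lemma integral0 : integral_at a b 0.
Proof. by rewrite -(rmorph0 iota); apply: integral_iota. Qed.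

Lemma integral1 : integral_at a b 1.
Proof. by rewrite -(rmorph1 iota); apply: integral_iota. Qed.

Lemma integralD z w : integral_at a b z -> integral_at a b w -> integral_at a b (z + w).
Proof.
move=> zP wP; rewrite -[w]opprK; apply: integralB => //; rewrite -sub0r.
by apply: integralB => //; apply: integral0.
Qed.

Lemma integralX z n : integral_at a b z -> integral_at a b (z ^+ n).
Proof.
by move=> zP; elim: n => [|n IH]; [exact: integral1 | rewrite exprS; apply: integralM].
Qed.

Lemma integralXz z (n : int) : integral_at a b z -> integral_at a b z^-1 -> integral_at a b (z
  ^ n).
Proof.
case: n => n zP zV; first exact: integralX.
by rewrite NegzE -exprz_inv; apply: integralX.
Qed.

Lemma integral_sum (I : Type) (r : seq I) (P : pred I) (G : I -> L) :
  (forall i, P i -> integral_at a b (G i)) -> integral_at a b (\sum_(i <- r | P i) G i).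
Proof. by move=> GP; apply: big_ind GP; [exact: integral0 | exact: integralD]. Qed.

Lemma integral_prod (I : Type) (r : seq I) (P : pred I) (G : I -> L) :
  (forall i, P i -> integral_at a b (G i)) -> integral_at a b (\prod_(i <- r | P i) G i).
Proof. by move=> GP; apply: big_ind GP; [exact: integral1 | exact: integralM]. Qed.

Lemma iota_series_unit f : f 0%MM = 1 -> iota f \is a GRing.unit.
Proof. by case/mps_inverse => g /(congr1 iota); rewrite rmorphM rmorph1 => E; apply/unitrP;
  exists (iota g); rewrite mulrC. Qed.

Lemma integral_series_inv f : f 0%MM = 1 -> integral_at a b (iota f)^-1.
Proof.
move=> f1; have [g /(congr1 iota)] := mps_inverse f1; rewrite rmorphM rmorph1 => E.
rewrite (_ : _^-1 = iota g); first exact: integral_iota.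
by apply: (mulrI (iota_series_unit f1)); rewrite E divrr ?iota_series_unit.
Qed.

Lemma integral_diff_inv p q : p != q -> (p, q) != (a, b) -> (p, q) != (b, a) ->
  integral_at a b (iota (dif p q))^-1.
Proof.
move=> pq n1 n2; exists (dif p q), 1; rewrite mulVr ?iota_unit // rmorph1; split=> //.
by move=> f g; apply: diff_regular_mod.
Qed.

Lemma divisibleM z w : divisible_at a b z -> integral_at a b w -> divisible_at a b (z * w).
Proof. by move=> zP wP; rewrite /divisible_at mulrAC; apply: integralM. Qed.

Lemma divisibleD z w : divisible_at a b z -> divisible_at a b w -> divisible_at a b (z + w).
Proof. by move=> zP wP; rewrite /divisible_at mulrDl; apply: integralD. Qed.

Lemma divisible_iota f g : f = dif a b * g -> divisible_at a b (iota f).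
Proof.
move=> ->; rewrite /divisible_at rmorphM mulrAC mulrV ?iota_unit // mul1r.
exact: integral_iota.
Qed.

Lemma divisible_integral z : divisible_at a b z -> integral_at a b z.
Proof.
by move=> zP; rewrite -[z](divrK (iota_unit ab)); apply/(integralM zP)/integral_iota.
Qed.

(** Units congruent to 1 modulo x_a - x_b. The condition on the inverse makes the notion stable
    under negative powers. *)
Definition unity_at z : Prop :=
  [/\ z \is a GRing.unit, divisible_at a b (z - 1) & divisible_at a b (z^-1 - 1)].

Lemma unity1 : unity_at 1.
Proof. by split; rewrite ?invr1 ?unitr1 // subrr /divisible_at mul0r; apply: integral0. Qed.

Lemma unity_integral z : unity_at z -> integral_at a b z.
Proof.
by case=> _ /divisible_integral zP _; rewrite -(subrK 1 z); apply/integralD/integral1.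
Qed.

Lemma unityV z : unity_at z -> unity_at z^-1.
Proof. by case=> zu zP zV; split; rewrite ?unitrV ?invrK. Qed.

Lemma unityM z w : unity_at z -> unity_at w -> unity_at (z * w).
Proof.
have key x y : divisible_at a b (x - 1) -> unity_at y -> divisible_at a b (x * y - 1).
  move=> xP yP; rewrite (_ : _ - _ = (x - 1) * y + (y - 1)); last by ring.
  by apply: divisibleD; [apply/(divisibleM xP)/unity_integral | case: yP].
move=> zP wP; have [zu z1 zV] := zP; have [wu w1 wV] := wP; split.
- by rewrite unitrM zu.
- exact: key.
- by rewrite invrM //; apply: (key _ _ wV); apply: unityV.
Qed.

Lemma unity_prod (I : Type) (r : seq I) (P : pred I) (G : I -> L) :
  (forall i, P i -> unity_at (G i)) -> unity_at (\prod_(i <- r | P i) G i).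
Proof. by move=> GP; apply: big_ind GP; [exact: unity1 | exact: unityM]. Qed.

Lemma unityXz z (n : int) : unity_at z -> unity_at (z ^ n).
Proof.
have key x m : unity_at x -> unity_at (x ^+ m).
  by move=> xP; elim: m => [|m IH]; [exact: unity1 | rewrite exprS; apply: unityM].
by move=> zP; case: n => n; rewrite ?NegzE -?exprz_inv; apply: key => //; apply: unityV.
Qed.

Lemma unity_div u v : u \is a GRing.unit -> v \is a GRing.unit ->
  integral_at a b u^-1 -> integral_at a b v^-1 -> divisible_at a b (u - v) -> unity_at (u / v).
Proof.
move=> uu vu iu iv uv; split; first by rewrite unitrM uu unitrV.
  by rewrite -(divrr vu) -mulrBl; apply: divisibleM.
rewrite invrM ?unitrV // invrK -(divrr uu) -mulrBl -opprB mulNr -mulrN.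
by apply: (divisibleM uv); rewrite -sub0r; apply/integralB/iu/integral0.
Qed.

End At.

(** The factors of a denominator are cancelled one at a time: integrality of [z] at a factor shows
    that some [D], regular modulo it, times the numerator is divisible by it, hence so is the
    numerator. *)
Lemma integral_everywhere z : (forall a b, (a < b)%N -> integral_at a b z) ->
  exists f, z = iota f.
Proof.
move=> zP; have [f [r [rP zr]]] : exists f (r : seq ('I_N * 'I_N)),
    all (fun x : 'I_N * 'I_N => (x.1 < x.2)%N) r /\
    z * iota (\prod_(x <- r) dif x.1 x.2) = iota f.
  case: (hL) => Su Ss _; have [f [d [dS ->]]] := Ss z; exists f.
  by have [r [rP dE]] := denominator_pairs dS; exists r; rewrite -dE divrK ?Su.
elim: r f rP zr => [|x r IH] f; first by rewrite big_nil rmorph1 mulr1; exists f.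
case/andP=> xP rP; rewrite big_cons rmorphM => zr.
have [D [g [rD Eg]]] := zP _ _ xP.
have [|h fE] := rD f (g * \prod_(x <- r) dif x.1 x.2).
  by apply: iota_inj; rewrite !rmorphM -zr -Eg /=; ring.
apply: (IH h rP); have xn : x.1 != x.2 by rewrite neq_ltn xP.
by apply: (mulrI (iota_unit xn)); rewrite -rmorphM -fE -zr; ring.
Qed.

Section Action.
Variable phi : 'S_N -> {rmorphism L -> L}.
Hypothesis phiE : forall s f, phi s (iota f) = iota (mps_perm s f).

Lemma actM s t z : phi (t * s)%g z = phi s (phi t z).
Proof.
apply: (localization_ext (f := phi (t * s)%g) (g := (phi s \o phi t)) hL) => f.
by rewrite /= !phiE mps_permM.
Qed.

Lemma act1 z : phi 1%g z = z.
Proof.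
apply: (localization_ext (f := phi 1%g) (g := idfun) hL) => f.
by rewrite /= !phiE mps_perm1.
Qed.

Lemma act_generated z : (forall i j : 'I_N, j = i.+1 :> nat -> phi (tperm i j) z = z) ->
  forall s, phi s z = z.
Proof.
move=> adj s; have tp d a b : (a + d)%N = b -> phi (tperm a b) z = z.
  elim: d a b => [|d IH] a b E.
    have -> : b = a by apply: val_inj; rewrite /= -E addn0.
    by rewrite tperm1 act1.
  have cN : (a + d < N)%N by have := ltn_ord b; lia.
  pose c := Ordinal cN; have ca := IH a c erefl.
  have bc := adj c b; have {}bc : phi (tperm c b) z = z by apply: bc; rewrite /=; lia.
  have [Ea|ac] := eqVneq a c; first by rewrite Ea.
  have ab : a != b by apply/eqP => F; move: E; rewrite F; lia.
  (* Here [c] is b - 1: conjugation by an adjacent transposition lengthens the distance by 1. *)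
  have -> : tperm a b = (tperm c b * tperm a c * tperm c b)%g.
    by rewrite -{1}[tperm c b]tpermV -mulgA -/(conjg _ _) tpermJ tpermL tpermD // eq_sym.
  by rewrite !actM bc ca bc.
have tp2 (a b : 'I_N) : phi (tperm a b) z = z.
  by have [ab|ab] := leqP a b; [|rewrite tpermC]; apply: tp (subnKC _) => //; apply: ltnW.
have [ts -> _] := prod_tpermP s.
by elim: ts => [|x ts IH]; rewrite ?big_nil ?act1 // big_cons actM tp2.
Qed.

Lemma regular_mod_perm s a b D : regular_mod (dif a b) D ->
  regular_mod (dif (s a) (s b)) (mps_perm s D).
Proof.
move=> rD f g E; have [|h fE] := rD (mps_perm s^-1%g f) (mps_perm s^-1%g g).
  have := congr1 (mps_perm s^-1%g) E.
  by rewrite !rmorphM rmorphB /= !mps_perm_var !permK -mps_permM mulgV mps_perm1.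
exists (mps_perm s h); have := congr1 (mps_perm s) fE.
by rewrite rmorphM rmorphB /= !mps_perm_var -mps_permM mulVg mps_perm1.
Qed.

Lemma integral_act s a b z : integral_at a b z -> integral_at (s a) (s b) (phi s z).
Proof.
move=> [D [f [rD E]]]; exists (mps_perm s D), (mps_perm s f).
by split; [exact: regular_mod_perm | rewrite -!phiE -E rmorphM].
Qed.

(** A pair a < b is the image of (a, a + 1) under the transposition of a + 1 and b, so invariance
    carries integrality from adjacent pairs to all. *)
Lemma symmetric_integral z :
  (forall i j : 'I_N, j = i.+1 :> nat -> phi (tperm i j) z = z) ->
  (forall i j : 'I_N, j = i.+1 :> nat -> integral_at i j z) ->
  exists f, mps_symmetric f /\ iota f = z.
Proof.
move=> adj int; have sym := act_generated adj.
have [a b ab|f zE] := integral_everywhere _ (z := z).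
  have jN : (a.+1 < N)%N by have := ltn_ord b; lia.
  pose j := Ordinal jN; rewrite -(sym (tperm j b)).
  have := integral_act (tperm j b) (int a j erefl); rewrite tpermL tpermD //.
    by apply/eqP => /(congr1 val) /=; lia.
  by apply/eqP => E; move: ab; rewrite E; lia.
exists f; split=> // s; apply: iota_inj.
by rewrite -phiE -zE sym.
Qed.

End Action.

Lemma act_exists : exists phi : 'S_N -> {rmorphism L -> L},
  forall s f, phi s (iota f) = iota (mps_perm s f).
Proof.
suff /choice[phi phiP] : forall s, exists phi : {rmorphism L -> L},
  forall f, phi (iota f) = iota (mps_perm s f) by exists phi.
move=> s; apply: (localization_lift (g := (iota \o mps_perm s)) hL) => d.
case/denominator_pairs => r [rP ->] /=; rewrite !rmorph_prod.
elim: r rP => [|x r IH] /=; first by rewrite big_nil unitr1.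
case/andP=> xP rP; rewrite big_cons unitrM IH // andbT !rmorphB /= -!/(mps_perm s _)
  !mps_perm_var -rmorphB.
by rewrite iota_unit // (inj_eq perm_inj) neq_ltn xP.
Qed.

End Localization.

(** * Weights of Euler characteristics *)

Section Weight.
Local Open Scope ring_scope.

Lemma exprNz (K : unitRingType) (x : K) (n : int) : (- x) ^ n = (-1) ^ n * x ^ n.
Proof.
case: n => n; first exact: exprNn.
by rewrite !NegzE -!exprz_inv invrN invrN1 -[in LHS]exprnP exprNn.
Qed.

Lemma exprz_div (K : comUnitRingType) (x y : K) (n : int) :
  x \is a GRing.unit -> y \is a GRing.unit -> (x / y) ^ n = x ^ n / y ^ n.
Proof.
move=> xu yu; rewrite exprMz_comm ?unitrV ?exprz_inv ?invr_expz //.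
exact: mulrC.
Qed.

Variables (k : comNzRingType) (N : nat) (L : comUnitRingType) (beta : nat -> nat -> k).
Variable iota : {rmorphism mps k N -> L}.
Hypothesis hL : is_localization (@denominator k N) iota.
Implicit Types (a b l m : 'I_N) (u : 'I_N -> int) (v : 'I_N -> 'I_N -> int).

Local Notation dif a b := (@mps_var k N a - @mps_var k N b).
Local Notation p a b := (@p_series k N beta a b).

Lemma mps_perm_diff (s : 'S_N) a b : mps_perm s (dif a b) = dif (s a) (s b).
Proof. by rewrite rmorphB /= !mps_perm_var. Qed.

Lemma p_series0 a b : p a b 0%MM = 1.
Proof.
rewrite /p_series (introT forallP) /p_coef ?mnm0E ?eqxx // => l.
by rewrite mnm0E eqxx implybT.
Qed.

Let pu a b : iota (p a b) \is a GRing.unit.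
Proof. exact/iota_series_unit/p_series0. Qed.

Definition pair_factor u v a b : L :=
  iota (p a b) ^ u a * iota (p b a) ^ u b / iota (dif a b) ^ v a b.

(** The last product of the evaluation with free exponents. It is multiplicative in them, so a
    change of Euler characteristics factors out. *)
Definition weight u v : L := \prod_(a < N) \prod_(b < N | (a < b)%N) pair_factor u v a b.

Lemma pair_factor0 u v a b : u a = 0 -> u b = 0 -> v a b = 0 -> pair_factor u v a b = 1.
Proof. by rewrite /pair_factor => -> -> ->; rewrite !expr0z invr1 !mulr1. Qed.

Lemma weight_ext u v u' v' : (forall l, u l = u' l) -> (forall l m, v l m = v' l m) ->
  weight u v = weight u' v'.
Proof.
by move=> uu vv; apply: eq_bigr => a _; apply: eq_bigr => b _; rewrite /pair_factor !uu vv.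
Qed.

Lemma weightD u v u' v' : weight (fun l => u l + u' l) (fun l m => v l m + v' l m) =
  weight u v * weight u' v'.
Proof.
rewrite -big_split; apply: eq_bigr => a _; rewrite -big_split; apply: eq_bigr => b ab.
have du : iota (dif a b) \is a GRing.unit by apply: iota_unit; rewrite // neq_ltn ab.
by rewrite /pair_factor !exprzDr // invrM ?unitrXz //= ; ring.
Qed.

Lemma weight_sum (I : Type) (r : seq I) (U : I -> 'I_N -> int) (V : I -> 'I_N -> 'I_N -> int) :
  weight (fun l => \sum_(C <- r) U C l) (fun l m => \sum_(C <- r) V C l m) =
  \prod_(C <- r) weight (U C) (V C).
Proof.
elim: r => [|C r IH].
  rewrite big_nil; apply: big1 => a _; apply: big1 => b _.
  by rewrite pair_factor0 ?big_nil.
rewrite big_cons -IH -weightD; apply: weight_ext => *; exact: big_cons.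
Qed.

Section Adjacent.
Variables i j : 'I_N.
Hypothesis ij : j = i.+1 :> nat.
Let ij_neq : i != j.
Proof. by apply/eqP => E; move: ij; rewrite E; lia. Qed.
Let lt_ij : (i < j)%N. Proof. by rewrite ij. Qed.

(** The transposition permutes the pairs and reverses only (i, j), whose factor x_j - x_i
    contributes the sign. *)
Lemma weight_act (phi : 'S_N -> {rmorphism L -> L}) u v :
  (forall s f, phi s (iota f) = iota (mps_perm s f)) -> v j i = v i j ->
  phi (tperm i j) (weight u v) = (-1) ^ v i j *
    weight (fun l => u (tperm i j l)) (fun l m => v (tperm i j l) (tperm i j m)).
Proof.
move=> phiE vji; set s := tperm i j; set u' := fun l => _; set v' := fun l m => _.
have [u'E v'E] : (forall l, u' (s l) = u l) /\ (forall l m, v' (s l) (s m) = v l m).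
  by split=> *; rewrite /u' /v' !tpermK.
have [v'ij v'ji] : v' i j = v i j /\ v' j i = v i j.
  by have := v'E i j; have := v'E j i; rewrite /s tpermL tpermR => -> ->.
clearbody u' v'.
have act a b : (a < b)%N -> phi s (pair_factor u v a b) = pair_factor u' v' (s a) (s b).
  move=> ab; have du : iota (dif a b) \is a GRing.unit by apply: iota_unit; rewrite // neq_ltn ab.
  rewrite rmorph_div ?unitrXz // rmorphM !rmorphXz // !phiE !mps_perm_p_series mps_perm_diff.
  by rewrite /pair_factor !u'E v'E.
have Sji : pair_factor u' v' j i = (-1) ^ v i j * pair_factor u' v' i j.
  rewrite /pair_factor v'ij v'ji.
  rewrite -[dif j i]opprB rmorphN exprNz invrM ?unitrXz ?unitrN1 ?iota_unit //.
  have -> : ((-1 : L) ^ v i j)^-1 = (-1) ^ v i j by rewrite invr_expz -exprz_inv invrN1.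
  ring.
rewrite /weight rmorph_prod (eq_bigr (fun a => \prod_(b < N | (a < b)%N)
  pair_factor u' v' (s a) (s b))); last first.
  by move=> a _; rewrite rmorph_prod; apply: eq_bigr => b; apply: act.
move: (pair_factor u' v') Sji => S Sji.
have split2 S' : \prod_(a < N) \prod_(b < N | (a < b)%N) S' a b =
    S' i j * (\prod_(l < N | (l != i) && (l != j))
       (if (l < i)%N then S' l i * S' l j else S' i l * S' j l) *
     \prod_(a < N | (a != i) && (a != j)) \prod_(b < N | [&& b != i, b != j & (a < b)%N]) S' a b)
  := big_pairs_adjacent _ S' ij.
rewrite !split2 [RHS]mulrA {split2}; congr (_ * (_ * _)).
- by rewrite /s tpermL tpermR.
- apply: eq_bigr => l /andP[li lj]; rewrite /s tpermL tpermR tpermD 1?eq_sym //.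
  by case: ifP => _; rewrite mulrC.
apply: eq_bigr => a /andP[ai aj]; apply: eq_bigr => b /and3P[bi bj _].
by rewrite /s !tpermD 1?eq_sym.
Qed.

Let divisible_tperm f f' : mps_perm (tperm i j) f = f' ->
  divisible_at iota i j (iota f - iota f').
Proof.
move=> <-; rewrite -rmorphB; have [g E] := tperm_diff ij_neq f.
exact: divisible_iota E.
Qed.

(** For exponents antisymmetric in i and j, the factors combine into powers of quotients of a series
    by its transpose, such as p_il / p_jl, and each quotient is congruent to 1 modulo x_i - x_j. *)
Lemma weight_unity u v : (forall l, l != i -> l != j -> u l = 0) -> u i = - u j ->
  v i j = 0 -> (forall l, l != i -> l != j -> v l i = - v l j) ->
  (forall l, l != i -> l != j -> v i l = - v j l) ->
  (forall l m, l != i -> l != j -> m != i -> m != j -> v l m = 0) ->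
  unity_at iota i j (weight u v).
Proof.
move=> u0 uij vij vl vr v0; rewrite /weight (big_pairs_adjacent _ _ ij) /=.
have puni a b a' b' : mps_perm (tperm i j) (p a b) = p a' b' ->
    unity_at iota i j (iota (p a b) / iota (p a' b')).
  by move=> E; apply: unity_div => //; do ?[exact/integral_series_inv/p_series0];
    apply: divisible_tperm.
have duni a b a' b' : a != b -> a' != b' -> (a, b) != (i, j) -> (a, b) != (j, i) ->
    (a', b') != (i, j) -> (a', b') != (j, i) ->
    mps_perm (tperm i j) (dif a b) = dif a' b' ->
    unity_at iota i j (iota (dif a b) / iota (dif a' b')).
  move=> *; apply: unity_div; rewrite ?iota_unit //; last exact: divisible_tperm.
    exact: integral_diff_inv.
  exact: integral_diff_inv.
apply: unityM => //.
  rewrite /pair_factor vij expr0z invr1 mulr1 uij -invr_expz mulrC -exprz_div //.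
  by apply: unityXz => //; apply: puni; rewrite mps_perm_p_series tpermL tpermR.
apply: unityM => //; apply: unity_prod => // l /andP[li lj]; last first.
  apply: unity_prod => // m /and3P[mi mj _]; rewrite pair_factor0 ?u0 ?v0 //.
  exact: unity1.
have il : i != l by rewrite eq_sym.
have jl : j != l by rewrite eq_sym.
have nl (x y : 'I_N) : (l, x) != (i, y) /\ (l, x) != (j, y) by rewrite !xpair_eqE !negb_and li lj.
have nr (x y : 'I_N) : (x, l) != (y, i) /\ (x, l) != (y, j) by rewrite !xpair_eqE !negb_and li
  lj !orbT.
have alg (A A' B B' : L) (n m : int) : A \is a GRing.unit -> A' \is a GRing.unit ->
    B \is a GRing.unit -> B' \is a GRing.unit ->
    unity_at iota i j (A / A') -> unity_at iota i j (B / B') ->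
    unity_at iota i j (A ^ (- n) / B ^ (- m) * (A' ^ n / B' ^ m)).
  move=> Au A'u Bu B'u AA BB; rewrite (_ : _ * _ = (A / A') ^ (- n) * (B / B') ^ m).
    by apply: unityM => //; apply: unityXz.
  by rewrite !exprz_div // !invr_expz !opprK; ring.
case: ifP => _; rewrite /pair_factor ?(vl _ li lj) ?(vr _ li lj) uij !(u0 _ li lj) !expr0z
  ?mul1r ?mulr1.
  apply: alg; rewrite ?iota_unit //; first by apply: puni;
    rewrite mps_perm_p_series tpermL tpermD.
  apply: duni => //; do ?[exact: (nl _ _).1 | exact: (nl _ _).2].
  by rewrite mps_perm_diff tpermL tpermD.
apply: alg; rewrite ?iota_unit //; first by apply: puni; rewrite mps_perm_p_series tpermL tpermD.
apply: duni => //; do ?[exact: (nr _ _).1 | exact: (nr _ _).2].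
by rewrite mps_perm_diff tpermL tpermD.
Qed.

Lemma weight_integral u v : integral_at iota i j (weight u v * iota (dif i j) ^ v i j).
Proof.
have pint a b n : integral_at iota i j (iota (p a b) ^ n).
  by apply: integralXz; [exact: integral_iota | exact/integral_series_inv/p_series0].
have gen a b : (a < b)%N -> (a != i) || (b != j) -> integral_at iota i j (pair_factor u v a b).
  move=> ab nij; have anb : a != b by rewrite neq_ltn ab.
  apply: integralM; first by apply: integralM.
  rewrite invr_expz -exprz_inv; apply: integralXz; rewrite ?invrK.
    apply: integral_diff_inv => //; first by rewrite xpair_eqE negb_and.
    rewrite xpair_eqE; apply/negP => /andP[/eqP E /eqP E']; move: ab; rewrite E E'; lia.
  exact: integral_iota.
rewrite /weight (bigD1 i) //= (bigD1 j) //= mulrC !mulrA; apply: integralM.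
  apply: integralM.
    by rewrite mulrC -!mulrA mulKr ?unitrXz ?iota_unit //; apply: integralM.
  by apply: integral_prod => b /andP[ab bj]; apply: gen; rewrite ?bj ?orbT.
by apply: integral_prod => a ai; apply: integral_prod => b ab; apply: gen; rewrite ?ai.
Qed.

End Adjacent.
End Weight.

(** * The evaluation *)

Section Spheres.
Local Open Scope ring_scope.
Variables (R : realType) (N : nat) (F : prefoam R) (hF : is_foam F N).
Variables i j : 'I_N.
Implicit Types (c : {ffun facet F -> {set 'I_N}}) (f : facet F) (G C : {set facet F}).
Implicit Types (H : {set {set facet F}}).

Local Notation kempe := (kempe i j).
Local Notation mixed c := (mixed_facets c i j).

Lemma kempeK G : involutive (kempe G).
Proof.
move=> c; apply/ffunP => f; rewrite !ffunE; case: (f \in G) => //.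
by apply/setP => l; rewrite !mem_imset_tperm tpermK.
Qed.

Lemma mixed_kempe G c : mixed (kempe G c) = mixed c.
Proof.
apply/setP => f; rewrite !mixedE ffunE; case: ifP => // _.
by rewrite !mem_imset_tperm tpermL tpermR addbC.
Qed.

Lemma kempe_mixedE c f : kempe (mixed c) c f = tperm i j @: c f.
Proof.
rewrite ffunE mixedE; case: ifP => // /negbT E; apply/setP => l.
by rewrite mem_imset_tperm; case: tpermP => // ->; move: E; do 2!case: (_ \in _).
Qed.

Lemma coloring_card c f : is_coloring c -> #|c f| = thickness f.
Proof. by case/andP => /forallP/(_ f)/eqP. Qed.

Definition spheres c : {set {set facet F}} :=
  [set C in components (mixed c) | euler (region C) == 2].

(** Tells the two colorings of a component apart by one facet, whose choice depends on [C] alone.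
    Exactly one of i and j colors it, so the exchange flips the value; components are nonempty, so
    the default does not occur. *)
Definition has_upper c C : bool := if [pick f in C] is Some f then i \in c f else true.

Definition lower_spheres c : {set {set facet F}} := [set C in spheres c | ~~ has_upper c C].

Lemma sphereP c C : C \in spheres c -> C \in components (mixed c) /\ euler (region C) = 2.
Proof. by rewrite inE => /andP[-> /eqP]. Qed.

Lemma spheres_sub c H : H \subset spheres c -> H \subset components (mixed c).
Proof. by move=> Hs; apply/subsetP => C /(subsetP Hs)/sphereP[]. Qed.

Lemma spheres_kempe G c : spheres (kempe G c) = spheres c.
Proof. by rewrite /spheres mixed_kempe. Qed.

Lemma has_upper_kempe c H C : H \subset spheres c -> C \in spheres c ->
  has_upper (kempe (cover H) c) C = has_upper c C (+) (C \in H).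
Proof.
move=> Hs /sphereP[CM _]; rewrite /has_upper; case: pickP => [f fC|C0]; last first.
  have [/and3P[_ _ /negP[]]] := components_partition (mixed c).
  by rewrite (_ : set0 = C) //; apply/esym/setP => f; rewrite inE C0.
have fM := subsetP (component_sub CM) f fC.
have -> : C \in H = (f \in cover H).
  apply/idP/bigcupP => [CH|[D DH fD]]; first by exists C.
  by rewrite (component_unique CM _ fC fD) // (subsetP (spheres_sub Hs)).
rewrite ffunE; case: ifP => _; last by rewrite addbF.
by rewrite mem_imset_tperm tpermL; move: fM; rewrite mixedE; do 2!case: (_ \in _).
Qed.

Lemma lower_spheres_sub c : lower_spheres c \subset spheres c.
Proof. by apply/subsetP => C; rewrite [in X in X -> _]inE => /andP[]. Qed.

Lemma lower_kempe c H : H \subset spheres c -> lower_spheres c = set0 ->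
  lower_spheres (kempe (cover H) c) = H.
Proof.
move=> Hs c0; apply/setP => C; have := in_set0 C; rewrite -c0.
rewrite /lower_spheres spheres_kempe.
rewrite [in X in X -> _]in_set [in X in _ -> X = _]in_set.
case CS: (C \in spheres c) => /= => [/negbFE up|_].
  by rewrite has_upper_kempe // up addTb negbK.
by apply/esym/negP => /(subsetP Hs); rewrite CS.
Qed.

Definition raise c := kempe (cover (lower_spheres c)) c.

Lemma lower_raise c : lower_spheres (raise c) = set0.
Proof.
apply/setP => C; rewrite in_set0 /raise [LHS]in_set spheres_kempe.
case CS: (C \in spheres c) => //=; rewrite has_upper_kempe ?lower_spheres_sub //.
by rewrite [C \in lower_spheres c]in_set CS; case: (has_upper c C).
Qed.

Lemma cover_kempe_coloring c H : is_coloring c -> H \subset spheres c ->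
  is_coloring (kempe (cover H) c).
Proof. by move=> hc Hs; apply: (kempe_coloring hF hc (cover_closed (spheres_sub Hs))). Qed.

(* Swaps on spherical components of the surface F_ij act freely on colorings, and
   every orbit contains exactly one coloring without lower spheres. *)
Lemma sum_colorings (V : nmodType) (E : {ffun facet F -> {set 'I_N}} -> V) :
  \sum_(c | is_coloring c) E c =
  \sum_(c | is_coloring c && (lower_spheres c == set0))
    \sum_(H : {set {set facet F}} | H \subset spheres c) E (kempe (cover H) c).
Proof.
rewrite (partition_big raise (fun c => is_coloring c && (lower_spheres c == set0))) /=;
  last first.
  by move=> c hc; rewrite lower_raise eqxx andbT cover_kempe_coloring ?lower_spheres_sub.
apply: eq_bigr => c0 /andP[hc0 /eqP low0].
rewrite (reindex_onto (fun H => kempe (cover H) c0) lower_spheres) /=; last first.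
  by move=> c /andP[_ /eqP <-]; rewrite /raise kempeK.
apply: eq_bigl => H; apply/idP/idP => [/andP[/andP[_ _] /eqP <-]|Hs].
  by rewrite -(spheres_kempe (cover H) c0) lower_spheres_sub.
by rewrite cover_kempe_coloring //= /raise lower_kempe // kempeK !eqxx.
Qed.

(** A component has even Euler characteristic at most 2, so one that is not a sphere contributes at
    most 0. *)
Lemma half_chi2_le c : is_coloring c -> (half_chi2 c i j <= #|spheres c|%:Z)%R.
Proof.
move=> hc; suff : half_chi2 c i j * 2 <= #|spheres c|%:Z * 2 by lia.
rewrite /half_chi2 divz2K ?(surface2_even hF) // -region_mixed.
have := components_partition (mixed c) => /cover_partition <-.
rewrite (euler_cover (i := i) (j := j) hF hc (subxx _)).
apply: (@le_trans _ _ (\sum_(C in components (mixed c)) (C \in spheres c)%:R * 2)).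
  apply: ler_sum => C CM; have := euler_component hF hc CM.
  have := region_even hF hc (component_closed_facets CM).
  rewrite [C \in spheres c]in_set CM /= => ev; rewrite le_eqVlt => /orP[/eqP->//|lt].
  rewrite (lt_eqF lt) mul0r; move: ev lt; rewrite /oddz; lia.
rewrite -mulr_suml (_ : \sum_(C in _) _ = #|spheres c|%:Z) //.
rewrite -natz -sum1_card natr_sum [RHS]big_mkcond [LHS]big_mkcond; apply: eq_bigr => C _.
by case CS: (C \in spheres c); rewrite ?if_same // (sphereP CS).1.
Qed.

End Spheres.

Lemma prodr_addr (K : comNzRingType) (I : finType) (A : {set I}) (X Y : I -> K) :
  (\prod_(x in A) (X x + Y x) =
   \sum_(J : {set I} | J \subset A) \prod_(x in A) (if x \in J then X x else Y x))%R.
Proof.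
rewrite big_mkcond (eq_bigr (fun x => (if x \in A then X x else 0) +
  (if x \in A then Y x else 1))%R); last by move=> x _; case: ifP; rewrite ?add0r.
rewrite bigA_distr [RHS]big_mkcond; apply: eq_big => // J _.
case: ifP => [/subsetP JA|/negbT/subsetPn[x xJ xA]].
  rewrite [RHS]big_mkcond; apply: eq_bigr => x _.
  by case: ifP => [/JA->|] //.
by rewrite (bigD1 x) //= xJ (negbTE xA) mul0r.
Qed.

(** * Symmetry and integrality of the evaluation *)

Section FoamEvaluation.
Local Open Scope ring_scope.
Variables (R : realType) (N : nat) (F : foam R N).
Variables (k : comNzRingType) (gr : grading k) (beta : nat -> nat -> k) (P : dots F gr).
Variables (L : comUnitRingType) (iota : {rmorphism mps k N -> L}).
Hypothesis hL : is_localization (@denominator k N) iota.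
Implicit Types (c : {ffun facet F -> {set 'I_N}}) (f : facet F).
Let hF : is_foam F N := foamP F.

Local Notation dif a b := (@mps_var k N a - @mps_var k N b).
Local Notation E := (coloring_eval beta P iota).
Local Notation P_at c f := (eval_at (P f) (c f)).

Lemma coloring_evalE c : E c = (-1) ^+ oddz (sign_exp c) *
  (\prod_f iota (P_at c f)) * weight beta iota (half_chi1 c) (half_chi2 c).
Proof. by rewrite -exprz_sign. Qed.

Variables i j : 'I_N.
Hypothesis ij : j = i.+1 :> nat.
Let ij_neq : i != j. Proof. by apply/eqP => H; move: ij; rewrite H; lia. Qed.

Local Notation kempe := (kempe i j).
Local Notation mixed c := (mixed_facets c i j).

Lemma half_chi2C c a b : half_chi2 c a b = half_chi2 c b a.
Proof.
by rewrite /half_chi2; congr (euler _ %/ 2)%Z; apply/setP => t; rewrite !surface2E addbC.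
Qed.

Lemma mps_perm_P_at c f : is_coloring c ->
  mps_perm (tperm i j) (P_at c f) = eval_at (P f) (tperm i j @: c f).
Proof. by move=> hc; rewrite mps_perm_eval_at ?dot_sym ?coloring_card. Qed.

(** The sign from x_j - x_i has exponent chi_ij / 2, and by [kempe_sign] this is the change of the
    sign exponent modulo 2 when all of F_ij is exchanged. *)
Lemma act_coloring_eval (phi : 'S_N -> {rmorphism L -> L}) c :
  (forall s g, phi s (iota g) = iota (mps_perm s g)) -> is_coloring c ->
  phi (tperm i j) (E c) = E (kempe (mixed c) c).
Proof.
move=> phiE hc; rewrite !coloring_evalE !rmorphM /=.
rewrite (weight_act _ hL ij _ phiE) ?(half_chi2C c j i) //.
rewrite [oddz _ in RHS](kempe_sign hF hc ij (closed_mixed _ _ _)) region_mixed.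
rewrite exprz_sign signr_addb rmorphXn rmorphN1 rmorph_prod.
have chi1 l : half_chi1 (kempe (mixed c) c) l = half_chi1 c (tperm i j l).
  by rewrite /half_chi1; congr (euler _ %/ 2)%Z; apply/setP => t;
    rewrite !inE kempe_mixedE mem_imset_tperm.
have chi2 l m : half_chi2 (kempe (mixed c) c) l m = half_chi2 c (tperm i j l) (tperm i j m).
  by rewrite /half_chi2; congr (euler _ %/ 2)%Z; apply/setP => t;
    rewrite !surface2E kempe_mixedE !mem_imset_tperm.
rewrite (weight_ext beta iota chi1 chi2).
have -> : \prod_f phi (tperm i j) (iota (P_at c f)) =
    \prod_f iota (P_at (kempe (mixed c) c) f).
  by apply: eq_bigr => f _; rewrite phiE mps_perm_P_at // kempe_mixedE.
by rewrite mulrACA mulrA.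
Qed.

Lemma act_foam_eval (phi : 'S_N -> {rmorphism L -> L}) :
  (forall s g, phi s (iota g) = iota (mps_perm s g)) ->
  phi (tperm i j) (foam_eval beta P iota) = foam_eval beta P iota.
Proof.
move=> phiE; rewrite /foam_eval rmorph_sum /=.
have swapK : involutive (fun c => kempe (mixed c) c).
  by move=> c; rewrite mixed_kempe kempeK.
rewrite [RHS](reindex_inj (inv_inj swapK)) /=; apply: eq_big => [c|c hc].
  have cm (d : {ffun facet F -> {set 'I_N}}) : is_coloring d -> is_coloring (kempe (mixed d) d).
    by move=> hd; exact: (kempe_coloring hF hd (closed_mixed d i j)).
  by apply/idP/idP => [/cm //|/cm]; rewrite swapK.
exact: act_coloring_eval.
Qed.

Section Fixed.
Variable c : {ffun facet F -> {set 'I_N}}.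
Hypothesis hc : is_coloring c.
Local Notation S := (spheres i j c).

Definition sphere_weight C : L := weight beta iota (shift1 c i j C) (shift2 c i j C).

Lemma sphere_weight_unity C : C \in S -> unity_at iota i j (sphere_weight C).
Proof.
case/sphereP => CM _; have Cc := component_closed_facets CM.
have K := shift2K hF hc Cc; have sym l m : surface2 c l m = surface2 c m l.
  by apply/setP => t; rewrite !surface2E addbC.
apply: weight_unity => //.
- by move=> l; apply: shift1_0.
- exact: shift1_opp.
- by have := K i j; rewrite tpermL tpermR (sym j i) subrr; lia.
- move=> l li lj; have := K l i; have := K l j; rewrite tpermL tpermR tpermD 1?eq_sym //; lia.
- move=> l li lj; have := K i l; have := K j l; rewrite tpermL tpermR tpermD 1?eq_sym //; lia.
move=> l m li lj mi mj; have := K l m; rewrite !tpermD 1?eq_sym // subrr; lia.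
Qed.

(** A sphere has chi / 2 = 1, so each exchanged sphere contributes a factor -1. As the other changes
    also split over the spheres, the sum over [H] expands a product of two-term sums. *)
Lemma kempe_eval (H : {set {set facet F}}) : H \subset S ->
  E (kempe (cover H) c) = (-1) ^+ oddz (sign_exp c) *
    weight beta iota (half_chi1 c) (half_chi2 c) *
    (\prod_(f | f \notin cover S) iota (P_at c f)) *
    \prod_(C in S) (if C \in H
      then - sphere_weight C * \prod_(f in C) iota (mps_perm (tperm i j) (P_at c f))
      else \prod_(f in C) iota (P_at c f)).
Proof.
move=> Hs; have HM := spheres_sub Hs.
rewrite coloring_evalE [oddz _ in LHS](kempe_sign hF hc ij (cover_closed HM)) signr_addb.
move: (oddz (sign_exp c)) => e.
have -> : (euler (region (cover H)) %/ 2)%Z = #|H|.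
  rewrite (euler_cover hF hc HM) (eq_bigr (fun=> 2)) ?sumr_const.
    by rewrite -mulr_natr natz; lia.
  by move=> C /(subsetP Hs)/sphereP[].
have -> : weight beta iota (half_chi1 (kempe (cover H) c)) (half_chi2 (kempe (cover H) c)) =
    weight beta iota (half_chi1 c) (half_chi2 c) * \prod_(C in H) sphere_weight C.
  rewrite -big_enum /= -weight_sum // -weightD //; apply: weight_ext => [l|l m].
    by rewrite (half_chi1_kempe hF hc (cover_closed HM)) (shift1_cover hF hc _ HM) big_enum.
  by rewrite (half_chi2_kempe hF hc (cover_closed HM)) (shift2_cover hF hc _ _ HM) big_enum.
have tS : trivIset S.
  have /and3P[_ + _] := components_partition (mixed c).
  by apply: trivIsetS; apply: spheres_sub.
rewrite (bigID (mem (cover S))) /= (big_trivIset _ tS) /= oddz_nat signr_odd.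
have HS C f : C \in S -> f \in C -> (f \in cover H) = (C \in H).
  move=> CS fC; apply/bigcupP/idP => [[D DH fD]|CH]; last by exists C.
  by rewrite (component_unique (sphereP CS).1 _ fC fD) // (subsetP HM).
pose B (C : {set facet F}) := \prod_(f in C) iota (mps_perm (tperm i j) (P_at c f)).
pose A (C : {set facet F}) := \prod_(f in C) iota (P_at c f).
rewrite (eq_bigr (fun C => if C \in H then B C else A C)); last first.
  move=> C CS; case CH: (C \in H); apply: eq_bigr => f fC; rewrite ffunE (HS C) // CH //.
  by rewrite mps_perm_P_at.
rewrite (eq_bigr (fun f => iota (P_at c f))); last first.
  move=> f fS; rewrite ffunE; case: ifP => // /bigcupP[C CH fC]; case/negP: fS.
  by apply/bigcupP; exists C; rewrite // (subsetP Hs).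
have -> : \prod_(C in S) (if C \in H then - sphere_weight C * B C else A C) =
    (-1) ^+ #|H| * \prod_(C in H) sphere_weight C * \prod_(C in S) (if C \in H then B C else A C).
  rewrite -prodrN [X in _ = X * _](_ : _ = \prod_(C in S) (if C \in H then - sphere_weight C
    else 1)).
    by rewrite -big_split; apply: eq_bigr => C _ /=; case: ifP; rewrite ?mul1r.
  rewrite -big_mkcondr; apply: eq_bigl => C.
  by rewrite andbC; apply/esym/andb_idr/(subsetP Hs).
have alg (x h W X Y Z : L) : x * h * (Y * Z) * (W * X) = x * W * Z * (h * X * Y) by ring.
exact: alg.
Qed.

(** Each sphere yields one factor x_i - x_j, while the pole of the weight has order chi_ij / 2, at
    most the number of spheres; [n] is the surplus. *)
Lemma sphere_sum_integral :
  integral_at iota i j (\sum_(H : {set {set facet F}} | H \subset S) E (kempe (cover H) c)).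
Proof.
rewrite (eq_bigr _ kempe_eval) -big_distrr /= -prodr_addr.
pose D (C : {set facet F}) : L :=
  - sphere_weight C * \prod_(f in C) iota (mps_perm (tperm i j) (P_at c f)) +
  \prod_(f in C) iota (P_at c f).
have Ddiv C : C \in S -> divisible_at iota i j (D C).
  move=> CS; rewrite /D; set B := \prod_(f in C) _; set A := \prod_(f in C) _.
  (* [A] and [B] agree modulo x_i - x_j by [tperm_diff], and the weight of a sphere is congruent to
     1. *)
  have -> : - sphere_weight C * B + A = (A - B) + - (sphere_weight C - 1) * B by ring.
  have [_ wC _] := sphere_weight_unity CS; apply: divisibleD.
    have [g gE] := tperm_diff ij_neq (\prod_(f in C) P_at c f).
    rewrite (_ : A - B = iota (dif i j * g)); first exact: divisible_iota.
    by rewrite -gE rmorphB !rmorph_prod.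
  rewrite mulNr -mulrN; apply: (divisibleM wC); rewrite -sub0r;
    apply: integralB (integral0 _ _ _) _.
  by apply: integral_prod => f _; apply: integral_iota.
have du : iota (dif i j) \is a GRing.unit by apply: iota_unit.
rewrite [\prod_(C in S) _](_ : _ = iota (dif i j) ^ #|S| * \prod_(C in S) (D C / iota (dif i
  j))); last first.
  rewrite -exprnP -prodr_const -big_split; apply: eq_bigr => C _ /=.
  by rewrite [RHS]mulrC divrK.
have [n nE] : exists n, #|S| = half_chi2 c i j + n%:Z :> int.
  exists `|#|S|%:Z - half_chi2 c i j|%N; have := half_chi2_le hF i j hc; lia.
rewrite nE exprzDr // -exprnP; have WI := weight_integral beta hL ij (half_chi1 c) (half_chi2 c).
rewrite (_ : forall e W Z X Y T : L, e * W * Z * (X * Y * T) = e * Z * (W * X) * Y * T);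
  last first.
  by move=> e W Z X Y T; ring.
apply: integralM; last by apply: integral_prod => C; apply: Ddiv.
apply: integralM; last by apply: integralX; apply: integral_iota.
apply: integralM => //; apply: integralM; last by apply: integral_prod => f _;
  apply: integral_iota.
by apply: integralX; rewrite -(rmorphN1 iota); apply: integral_iota.
Qed.

End Fixed.

Lemma foam_eval_integral : integral_at iota i j (foam_eval beta P iota).
Proof.
rewrite /foam_eval (sum_colorings hF i j); apply: integral_sum => c /andP[hc _].
exact: sphere_sum_integral.
Qed.

End FoamEvaluation.

Local Open Scope ring_scope.

Theorem theorem2p3 (R : realType) (k : comNzRingType) (gr : grading k)
    (beta : nat -> nat -> k)
    (hbeta : forall a b : nat, (a, b) <> (0%N, 0%N) ->
       homogeneous gr (- (2 * (a + b))%:Z) (beta a b))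
    (N : nat) (hN : (1 <= N)%N) (F : foam R N) (P : dots F gr)
    (L : comUnitRingType) (iota : {rmorphism mps k N -> L})
    (hL : is_localization (@denominator k N) iota) :
  exists G : mps k N, mps_symmetric G /\ iota G = foam_eval beta P iota.
Proof.
have [phi phiE] := act_exists hL.
apply: (symmetric_integral hL phiE) => i j ij.
  by apply: act_foam_eval.
exact: foam_eval_integral.
Qed.
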